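(* (Algorithmic reconstruction of a Ricci-flat metric from its projective class.) We work in a small neighborhood $U\subset\mathbb{R}^4$. Let $\Gamma=\Gamma^i_{jk}$ be a symmetric affine connection on $U$, let $W$ be its projective Weyl tensor, and assume that for all $1$-forms $\xi_i\neq0$ one has $W^a{}_{jk\ell}\,\xi_a\ne0$ (at every point of $U$). At each point consider the homogeneous linear system on symmetric matrices $a_{ij}$: $$a_{is}W^s{}_{jkm}+a_{js}W^s{}_{ikm}=0,\qquad a_{is}W^s{}_{jkm}-a_{ks}W^s{}_{mij}=0.\qquad(\mathrm{A})$$ For a nondegenerate field $a_{ij}$ of solutions of $(\mathrm{A})$ with inverse $a^{ij}$, let $(\mathrm{B})$ be the system obtained by substituting the ansatz $\sigma^{ij}=e^{\lambda}a^{ij}$, with unknown function $\lambda$, into the system $(\mathrm{E})$ of the context; it is an inhomogeneous system of linear equations on the components $\partial\lambda/\partial x^i$. Then: (1) The system $(\mathrm{A})$ has at every point no more than a one-dimensional space of solutions, and the system $(\mathrm{B})$ has at most one solution $\partial\lambda/\partial x^i$. (2) If there exists a nonflat Ricci-flat metric $\bar g$ in the projective class of $\Gamma$, then it is unique up to multiplication by a constant and can be found as follows: $\bar g_{ij}$ satisfies $(\mathrm{A})$, so solving $(\mathrm{A})$ gives the conformal class of $\bar g$; the system $(\mathrm{B})$ is then solvable and gives all $\partial\lambda/\partial x^i$; integration gives the function $\lambda$ and therefore, through $\bar g^{ij}\det(\bar g)^{1/5}=e^{\lambda}a^{ij}$, the metric $\bar g$. (3) The same steps check whether such a metric exists. If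 every solution of $(\mathrm{A})$ has zero determinant, or if $(\mathrm{B})$ has no solution, or if the $1$-form $\frac{\partial\lambda}{\partial x^i}dx^i$ obtained by solving $(\mathrm{B})$ is not closed, then no Ricci-flat metric exists in the projective class of $\Gamma$. (4) If $(\mathrm{A})$ has a nondegenerate solution, $(\mathrm{B})$ can be solved, and the solution satisfies the closedness condition $\frac{\partial}{\partial x^k}\frac{\partial\lambda}{\partial x^i}=\frac{\partial}{\partial x^i}\frac{\partial\lambda}{\partial x^k}$, then one obtains in this way a metric $g$, with $g^{ij}\det(g)^{1/5}=e^\lambda a^{ij}$, in the projective class of $\Gamma$; this metric need not be Ricci-flat.
   Context: Metrics are Riemannian or pseudo-Riemannian. A metric $g$ lies in the projective class of a symmetric affine connection $\Gamma$ if every geodesic of $g$ is a reparameterized geodesic of $\Gamma$; equivalently, the Levi-Civita connection of $g$ is $\Gamma^a_{bc}+\delta^a_b\phi_c+\delta^a_c\phi_b$ for some $1$-form $\phi$. With $R^i{}_{jk\ell}$ the curvature tensor of $\Gamma$ (skew-symmetric in $k,\ell$) and the convention $R_{jk}=R^a{}_{jka}$ for the Ricci tensor, the projective Weyl tensor in dimension $n$ is $$W^i{}_{jk\ell}=R^i{}_{jk\ell}-\tfrac{1}{n-1}\left(\delta^i_\ell R_{jk}-\delta^i_kR_{j\ell}\right);$$ here $n=4$. By Weyl, it does not depend on the choice of the connection within the projective class, and for a Ricci-flat metric it coincides with the Riemann curvature tensor. The system $(\mathrm{E})$, whose solutions of the form $\sigma^{ab}=g^{ab}\det(g)^{1/5}$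 correspond to the metrics $g$ in the projective class of $\Gamma$, is $$\nabla_a\sigma^{bc}-\tfrac15\left(\nabla_i\sigma^{ib}\,\delta^c_a+\nabla_i\sigma^{ic}\,\delta^b_a\right)=0,\qquad \nabla_a\sigma^{bc}:=\frac{\partial\sigma^{bc}}{\partial x^a}+\Gamma^b_{ad}\sigma^{dc}+\Gamma^c_{da}\sigma^{bd}-\tfrac25\,\Gamma^d_{da}\,\sigma^{bc}.\qquad(\mathrm{E})$$ Here $\sigma^{bc}$ is a symmetric weighted tensor (the last term in $\nabla_a\sigma^{bc}$ comes from the volume-form weight $2/5$), and $g^{ij}$ denotes the inverse of $g_{ij}$.
   Formalization: The displayed formula for W is projectively invariant only when the Ricci tensor is symmetric; for general Γ, (2) and (3) fail with it. The formal W adds Weyl's terms in R_{jk}−R_{kj}, which vanish for symmetric Ricci tensor. *)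

(* Defs.v *)
(* MathComp-Analysis; points of R^4 are row vectors.  A tensor field is a total
   function on R^4 of which only the values on the open set U matter. *)
From HB Require Import structures.
From mathcomp Require Import all_boot all_order all_algebra.
From mathcomp Require Import all_classical all_reals all_analysis.
Set Implicit Arguments.
Unset Strict Implicit.
Unset Printing Implicit Defensive.
Import Order.TTheory GRing.Theory Num.Theory.
Import numFieldNormedType.Exports.
Local Open Scope classical_set_scope.
Local Open Scope ring_scope.

(* ---------------------------- calculus on R^4 ---------------------------- *)

Definition pderiv (R : realType) (i : 'I_4) (f : 'rV[R]_4 -> R) (x : 'rV[R]_4) : R :=
  'D_(delta_mx 0 i) f x.

Fixpoint Ck (R : realType) (U : set 'rV[R]_4) (n : nat) (f : 'rV[R]_4 -> R) : Prop :=
  {in U, continuous f} /\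
  match n with
  | 0%N => True
  | m.+1 => forall i : 'I_4,
      (forall x, U x -> derivable f x (delta_mx 0 i)) /\ Ck U m (pderiv i f)
  end.

Definition smooth (R : realType) (U : set 'rV[R]_4) (f : 'rV[R]_4 -> R) : Prop :=
  forall n, Ck U n f.

Definition star_shaped (R : realType) (p : 'rV[R]_4) (U : set 'rV[R]_4) : Prop :=
  U p /\ forall x (t : R), U x -> 0 <= t <= 1 -> U (p + t *: (x - p)).

(* The "small neighborhoods": open sets star-shaped about one of their points
   (balls, convex open sets); closed 1-forms on them are exact. *)
Definition small_nbhd (R : realType) (p : 'rV[R]_4) (U : set 'rV[R]_4) : Prop :=
  open U /\ star_shaped p U.

(* 1-forms are fields of row vectors, [w x 0 i] being the component w_i at x. *)
Definition closed_form (R : realType) (U : set 'rV[R]_4)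
    (w : 'rV[R]_4 -> 'rV[R]_4) : Prop :=
  forall x, U x -> forall i k,
    pderiv k (fun y => w y 0 i) x = pderiv i (fun y => w y 0 k) x.

Definition potential (R : realType) (U : set 'rV[R]_4)
    (lam : 'rV[R]_4 -> R) (w : 'rV[R]_4 -> 'rV[R]_4) : Prop :=
  smooth U lam /\ forall x, U x -> forall i, pderiv i lam x = w x 0 i.

(* ------------------------- connections, curvature ------------------------ *)

(* [G x i j k] is Gamma^i_{jk} at x. *)
Definition conn (R : realType) : Type := 'rV[R]_4 -> 'I_4 -> 'I_4 -> 'I_4 -> R.

Definition symmetric_connection (R : realType) (U : set 'rV[R]_4) (G : conn R) : Prop :=
  (forall i j k, smooth U (fun x => G x i j k)) /\
  (forall x, U x -> forall i j k, G x i j k = G x i k j).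

(* R^i_{jkl}, skew in k, l, with the sign for which R_{jk} = R^a_{jka} is the
   usual Ricci tensor (positive on spheres). *)
Definition curvature (R : realType) (G : conn R) (x : 'rV[R]_4) (i j k l : 'I_4) : R :=
  pderiv l (fun y => G y i j k) x - pderiv k (fun y => G y i j l) x
  + \sum_a (G x i l a * G x a j k - G x i k a * G x a j l).

Definition ricci (R : realType) (G : conn R) (x : 'rV[R]_4) (j k : 'I_4) : R :=
  \sum_a curvature G x a j k a.

Definition weyl_sym (R : realType) (G : conn R) (x : 'rV[R]_4) (i j k l : 'I_4) : R :=
  curvature G x i j k l
  - 3%:R^-1 * ((i == l)%:R * ricci G x j k - (i == k)%:R * ricci G x j l).

(* [weyl_sym] is independent of the connection within the projective class only
   among connections with symmetric Ricci tensor.  For an arbitrary symmetric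
   connection Weyl's invariant tensor has, in dimension n, the additional term
     1/(n+1) delta^i_j S_{kl} + 1/(n^2-1) (delta^i_l S_{jk} - delta^i_k S_{jl})
   with S_{jk} = R_{jk} - R_{kj}; see [weylE] below. *)
Definition ricci_skew (R : realType) (G : conn R) (x : 'rV[R]_4) (j k : 'I_4) : R :=
  ricci G x j k - ricci G x k j.

Definition weyl (R : realType) (G : conn R) (x : 'rV[R]_4) (i j k l : 'I_4) : R :=
  weyl_sym G x i j k l
  + 5%:R^-1 * ((i == j)%:R * ricci_skew G x k l)
  + 15%:R^-1 * ((i == l)%:R * ricci_skew G x j k - (i == k)%:R * ricci_skew G x j l).

Lemma weylE (R : realType) (G : conn R) (x : 'rV[R]_4) :
  (forall j k, ricci G x j k = ricci G x k j) ->
  forall i j k l, weyl G x i j k l = weyl_sym G x i j k l.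
Proof.
move=> H i j k l; rewrite /weyl /ricci_skew (H k l) (H j k) (H j l) !subrr.
by rewrite !mulr0 subrr mulr0 !addr0.
Qed.

(* W^a_{jkl} xi_a <> 0 for every 1-form xi <> 0. *)
Definition nondegenerate_weyl (R : realType) (U : set 'rV[R]_4) (G : conn R) : Prop :=
  forall x, U x -> forall xi : 'rV[R]_4, xi != 0 ->
    exists j k l, \sum_a weyl G x a j k l * xi 0 a != 0.

(* --------------------------------- metrics ------------------------------- *)

Definition nondegenerate_field (R : realType) (U : set 'rV[R]_4)
    (g : 'rV[R]_4 -> 'M[R]_4) : Prop :=
  (forall i j, smooth U (fun x => g x i j)) /\
  (forall x, U x -> (g x)^T = g x /\ g x \in unitmx).

(* Of any signature. *)
Definition metric (R : realType) (U : set 'rV[R]_4) (g : 'rV[R]_4 -> 'M[R]_4) : Prop :=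
  nondegenerate_field U g.

Definition levi_civita (R : realType) (g : 'rV[R]_4 -> 'M[R]_4) : conn R :=
  fun x i j k => 2%:R^-1 * \sum_s invmx (g x) i s *
    (pderiv k (fun y => g y s j) x + pderiv j (fun y => g y s k) x
     - pderiv s (fun y => g y j k) x).

Definition in_projective_class (R : realType) (U : set 'rV[R]_4) (G : conn R)
    (g : 'rV[R]_4 -> 'M[R]_4) : Prop :=
  exists phi : 'rV[R]_4 -> 'rV[R]_4, forall x, U x -> forall a b c,
    levi_civita g x a b c =
      G x a b c + (a == b)%:R * phi x 0 c + (a == c)%:R * phi x 0 b.

Definition ricci_flat (R : realType) (U : set 'rV[R]_4) (g : 'rV[R]_4 -> 'M[R]_4) : Prop :=
  forall x, U x -> forall j k, ricci (levi_civita g) x j k = 0.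

Definition nonflat (R : realType) (U : set 'rV[R]_4) (g : 'rV[R]_4 -> 'M[R]_4) : Prop :=
  exists x, U x /\ exists i j k l, curvature (levi_civita g) x i j k l <> 0.

(* The real fifth root, odd in x: det g < 0 in Lorentzian signature. *)
Definition root5 (R : realType) (x : R) : R := Num.sg x * `|x| `^ 5%:R^-1.

(* sigma^{ij} = g^{ij} det(g)^{1/5} *)
Definition sigma_of (R : realType) (g : 'M[R]_4) : 'M[R]_4 :=
  root5 (\det g) *: invmx g.

(* --------------------------- the systems (A), (E), (B) ------------------- *)

Definition solA (R : realType) (G : conn R) (x : 'rV[R]_4) (a : 'M[R]_4) : Prop :=
  [/\ a^T = a,
      forall i j k m, \sum_s a i s * weyl G x s j k m
                      + \sum_s a j s * weyl G x s i k m = 0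
    & forall i j k m, \sum_s a i s * weyl G x s j k m
                      - \sum_s a k s * weyl G x s m i j = 0].

Definition nondegenerate_solA (R : realType) (U : set 'rV[R]_4) (G : conn R)
    (a : 'rV[R]_4 -> 'M[R]_4) : Prop :=
  nondegenerate_field U a /\ forall x, U x -> solA G x (a x).

(* nabla_a sigma^{bc} at x, from the value [s] of sigma and the values [ds a] of
   its partial derivatives at x. *)
Definition nabla (R : realType) (G : conn R) (x : 'rV[R]_4)
    (s : 'M[R]_4) (ds : 'I_4 -> 'M[R]_4) (a b c : 'I_4) : R :=
  ds a b c + \sum_d G x b a d * s d c + \sum_d G x c d a * s b d
  - 2%:R / 5%:R * (\sum_d G x d d a) * s b c.

Definition E_lhs (R : realType) (G : conn R) (x : 'rV[R]_4)
    (s : 'M[R]_4) (ds : 'I_4 -> 'M[R]_4) (a b c : 'I_4) : R :=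
  nabla G x s ds a b c
  - 5%:R^-1 * ((\sum_i nabla G x s ds i i b) * (c == a)%:R
               + (\sum_i nabla G x s ds i i c) * (b == a)%:R).

Definition pderiv_mx (R : realType) (s : 'rV[R]_4 -> 'M[R]_4) (x : 'rV[R]_4)
    (a : 'I_4) : 'M[R]_4 := \matrix_(b, c) pderiv a (fun y => s y b c) x.

Definition systemE (R : realType) (G : conn R) (x : 'rV[R]_4)
    (s : 'rV[R]_4 -> 'M[R]_4) : Prop :=
  forall a b c, E_lhs G x (s x) (pderiv_mx s x) a b c = 0.

(* (E) for sigma = e^lam a^{-1} at x, divided by e^lam, with the row vector w in
   place of the gradient of lam; see [systemEB] below. *)
Definition systemB (R : realType) (G : conn R) (a : 'rV[R]_4 -> 'M[R]_4)
    (x : 'rV[R]_4) (w : 'rV[R]_4) : Prop :=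
  forall k b c,
    E_lhs G x (invmx (a x))
      (fun d => w 0 d *: invmx (a x) + pderiv_mx (fun y => invmx (a y)) x d) k b c = 0.

Definition solB (R : realType) (U : set 'rV[R]_4) (G : conn R)
    (a : 'rV[R]_4 -> 'M[R]_4) (w : 'rV[R]_4 -> 'rV[R]_4) : Prop :=
  forall x, U x -> systemB G a x (w x).

Lemma nablaZ (R : realType) (G : conn R) x (t : R) (s : 'M[R]_4) ds a b c :
  nabla G x (t *: s) (fun d => t *: ds d) a b c = t * nabla G x s ds a b c.
Proof.
rewrite /nabla !mxE mulrBr !mulrDr !mulr_sumr; congr (_ + _ + _ - _).
- by apply: eq_bigr => d _; rewrite !mxE mulrCA.
- by apply: eq_bigr => d _; rewrite !mxE mulrCA.
- by rewrite mulrCA.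
Qed.

Lemma E_lhsZ (R : realType) (G : conn R) x (t : R) (s : 'M[R]_4) ds a b c :
  E_lhs G x (t *: s) (fun d => t *: ds d) a b c = t * E_lhs G x s ds a b c.
Proof.
rewrite /E_lhs nablaZ.
have H c' : \sum_i nabla G x (t *: s) (fun d => t *: ds d) i i c' =
            t * \sum_i nabla G x s ds i i c'.
  by rewrite mulr_sumr; apply: eq_bigr => i _; rewrite nablaZ.
rewrite !H; move: (nabla _ _ _ _ _ _ _) (\sum_i _) (\sum_i _) => u v w.
by rewrite mulrBr (mulrCA t) !mulrDr !mulrA.
Qed.

Lemma systemEB (R : realType) (G : conn R) (a : 'rV[R]_4 -> 'M[R]_4)
    (lam : 'rV[R]_4 -> R) (x : 'rV[R]_4) :
  differentiable lam x ->
  (forall i b c, derivable (fun y => invmx (a y) b c) x (delta_mx 0 i)) ->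
  systemE G x (fun y => expR (lam y) *: invmx (a y)) <->
  systemB G a x (\row_i pderiv i lam x).
Proof.
move=> dl da.
have de : differentiable (@expR R) (lam x).
  by apply/derivable1_diffP; apply: derivable_expR.
have dc : differentiable (expR \o lam) x by apply: differentiable_comp.
have dE i : derivable (expR \o lam) x (delta_mx 0 i) by apply: diff_derivable.
have -> : systemE G x (fun y => expR (lam y) *: invmx (a y)) <->
  forall k b c, expR (lam x) * E_lhs G x (invmx (a x))
   (fun d => (\row_i pderiv i lam x) 0 d *: invmx (a x)
             + pderiv_mx (fun y => invmx (a y)) x d) k b c = 0; last first.
  split=> H k b c; last by rewrite H mulr0.
  by apply: (mulfI (lt0r_neq0 (expR_gt0 (lam x)))); rewrite H mulr0.
rewrite /systemE.
have -> : pderiv_mx (fun y => expR (lam y) *: invmx (a y)) x =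
  fun d => expR (lam x) *: ((\row_i pderiv i lam x) 0 d *: invmx (a x)
             + pderiv_mx (fun y => invmx (a y)) x d).
  apply/funext => d; apply/matrixP => b c; rewrite !mxE /pderiv.
  have -> : (fun y => (expR (lam y) *: invmx (a y)) b c) =
     (expR \o lam) * (fun y => invmx (a y) b c).
    by apply/funext => y; rewrite mxE.
  rewrite deriveM //.
  have -> : 'D_(delta_mx 0 d) (expR \o lam) x = expR (lam x) * 'D_(delta_mx 0 d) lam x.
    rewrite !deriveE //.
    rewrite diff_comp //= diff1E //.
    by rewrite derive1E (@derive_val _ _ _ _ _ _ _ (is_derive_expR _)) mulrC.
  rewrite /= /GRing.scale /= mulrDr addrC; congr (_ + _).
  by rewrite mulrC -mulrA.
by split=> H k b c; have := H k b c; rewrite E_lhsZ.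
Qed.

(* Main.v *)
Require Import Defs.
From HB Require Import structures.
From mathcomp Require Import all_boot all_order all_algebra.
From mathcomp Require Import all_classical all_reals all_analysis.
From mathcomp Require complex.
From mathcomp Require Import perm ring lra.
Set Implicit Arguments.
Unset Strict Implicit.
Unset Printing Implicit Defensive.
Import Order.TTheory GRing.Theory Num.Theory.
Import numFieldNormedType.Exports.
Local Open Scope classical_set_scope.
Local Open Scope ring_scope.

(* Lowering an index of the Weyl tensor W with a solution a of (A) gives a tensor
   with the pair symmetries of a Riemann tensor.  Hence W preserves the kernel of
   every solution modulo itself.  If b is a solution of rank 2, then modulo ker b
   the endomorphisms W(., z, w) are multiples of one fixed traceless map; pairing
   them with a second solution a, skew-symmetry and the vanishing trace
   W^i_{jki} = 0 leave only multiples of b.  Rank 1 is impossible, and over an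
   algebraically closed field every pencil of solutions that is not a line contains
   a member of rank at most 2.

   A metric h a lies in the projective class of G if and only if the trace-free part
   of the difference of the two connections vanishes, and since sigma = (h a)^{-1}
   det(h a)^{1/5} is parallel for the Levi-Civita connection this is the system (B)
   with gradient (1/5) d ln |det a / h|.  As (B) determines the gradient (contract
   with a), this identifies lambda with (1/5) ln |det a / h| up to a constant, and
   conversely lambda with h = e^{-5 lambda} det a, which needs no fifth root.

   For a Ricci-flat metric in the projective class the Weyl tensor is its Riemann
   tensor, whose symmetries are the equations (A). *)

(** * Calculus on open subsets of R^4 *)

(** The rank of a pencil of solutions drops twice. An eigenvalue of a b^{-1} gives a singular
    member. If its rank is 3, [W(y, z, .)] preserves its kernel line; pairing the line with any
    other solution gives a product of two functions that is skew-symmetric, hence zero, so the line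
    lies in the kernel of every solution. The pencil then descends to a three-dimensional quotient,
    where a second eigenvalue lowers the rank to at most 2. These eigenvalues need not be real, so
    the tensor is extended to complex coefficients; proportionality is a polynomial identity in the
    entries and descends to the reals.

    In rank 2 the obstacle is a second solution that does not vanish on ker b. The condition
    W^i_{jki} = 0 makes the trace of [W(y, z, .)] on ker b a nonzero multiple of b(y, z), so [W]
    cannot ignore ker b.

    Signs need separate care: e^lambda is positive, so a metric matches a given [a] only up to a
    sign, which is constant on the star-shaped set. *)

Lemma is_derive_line (R : realType) (f : 'rV[R]_4 -> R) y v (t : R) :
  derivable f (y + t *: v) v ->
  is_derive t 1 (fun s => f (y + s *: v)) ('D_v f (y + t *: v)).
Proof.
have E : (fun h => h^-1 *: ((fun s => f (y + s *: v)) (h *: 1 + t) - f (y + t *: v))) =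
   (fun h => h^-1 *: (f (h *: v + (y + t *: v)) - f (y + t *: v))).
  apply/funext => h; congr (_ *: (f _ - _)).
  by rewrite scalerDl addrCA scaler1.
by move=> df; split; rewrite /derivable /derive/= E.
Qed.

(** The segment is parametrized by [[0, 1]] and scaled by [k], so no case distinction on the sign of
    [k] is needed. *)
Lemma MVT_line (R : realType) (f : 'rV[R]_4 -> R) y v (k : R) :
  (forall t, 0 <= t <= 1 -> derivable f (y + (t * k) *: v) v) ->
  exists2 t, 0 <= t <= 1 & f (y + k *: v) - f y = k * 'D_v f (y + (t * k) *: v).
Proof.
move=> df.
pose g s := f (y + s *: v).
have dg (t : R) : 0 <= t <= 1 -> is_derive t 1 (fun s => g (s * k)) (k * 'D_v f (y + (t * k) *: v)).
  move=> /df /is_derive_line dft.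
  have dk : is_derive t (1 : R) (fun s : R => s * k) k.
    have -> : (fun s : R => s * k) = k *: id by apply/funext => s /=; rewrite mulrC.
    by apply: is_derive_eq; rewrite /GRing.scale /= mulr1.
  have := @is_derive1_comp _ g (fun s => s * k) t _ _ dft dk.
  by rewrite mulrC.
have [] := @MVT_segment R (fun s => g (s * k)) (fun t => k * 'D_v f (y + (t * k) *: v)) 0 1 ler01.
- by move=> x; rewrite in_itv /= => /andP[x0 x1]; apply: dg; rewrite !ltW.
- apply: derivable_within_continuous => x; rewrite in_itv /= => /dg [dx _]; exact: dx.
move=> c; rewrite in_itv /= => c01; rewrite /g mul1r mul0r scale0r addr0 subr0 mulr1 => E.
by exists c.
Qed.

(** The points [x + trunc_row h k] form a staircase from [x] to [x + h] with steps parallel to the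
    axes, so that each increment of [f] involves a single partial derivative. *)
Definition trunc_row (R : realType) (h : 'rV[R]_4) (k : nat) : 'rV[R]_4 :=
  \row_i (if (i < k)%N then h 0 i else 0).

Lemma trunc_rowS (R : realType) (h : 'rV[R]_4) (k : 'I_4) :
  trunc_row h k.+1 = trunc_row h k + h 0 k *: delta_mx 0 k.
Proof.
apply/rowP => i; rewrite !mxE eqxx /= ltnS leq_eqVlt.
have [->|ik] := eqVneq i k; first by rewrite eqxx ltnn /= mulr1 add0r.
by rewrite mulr0 addr0 (negPf (_ : nat_of_ord i != k)).
Qed.

Lemma rV_norm_le (R : realType) (h : 'rV[R]_4) (e : R) :
  0 <= e -> (forall i, `|h 0 i| <= e) -> `|h| <= e.
Proof.
move=> e0 H; rewrite /Num.Def.normr/= mx_normrE; apply: bigmax_le => // -[i j] _ /=.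
by rewrite ord1.
Qed.

Lemma rV_coord_le (R : realType) (h : 'rV[R]_4) i : `|h 0 i| <= `|h|.
Proof. by rewrite [leRHS]/Num.Def.normr/= mx_normrE; apply: (le_bigmax _ (fun ij => `|h ij.1 ij.2|) (0, i)). Qed.

Lemma continuous_at_sum (R : realType) (T : topologicalType) (I : Type) (r : seq I)
    (f : I -> T -> R) (x : T) :
  (forall i, f i y @[y --> x] --> f i x) ->
  \sum_(i <- r) f i y @[y --> x] --> \sum_(i <- r) f i x.
Proof.
move=> cf; elim: r => [|i r IH].
  by rewrite big_nil; under eq_fun do rewrite big_nil; exact: cvg_cst.
by rewrite big_cons; under eq_fun do rewrite big_cons; apply: cvgD => //; exact: cf.
Qed.

(** The mean value theorem on each step of the staircase produces a partial derivative at a nearby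
    point; continuity compares it with the one at [x]. Each of the four steps may cost a quarter of
    the allowed error. *)
Lemma continuous_pderiv_differentiable (R : realType) (U : set 'rV[R]_4) (f : 'rV[R]_4 -> R) x :
  open U -> (forall i, (forall y, U y -> derivable f y (delta_mx 0 i)) /\
                       {in U, continuous (pderiv i f)}) ->
  U x -> differentiable f x.
Proof.
move=> oU Cf Ux.
pose L (h : 'rV[R]_4) : R := \sum_i h 0 i * pderiv i f x.
have Llin : linear L.
  move=> a u v; rewrite /L scaler_sumr -big_split; apply: eq_bigr => i _.
  by rewrite !mxE mulrDl /GRing.scale /= mulrA.
pose Lm := GRing.isLinear.Build _ _ _ _ L Llin.
pose LL : {linear 'rV[R]_4 -> R} := HB.pack L Lm.
have Lc : continuous LL.
  move=> y; rewrite /LL /= /L.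
  apply: (@continuous_at_sum _ _ _ _ (fun i (z : 'rV[R]_4) => z 0 i * pderiv i f x)) => i.
  by apply: (@cvgMr_tmp _ _ (nbhs y)); apply: coord_continuous.
have key : f \o shift x = cst (f x) + LL +o_ (0 : 'rV[R]_4) id.
  apply/eqaddoP => _/posnumP[e].
  have : \forall y \near x, U y /\ forall i, `|pderiv i f y - pderiv i f x| <= e%:num / 4%:R.
    apply: filterI; first exact: open_nbhs_nbhs.
    apply: (@filter_forall _ _ (fun (i : 'I_4) y => `|pderiv i f y - pderiv i f x| <= e%:num / 4%:R) (nbhs x)) => i.
    have [_ cp] := Cf i.
    have /cvgrPdist_le := cp x (mem_set Ux).
    move=> /(_ (e%:num / 4%:R)) /= H; near=> y; rewrite distrC; near: y.
    by apply: H; apply: divr_gt0.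
  move=> /nbhs_ballP[d /= d0 H].
  near=> h.
  have hd : `|h| < d.
    near: h; apply/nbhs_ballP; exists d => //= z.
    by rewrite -ball_normE /= sub0r normrN.
  have Hin z : `|z| <= `|h| ->
      U (x + z) /\ forall i, `|pderiv i f (x + z) - pderiv i f x| <= e%:num / 4%:R.
    move=> zh; apply: H; rewrite -ball_normE /= opprD addrA subrr add0r normrN.
    exact: le_lt_trans hd.
  have step (k : 'I_4) : `|f (x + trunc_row h k.+1) - f (x + trunc_row h k)
      - h 0 k * pderiv k f x| <= e%:num / 4%:R * `|h|.
    have small t : 0 <= t <= 1 ->
        `|trunc_row h k + (t * h 0 k) *: delta_mx 0 k| <= `|h|.
      move=> /andP[t0 t1]; apply: rV_norm_le => // i; rewrite !mxE eqxx /=.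
      have [->|ik] := eqVneq i k.
        rewrite ltnn /= mulr1 add0r normrM ger0_norm //.
        by rewrite (le_trans (ler_piMl _ t1)) // rV_coord_le.
      by rewrite mulr0 addr0; case: ifP => _; [exact: rV_coord_le|rewrite normr0].
    have [|t t01 E] := @MVT_line _ f (x + trunc_row h k) (delta_mx 0 k) (h 0 k).
      move=> t t01; rewrite -addrA; have [D _] := Cf k; apply: D.
      by have [] := Hin _ (small t t01).
    rewrite trunc_rowS addrA E -mulrBr normrM mulrC ler_pM //.
      by rewrite -addrA; have [_ ->] := Hin _ (small t t01).
    exact: rV_coord_le.
  have -> : (f \o shift x - (cst (f x) + LL)) h =
     \sum_(k < 4) (f (x + trunc_row h k.+1) - f (x + trunc_row h k) - h 0 k * pderiv k f x).
    rewrite sumrB -(big_mkord xpredT (fun k => f (x + trunc_row h k.+1) - f (x + trunc_row h k))).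
  rewrite telescope_sumr //.
    have -> : trunc_row h 0 = 0 by apply/rowP => i; rewrite !mxE.
    have -> : trunc_row h 4 = h by apply/rowP => i; rewrite !mxE ltn_ord.
    by rewrite addr0 opprD addrA [x + h]addrC.
  rewrite (le_trans (ler_norm_sum _ _ _)) //.
  rewrite (le_trans (ler_sum _ (fun k _ => step k))) //.
  by rewrite sumr_const card_ord -[leLHS]mulr_natr mulrAC divfK.
have LLc : continuous LL by exact: Lc.
have E := diff_unique LLc key.
by apply/diff_locallyP; split; rewrite E.
Unshelve. all: by end_near. Qed.


Lemma C1_differentiable (R : realType) (U : set 'rV[R]_4) n (f : 'rV[R]_4 -> R) x :
  open U -> Ck U n.+1 f -> U x -> differentiable f x.
Proof.
move=> oU [_ Cf]; apply: continuous_pderiv_differentiable => // i.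
by have [D C] := Cf i; split=> //; case: n C {Cf} => [|n] [].
Qed.

Lemma derive_pderiv (R : realType) (f : 'rV[R]_4 -> R) x v :
  differentiable f x -> 'D_v f x = \sum_i v 0 i * pderiv i f x.
Proof.
move=> df; rewrite deriveE // {1}(row_sum_delta v) linear_sum.
by apply: eq_bigr => i _; rewrite linearZ /= /pderiv deriveE.
Qed.

Lemma star_shaped_constant (R : realType) p (U : set 'rV[R]_4) (f : 'rV[R]_4 -> R) :
  star_shaped p U ->
  (forall x, U x -> differentiable f x /\ forall i, pderiv i f x = 0) ->
  forall x, U x -> f x = f p.
Proof.
move=> [Up sU] df x Ux.
have sU' t : 0 <= t <= 1 -> U (p + (t * 1) *: (x - p)).
  by move=> t01; rewrite mulr1; apply: sU.
have [t t01|t t01] := @MVT_line _ f p (x - p) 1.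
  by apply: diff_derivable; have [] := df _ (sU' t t01).
have [dt zt] := df _ (sU' t t01).
rewrite scale1r (addrC p) subrK derive_pderiv // big1 ?mulr0; last first.
  by move=> i _; rewrite zt mulr0.
by move/eqP; rewrite subr_eq0 => /eqP.
Qed.

(** * Calculus of smooth functions on an open set *)

Section OpenSet.
Context {R : realType} (U : set 'rV[R]_4) (oU : open U).
Implicit Types (f g : 'rV[R]_4 -> R) (x : 'rV[R]_4) (i : 'I_4).

Lemma near_open x : U x -> \forall y \near x, U y.
Proof. by move=> Ux; apply: open_nbhs_nbhs. Qed.

Lemma eq_on_near f g x : (forall y, U y -> f y = g y) -> U x ->
  \forall y \near x, f y = g y.
Proof. by move=> fg Ux; apply: filterS (near_open Ux). Qed.

(** Fields have arbitrary values off [U]; as [U] is open, derivatives at its points depend only on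
    the values in [U]. *)
Lemma eq_on_pderiv f g i x : (forall y, U y -> f y = g y) -> U x ->
  pderiv i f x = pderiv i g x.
Proof.
by move=> fg Ux; apply: near_eq_derive; apply: eq_on_near.
Qed.

Lemma eq_on_derivable f g i x : (forall y, U y -> f y = g y) -> U x ->
  derivable f x (delta_mx 0 i) -> derivable g x (delta_mx 0 i).
Proof.
by move=> fg Ux; apply: near_eq_derivable; apply: (eq_on_near fg Ux).
Qed.

Lemma eq_on_continuous f g : (forall y, U y -> f y = g y) ->
  {in U, continuous f} -> {in U, continuous g}.
Proof.
move=> fg cf x xU; have Ux := set_mem xU.
rewrite /continuous_at -(fg x Ux); apply: cvg_trans (cf x xU).
by apply: (@near_eq_cvg _ _ (nbhs x)); exact: (eq_on_near fg Ux).
Qed.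

Lemma eq_on_Ck n f g : (forall y, U y -> f y = g y) -> Ck U n f -> Ck U n g.
Proof.
elim: n f g => [|n IH] f g fg [cf df]; split=> //; first exact: eq_on_continuous cf.
  exact: eq_on_continuous cf.
move=> i; have [D C] := df i; split.
  by move=> x Ux; apply: eq_on_derivable (D x Ux).
by apply: IH C => y Uy; apply: eq_on_pderiv.
Qed.

Lemma eq_on_smooth f g : (forall y, U y -> f y = g y) -> smooth U f -> smooth U g.
Proof. by move=> fg sf n; apply: eq_on_Ck (sf n). Qed.

Lemma CkW n f : Ck U n.+1 f -> Ck U n f.
Proof.
elim: n f => [|n IH] f [cf df]; split=> // i.
by have [D C] := df i; split=> //; apply: IH.
Qed.

Lemma Ck_continuous n f : Ck U n f -> {in U, continuous f}.
Proof. by case: n => [|n] []. Qed.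

Lemma smooth_continuous f : smooth U f -> {in U, continuous f}.
Proof. by move/(_ 0%N) => []. Qed.

Lemma smooth_differentiable f x : smooth U f -> U x -> differentiable f x.
Proof. by move/(_ 1%N); apply: C1_differentiable. Qed.

Lemma smooth_derivable f x i : smooth U f -> U x -> derivable f x (delta_mx 0 i).
Proof. by move=> sf Ux; apply: diff_derivable; apply: smooth_differentiable. Qed.

Lemma smooth_pderiv f i : smooth U f -> smooth U (pderiv i f).
Proof. by move=> sf n; have [_ /(_ i)[]] := sf n.+1. Qed.

Lemma Ck_cst n (c : R) : Ck U n (fun=> c).
Proof.
elim: n c => [|n IH] c; split=> //; try by move=> x _; apply: cst_continuous.
move=> i; split; first by move=> x _; exact: derivable_cst.
by apply: eq_on_Ck (IH 0) => y _; rewrite /pderiv derive_cst.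
Qed.

Lemma pderivD f g i x : derivable f x (delta_mx 0 i) -> derivable g x (delta_mx 0 i) ->
  pderiv i (fun y => f y + g y) x = pderiv i f x + pderiv i g x.
Proof. exact: deriveD. Qed.

Lemma pderivM f g i x : derivable f x (delta_mx 0 i) -> derivable g x (delta_mx 0 i) ->
  pderiv i (fun y => f y * g y) x = f x * pderiv i g x + pderiv i f x * g x.
Proof. by move=> df dg; rewrite /pderiv (deriveM df dg) [X in _ + X]mulrC. Qed.

Lemma pderiv_cst (c : R) i x : pderiv i (fun=> c) x = 0.
Proof. exact: derive_cst. Qed.

Lemma CkD n f g : Ck U n f -> Ck U n g -> Ck U n (fun y => f y + g y).
Proof.
elim: n f g => [|n IH] f g Cf Cg; have [cf df] := Cf; have [cg dg] := Cg; split=> //.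
- by move=> x xU; exact: continuousD (cf x xU) (cg x xU).
- by move=> x xU; exact: continuousD (cf x xU) (cg x xU).
- move=> i; have [Df Cf'] := df i; have [Dg Cg'] := dg i; split.
    by move=> x Ux; apply: derivableD; auto.
  apply: eq_on_Ck (IH _ _ Cf' Cg') => y Uy.
  by rewrite pderivD; auto.
Qed.

Lemma CkM n f g : Ck U n f -> Ck U n g -> Ck U n (fun y => f y * g y).
Proof.
elim: n f g => [|n IH] f g Cf Cg; have [cf df] := Cf; have [cg dg] := Cg; split=> //.
- by move=> x xU; exact: continuousM (cf x xU) (cg x xU).
- by move=> x xU; exact: continuousM (cf x xU) (cg x xU).
- move=> i; have [Df Cf'] := df i; have [Dg Cg'] := dg i; split.
    by move=> x Ux; apply: derivableM; auto.
  apply: eq_on_Ck (CkD (IH _ _ (CkW Cf) Cg') (IH _ _ Cf' (CkW Cg))) => y Uy.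
  by rewrite pderivM; auto.
Qed.

Lemma pderivV f i x : f x != 0 -> derivable f x (delta_mx 0 i) ->
  pderiv i (fun y => (f y)^-1) x = - ((f x)^-1 * (f x)^-1) * pderiv i f x.
Proof. by move=> f0 df; rewrite /pderiv deriveV // /GRing.scale /= -expr2 exprVn. Qed.

Lemma CkV n f : (forall x, U x -> f x != 0) -> Ck U n f -> Ck U n (fun y => (f y)^-1).
Proof.
move=> f0; elim: n => [|n IH] Cf; have [cf df] := Cf; split=> //.
- by move=> x xU; exact: continuousV (f0 _ (set_mem xU)) (cf x xU).
- by move=> x xU; exact: continuousV (f0 _ (set_mem xU)) (cf x xU).
- move=> i; have [Df Cf'] := df i; split.
    by move=> x Ux; apply: derivableV; auto.
  have CV := IH (CkW Cf).
  apply: eq_on_Ck (CkM (CkM (Ck_cst n (-1)) (CkM CV CV)) Cf') => y Uy.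
  by rewrite pderivV ?mulN1r; auto.
Qed.

Lemma pderiv_expR f i x : differentiable f x ->
  derivable (fun y => expR (f y)) x (delta_mx 0 i) /\
  pderiv i (fun y => expR (f y)) x = expR (f x) * pderiv i f x.
Proof.
move=> df.
have de : differentiable (@expR R) (f x).
  by apply/derivable1_diffP; apply: derivable_expR.
have dc : differentiable (expR \o f) x by apply: differentiable_comp.
split; first exact: diff_derivable.
rewrite /pderiv !deriveE // diff_comp //= diff1E //.
by rewrite derive1E (@derive_val _ _ _ _ _ _ _ (is_derive_expR _)) mulrC.
Qed.

Lemma pderiv_ln f i x : 0 < f x -> differentiable f x ->
  derivable (fun y => ln (f y)) x (delta_mx 0 i) /\
  pderiv i (fun y => ln (f y)) x = (f x)^-1 * pderiv i f x.
Proof.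
move=> f0 df.
have [dl vl] := is_derive1_ln f0.
have de : differentiable (@ln R) (f x) by apply/derivable1_diffP.
have dc : differentiable (@ln R \o f) x by apply: differentiable_comp.
split; first exact: diff_derivable.
rewrite /pderiv !deriveE // diff_comp //= diff1E //.
by rewrite derive1E vl mulrC.
Qed.

(** The order is at least 1 because the chain rule needs [f] differentiable, which C^1 provides. The
    derivative contains [expR (f y)] again, one order lower, and this drives the induction. *)
Lemma Ck_expR n f : Ck U n.+1 f -> Ck U n.+1 (fun y => expR (f y)).
Proof.
have cE m g : Ck U m g -> {in U, continuous (fun y => expR (g y))}.
  move=> Cg x xU; apply: (@continuous_comp _ _ _ g (@expR R)).
    exact: Ck_continuous Cg _ xU.
  exact: continuous_expR.
elim: n => [|n IH] Cf; have [cf df] := Cf; split; try exact: cE Cf.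
- move=> i; split=> [x Ux|]; first by have [] := pderiv_expR i (C1_differentiable oU Cf Ux).
  have [_ C] := df i.
  have C0 : Ck U 0 (fun y => expR (f y)) by split=> //; exact: cE Cf.
  apply: eq_on_Ck (CkM C0 C) => y Uy.
  by have [_ ->] := pderiv_expR i (C1_differentiable oU Cf Uy).
- move=> i; split=> [x Ux|]; first by have [] := pderiv_expR i (C1_differentiable oU Cf Ux).
  have [_ C] := df i.
  apply: eq_on_Ck (CkM (IH (CkW Cf)) C) => y Uy.
  by have [_ ->] := pderiv_expR i (C1_differentiable oU Cf Uy).
Qed.

Lemma Ck_ln n f : (forall x, U x -> 0 < f x) -> Ck U n.+1 f -> Ck U n.+1 (fun y => ln (f y)).
Proof.
move=> f0 Cf; have [cf df] := Cf; split.
  move=> x xU; apply: (@continuous_comp _ _ _ f (@ln R)); first exact: cf.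
  exact: continuous_ln (f0 _ (set_mem xU)).
move=> i; have [_ C] := df i; split=> [x Ux|].
  by have [] := pderiv_ln i (f0 _ Ux) (C1_differentiable oU Cf Ux).
have CV : Ck U n (fun y => (f y)^-1).
  by apply: CkV (CkW Cf) => x /f0; apply: lt0r_neq0.
apply: eq_on_Ck (CkM CV C) => y Uy.
by have [_ ->] := pderiv_ln i (f0 _ Uy) (C1_differentiable oU Cf Uy).
Qed.

Lemma smooth_cst (c : R) : smooth U (fun=> c).
Proof. by move=> n; apply: Ck_cst. Qed.

Lemma smoothD f g : smooth U f -> smooth U g -> smooth U (fun y => f y + g y).
Proof. by move=> sf sg n; apply: CkD. Qed.

Lemma smoothM f g : smooth U f -> smooth U g -> smooth U (fun y => f y * g y).
Proof. by move=> sf sg n; apply: CkM. Qed.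

Lemma smoothN f : smooth U f -> smooth U (fun y => - f y).
Proof. by move=> sf; apply: eq_on_smooth (smoothM (smooth_cst (-1)) sf) => y _; rewrite mulN1r. Qed.

Lemma smoothB f g : smooth U f -> smooth U g -> smooth U (fun y => f y - g y).
Proof. by move=> sf sg; apply: smoothD => //; apply: smoothN. Qed.

Lemma smoothV f : (forall x, U x -> f x != 0) -> smooth U f -> smooth U (fun y => (f y)^-1).
Proof. by move=> f0 sf n; apply: CkV. Qed.

Lemma smooth_expR f : smooth U f -> smooth U (fun y => expR (f y)).
Proof. by move=> sf n; apply: CkW; apply: Ck_expR. Qed.

Lemma smooth_ln f : (forall x, U x -> 0 < f x) -> smooth U f -> smooth U (fun y => ln (f y)).
Proof. by move=> f0 sf n; apply: CkW; apply: Ck_ln. Qed.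

Lemma smooth_sum (I : Type) (r : seq I) (P : pred I) (F : I -> 'rV[R]_4 -> R) :
  (forall k, P k -> smooth U (F k)) -> smooth U (fun y => \sum_(k <- r | P k) F k y).
Proof.
move=> sF; elim: r => [|a r IH].
  by apply: eq_on_smooth (smooth_cst 0) => y _; rewrite big_nil.
have [Pa|nPa] := boolP (P a).
  by apply: eq_on_smooth (smoothD (sF a Pa) IH) => y _; rewrite big_cons Pa.
by apply: eq_on_smooth IH => y _; rewrite big_cons (negPf nPa).
Qed.

Lemma smooth_prod (I : Type) (r : seq I) (F : I -> 'rV[R]_4 -> R) :
  (forall k, smooth U (F k)) -> smooth U (fun y => \prod_(k <- r) F k y).
Proof.
move=> sF; elim: r => [|a r IH].
  by apply: eq_on_smooth (smooth_cst 1) => y _; rewrite big_nil.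
by apply: eq_on_smooth (smoothM (sF a) IH) => y _; rewrite big_cons.
Qed.

Lemma pderiv_sum (I : Type) (r : seq I) (F : I -> 'rV[R]_4 -> R) i x :
  (forall k, derivable (F k) x (delta_mx 0 i)) ->
  derivable (fun y => \sum_(k <- r) F k y) x (delta_mx 0 i) /\
  pderiv i (fun y => \sum_(k <- r) F k y) x = \sum_(k <- r) pderiv i (F k) x.
Proof.
move=> dF; elim: r => [|a r [IH1 IH2]].
  rewrite big_nil; under eq_fun do rewrite big_nil.
  by split; [exact: derivable_cst|exact: pderiv_cst].
have -> : (fun y => \sum_(k <- a :: r) F k y) = (fun y => F a y + \sum_(k <- r) F k y).
  by apply/funext => y; rewrite big_cons.
split; first exact: (derivableD (dF a) IH1).
by apply: etrans (pderivD (dF a) IH1) _; rewrite big_cons IH2.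
Qed.

Lemma pderiv_coord (k i : 'I_4) x :
  derivable (fun y : 'rV[R]_4 => y 0 k) x (delta_mx 0 i) /\
  pderiv i (fun y => y 0 k) x = (i == k)%:R.
Proof.
have dk : differentiable (fun y : 'rV[R]_4 => y 0 k) x by exact: differentiable_coord.
split; first exact: diff_derivable.
rewrite /pderiv /derive; apply: cvg_lim => //.
apply: (@cvg_trans _ ((fun=> (i == k)%:R) @ (0 : R)^')); last exact: cvg_cst.
apply: (@near_eq_cvg _ _ ((0 : R)^')); near=> h.
rewrite /= !mxE eqxx /= addrK eq_sym /GRing.scale /= mulKf //.
by near: h; exact: nbhs_dnbhs_neq.
Unshelve. all: by end_near. Qed.

Lemma smooth_coord (k : 'I_4) : smooth U (fun y => y 0 k).
Proof.
case=> [|n]; first by split=> // x _; exact: coord_continuous.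
split=> [x _|i]; first exact: coord_continuous.
split=> [x _|]; first by have [] := pderiv_coord k i x.
by apply: eq_on_Ck (Ck_cst n (i == k)%:R) => y _; have [_ ->] := pderiv_coord k i y.
Qed.

(** Meant for primitives defined by an integral, of which only the partial derivatives are known;
    continuity of [f] follows from differentiability. *)
Lemma smooth_of_pderiv (f : 'rV[R]_4 -> R) (w : 'I_4 -> 'rV[R]_4 -> R) :
  (forall i, smooth U (w i)) ->
  (forall i x, U x -> derivable f x (delta_mx 0 i) /\ pderiv i f x = w i x) ->
  smooth U f.
Proof.
move=> sw df n; apply: CkW.
have Cp i : Ck U n (pderiv i f).
  by apply: eq_on_Ck (sw i n) => y Uy; have [_ ->] := df i y Uy.
have D i y : U y -> derivable f y (delta_mx 0 i) by move=> Uy; have [] := df i y Uy.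
split=> [x xU|i]; last by split=> //; exact: D.
apply: differentiable_continuous.
apply: (@continuous_pderiv_differentiable R U) => //; last exact: set_mem.
by move=> i; split=> //; [exact: D|exact: Ck_continuous (Cp i)].
Qed.

End OpenSet.

(** * Symmetry of second partial derivatives *)

Lemma delta_norm_le (R : realType) (i : 'I_4) : `|delta_mx 0 i : 'rV[R]_4| <= 1.
Proof.
apply: rV_norm_le => // j; rewrite mxE eqxx /=.
by case: (j == i); rewrite ?normr1 // normr0.
Qed.

Lemma is_derive_translate (R : realType) (f : 'rV[R]_4 -> R) y c v :
  derivable f (y + c) v -> is_derive y v (fun z => f (z + c)) ('D_v f (y + c)).
Proof.
have E : (fun h => h^-1 *: ((fun z => f (z + c)) (h *: v + y) - f (y + c))) =
   (fun h => h^-1 *: (f (h *: v + (y + c)) - f (y + c))).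
  by apply/funext => h; rewrite addrA.
by move=> df; split; rewrite /derivable /derive/= E.
Qed.

(** Two mean values: the first for [y -> f (y + t e_j) - f y] in direction [i], the second for
    [pderiv i f] in direction [j]. *)
Lemma second_difference (R : realType) (U : set 'rV[R]_4) (f : 'rV[R]_4 -> R) x
    (t : R) (i j : 'I_4) :
  Ck U 2 f -> 0 < t -> (forall z, `|z| <= 2 * t -> U (x + z)) ->
  exists2 z, `|z| <= 2 * t &
    f (x + t *: delta_mx 0 i + t *: delta_mx 0 j) - f (x + t *: delta_mx 0 i)
    - (f (x + t *: delta_mx 0 j) - f x) = t * (t * pderiv j (pderiv i f) (x + z)).
Proof.
move=> [_ Cf] t0 Hin; have [Di [_ /(_ j)[Dij _]]] := Cf i.
have small a b : 0 <= a <= 1 -> 0 <= b <= 1 ->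
    `|(a * t) *: delta_mx 0 i + (b * t) *: delta_mx 0 j : 'rV[R]_4| <= 2 * t.
  move=> /andP[a0 a1] /andP[b0 b1]; rewrite (le_trans (ler_normD _ _)) // !normrZ.
  have H c k : 0 <= c -> c <= 1 -> `|c| * `|t| * `|delta_mx 0 k : 'rV[R]_4| <= t.
    move=> c0 c1; rewrite -normrM -[leRHS]mulr1 ler_pM ?delta_norm_le //.
    by rewrite ger0_norm ?mulr_ge0 ?ler_piMl // ltW.
  have -> : 2 * t = t + t by lra.
  by apply: lerD; apply: H.
pose phi y := f (y + t *: delta_mx 0 j) - f y.
have dphi y : U y -> U (y + t *: delta_mx 0 j) ->
    is_derive y (delta_mx 0 i) phi (pderiv i f (y + t *: delta_mx 0 j) - pderiv i f y).
  move=> Uy Uyj.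
  apply: (@is_deriveB _ _ _ (fun z => f (z + t *: delta_mx 0 j)) f).
    by apply: is_derive_translate; exact: Di.
  by apply: derivableP; exact: Di.
have Uin a b : 0 <= a <= 1 -> 0 <= b <= 1 ->
    U (x + (a * t) *: delta_mx 0 i + (b * t) *: delta_mx 0 j).
  by move=> a01 b01; rewrite -addrA; apply: Hin; exact: small.
have z01 : 0 <= (0 : R) <= 1 by rewrite lexx ler01.
have o01 : 0 <= (1 : R) <= 1 by rewrite lexx ler01.
have dphi' a : 0 <= a <= 1 -> is_derive (x + (a * t) *: delta_mx 0 i) (delta_mx 0 i) phi
    (pderiv i f (x + (a * t) *: delta_mx 0 i + t *: delta_mx 0 j)
     - pderiv i f (x + (a * t) *: delta_mx 0 i)).
  move=> a01; apply: dphi.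
    by have := Uin a 0 a01 z01; rewrite mul0r scale0r addr0.
  by have := Uin a 1 a01 o01; rewrite mul1r.
have [|a a01 E] := @MVT_line _ phi x (delta_mx 0 i) t.
  by move=> a /dphi' [].
have [|b b01 E'] := @MVT_line _ (pderiv i f) (x + (a * t) *: delta_mx 0 i) (delta_mx 0 j) t.
  by move=> b b01; apply: Dij; exact: Uin.
exists ((a * t) *: delta_mx 0 i + (b * t) *: delta_mx 0 j); first exact: small.
have [_ V] := dphi' a a01.
have -> : t * pderiv j (pderiv i f) (x + ((a * t) *: delta_mx 0 i + (b * t) *: delta_mx 0 j))
    = 'D_(delta_mx 0 i) phi (x + (a * t) *: delta_mx 0 i).
  by rewrite V E' addrA.
by rewrite -E.
Qed.

Local Opaque pderiv.

(* Schwarz's theorem: both iterated derivatives are limits of the same second difference quotient. *)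
Lemma pderivC (R : realType) (U : set 'rV[R]_4) (f : 'rV[R]_4 -> R) x (i j : 'I_4) :
  open U -> Ck U 2 f -> U x -> pderiv i (pderiv j f) x = pderiv j (pderiv i f) x.
Proof.
move=> oU Cf Ux.
have Cij k l : {in U, continuous (pderiv k (pderiv l f))}.
  by have [_ /(_ l)[_ [_ /(_ k)[_ []]]]] := Cf.
apply/eqP; rewrite -subr_eq0 -normr_le0; apply/ler_addgt0Pr => e e0; rewrite add0r.
have e20 : 0 < e / 2 by apply: divr_gt0.
have : \forall y \near x, U y /\
   (`|pderiv i (pderiv j f) x - pderiv i (pderiv j f) y| <= e / 2 /\
    `|pderiv j (pderiv i f) x - pderiv j (pderiv i f) y| <= e / 2).
  have H1 := near_open oU Ux.
  have /cvgrPdist_le /(_ _ e20) H2 := Cij i j x (mem_set Ux).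
  have /cvgrPdist_le /(_ _ e20) H3 := Cij j i x (mem_set Ux).
  apply: filterI; first exact: H1.
  by apply: filterI; [exact: H2|exact: H3].
move=> /nbhs_ballP[d /= d0 H].
have Bz z : `|z| <= 2 * (d / 4) -> ball x d (x + z).
  move=> zd; rewrite -ball_normE /= opprD addrA subrr add0r normrN.
  by apply: (le_lt_trans zd); lra.
have t0 : 0 < d / 4 by apply: divr_gt0.
have Uin z : `|z| <= 2 * (d / 4) -> U (x + z) by move=> /Bz /H [].
have [z1 z1d E1] := @second_difference _ U f x _ i j Cf t0 Uin.
have [z2 z2d E2] := @second_difference _ U f x _ j i Cf t0 Uin.
have E : pderiv j (pderiv i f) (x + z1) = pderiv i (pderiv j f) (x + z2).
  have : d / 4 * (d / 4 * pderiv j (pderiv i f) (x + z1)) =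
         d / 4 * (d / 4 * pderiv i (pderiv j f) (x + z2)).
    apply: (etrans (esym E1)); apply: (etrans _ E2); rewrite [in RHS](addrAC x).
    by move: (f _) (f (x + _)) (f (x + _)) (f x) => u v r s; ring.
  by move/(mulfI (lt0r_neq0 t0))/(mulfI (lt0r_neq0 t0)).
have [_ [_ H1]] := H _ (Bz _ z1d); have [_ [H2 _]] := H _ (Bz _ z2d).
rewrite (splitr e); apply: le_trans (ler_distD (pderiv i (pderiv j f) (x + z2)) _ _) _.
by apply: (lerD H2); rewrite distrC -E; exact: H1.
Qed.

(** * The Poincare lemma on star-shaped sets *)

Lemma within01_continuous (R : realType) (f : R -> R) :
  (forall t : R, 0 <= t <= 1 -> {for t, continuous f}) -> {within `[0, 1], continuous f}.
Proof.
move=> cf; apply: continuous_in_subspaceT => t; rewrite inE /= in_itv /= => t01.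
exact: cf.
Qed.

Lemma integrable01 (R : realType) (f : R -> R) :
  (forall t : R, 0 <= t <= 1 -> {for t, continuous f}) ->
  (@lebesgue_measure R).-integrable `[0, 1] (EFin \o f).
Proof.
move=> cf; apply: continuous_compact_integrable; first exact: segment_compact.
exact: within01_continuous.
Qed.

(** Dominated differentiation under the integral sign; the dominating function is the constant
    maximum of [|d|] on the compact rectangle [[-e, e] x [0, 1]]. *)
Lemma is_derive_integral01 (R : realType) (f d : R -> R -> R) (e : R) : 0 < e ->
  (forall s t, `|s| <= e -> 0 <= t <= 1 -> is_derive (s : R) (1 : R) (f^~ t) (d s t)) ->
  (forall s t, `|s| <= e -> 0 <= t <= 1 -> {for t, continuous (f s)}) ->
  (forall q : R * R, `|q.1| <= e -> 0 <= q.2 <= 1 ->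
     {for q, continuous (fun r => d r.1 r.2)}) ->
  is_derive (0 : R) (1 : R) (fun s => \int[@lebesgue_measure R]_(t in `[0, 1]) f s t)
     (\int[@lebesgue_measure R]_(t in `[0, 1]) d 0 t).
Proof.
move=> e0 df cf cd.
have [M HM] : exists M, forall s t, `|s| <= e -> 0 <= t <= 1 -> `|d s t| <= M.
  have [|||[s0 t0] _ H] := @compact_EVT_max _ _ (fun q : R * R => `|d q.1 q.2|) (`[- e, e] `*` `[0, 1]).
  - exists (0, 0); split; rewrite /= in_itv /= ?lexx ?ler01 //.
    by rewrite oppr_le0 ltW.
  - by apply: compact_setX; exact: segment_compact.
  - apply: continuous_in_subspaceT => -[s t]; rewrite inE /= !in_itv /= => -[s1 t1].
    apply: (@continuous_comp _ _ _ (fun q : R * R => d q.1 q.2) Num.norm).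
      by apply: cd => //=; rewrite ler_norml.
    exact: norm_continuous.
  - exists `|d s0 t0| => s t s1 t1; apply: (H (s, t)).
    by rewrite inE /=; split; rewrite in_itv /= -?ler_norml.
have Ie s : s \in `]- e, e[%R -> `|s| <= e.
  by rewrite in_itv /= => /andP[? ?]; rewrite ler_norml !ltW.
have tE (t : R) : t \in `[0, 1]%R -> 0 <= t <= 1 by rewrite in_itv.
have d1E s t : s \in `]- e, e[%R -> t \in `[0, 1]%R -> partial1of2 f s t = d s t.
  by move=> /Ie sI /tE tI; rewrite partial1of2E; have [_ ->] := df s t sI tI.
have M0 : 0 <= M.
  by apply: le_trans (normr_ge0 (d 0 0)) (HM 0 0 _ _); rewrite ?normr0 ?lexx ?ler01 // ltW.
have I0 : (0 : R) \in `]- e, e[%R by rewrite in_itv /= oppr_lt0 e0.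
have H1 := @derivable_under_integral R _ _ (@lebesgue_measure R) f `[0, 1] _ 0 (- e) e I0.
have H2 := @differentiation_under_integral R _ _ (@lebesgue_measure R) f `[0, 1] _ 0 (- e) e I0.
have A1 : forall x, [set` `]- e, e[%R] x -> (@lebesgue_measure R).-integrable `[0, 1] (EFin \o f x).
  by move=> s sI; apply: integrable01 => t tI; apply: cf => //; exact: Ie.
have A2 : forall x y, [set` `]- e, e[%R] x -> `[0, 1]%classic y -> derivable (f^~ y) x 1.
  by move=> s t sI tI; have [] := df s t (Ie s sI) (tE t tI).
have A3 : (@lebesgue_measure R).-integrable `[0, 1] (EFin \o (fun=> M)).
  by apply: integrable01 => t _; exact: cst_continuous.
have A4 : forall x y, [set` `]- e, e[%R] x -> `[0, 1]%classic y -> `|partial1of2 f x y| <= M.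
  by move=> s t sI tI; rewrite d1E //; apply: HM; [exact: Ie|exact: tE].
split.
  by apply: H1 A1 A2 (fun=> M) _ A3 A4.
rewrite -derive1E (H2 _ A1 A2 (fun=> M) _ A3 A4) //.
by apply: eq_Rintegral => t tI; rewrite d1E // -inE.
Qed.

Lemma Rintegral01_derivative (R : realType) (F f : R -> R) :
  (forall t : R, 0 <= t <= 1 -> is_derive t (1 : R) F (f t)) ->
  (forall t : R, 0 <= t <= 1 -> {for t, continuous f}) ->
  \int[@lebesgue_measure R]_(t in `[0, 1]) f t = F 1 - F 0.
Proof.
move=> dF cf.
have cF (t : R) : 0 <= t <= 1 -> F x @[x --> t] --> F t.
  by move=> /dF [/derivable1_diffP /differentiable_continuous].
rewrite /Rintegral (@continuous_FTC2 _ f F) //; first exact: within01_continuous.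
  split.
  - by move=> t; rewrite in_itv /= => /andP[t0 t1]; have [] := dF t; rewrite ?ltW.
  - by apply: cvg_at_right_filter; apply: cF; rewrite lexx ler01.
  - by apply: cvg_at_left_filter; apply: cF; rewrite lexx ler01.
move=> t; rewrite in_itv /= => /andP[t0 t1]; rewrite derive1E.
by have [|_ ->] := dF t; rewrite ?ltW.
Qed.

Lemma is_derive_of_line (R : realType) (f : 'rV[R]_4 -> R) y v (c : R) :
  is_derive (0 : R) (1 : R) (fun s => f (y + s *: v)) c -> is_derive y v f c.
Proof.
have E : (fun h => h^-1 *: ((fun s => f (y + s *: v)) (h *: 1 + 0) - f (y + 0 *: v))) =
   (fun h => h^-1 *: (f (h *: v + y) - f y)).
  by apply/funext => h; rewrite addr0 /= [h *: 1]mulr1 scale0r addr0 [y + _]addrC.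
by move=> [d1 d2]; split; move: d1 d2; rewrite /derivable /derive /= E.
Qed.

(** The primitive is the integral of [w] along the segment from [p]. Closedness turns the derivative
    of the integrand in direction [k] into the [t]-derivative of t w_k(p + t (x - p)), whose
    integral over [0, 1] is w_k(x). *)
Lemma poincare (R : realType) (p : 'rV[R]_4) (U : set 'rV[R]_4) (w : 'rV[R]_4 -> 'rV[R]_4) :
  small_nbhd p U -> (forall i, smooth U (fun x => w x 0 i)) -> closed_form U w ->
  exists lam, potential U lam w.
Proof.
move=> [oU [Up sU]] sw cw.
pose lam x := \int[@lebesgue_measure R]_(t in `[0, 1])
  (\sum_i w (p + t *: (x - p)) 0 i * (x - p) 0 i).
suff D x (k : 'I_4) : U x -> is_derive x (delta_mx 0 k) lam (w x 0 k).
  exists lam; split.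
    apply: (smooth_of_pderiv oU sw) => i x Ux.
    by have [d1 d2] := D x i Ux; split=> //; rewrite -d2.
  by move=> x Ux i; have [d1 d2] := D x i Ux; rewrite -d2.
move=> Ux; apply: is_derive_of_line.
pose u (s : R) := x + s *: delta_mx 0 k - p.
pose g (q : R * R) := p + q.2 *: u q.1.
have cu : continuous u.
  move=> s.
  have h1 : {for s, continuous (fun=> x)} by exact: cst_continuous.
  have h2 : {for s, continuous (fun s : R => s *: delta_mx 0 k : 'rV[R]_4)} by exact: scalel_continuous.
  have h3 : {for s, continuous (fun=> p)} by exact: cst_continuous.
  exact: (continuousB (continuousD h1 h2) h3).
have c1 (q : R * R) : {for q, continuous (fst : R * R -> R)} by exact: cvg_fst.
have c2 (q : R * R) : {for q, continuous (snd : R * R -> R)} by exact: cvg_snd.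
have cu1 (q : R * R) : {for q, continuous (fun q : R * R => u q.1)}.
  exact: (continuous_comp (c1 q) (cu q.1)).
have cg (q : R * R) : {for q, continuous g}.
  have h1 : {for q, continuous (fun=> p)} by exact: cst_continuous.
  exact: (continuousD h1 (continuousZ (c2 q) (cu1 q))).
have [e e0 He] : exists2 e : R, 0 < e & forall s, `|s| <= e -> U (x + s *: delta_mx 0 k).
  have /nbhs_ballP[d /= d0 Hd] := near_open oU Ux.
  exists (d / 2); first by rewrite divr_gt0.
  move=> s sd; apply: Hd; rewrite -ball_normE /= opprD addrA subrr add0r normrN normrZ.
  apply: le_lt_trans (ler_piMr (normr_ge0 _) (delta_norm_le _ k)) _.
  by apply: (le_lt_trans sd); rewrite ltr_pdivrMr // ltr_pMr // ltr1n.
have Ug q : `|q.1| <= e -> 0 <= q.2 <= 1 -> U (g q).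
  by move=> q1 q2; rewrite /g /u; apply: sU => //; apply: He.
have cc (h : 'rV[R]_4 -> R) (q : R * R) : smooth U h -> `|q.1| <= e -> 0 <= q.2 <= 1 ->
    {for q, continuous (h \o g)}.
  move=> sh q1 q2.
  exact: (continuous_comp (cg q) (smooth_continuous sh (mem_set (Ug q q1 q2)))).
have cui i (q : R * R) : {for q, continuous (fun q : R * R => u q.1 0 i)}.
  have h1 := @coord_continuous R 1 4 0 i (u q.1).
  exact: (continuous_comp (cu1 q) h1).
pose f s t := \sum_i w (g (s, t)) 0 i * u s 0 i.
pose d s t := w (g (s, t)) 0 k + t * \sum_i pderiv k (fun y => w y 0 i) (g (s, t)) * u s 0 i.
have sdw i := smooth_pderiv k (sw i).
have df s t : `|s| <= e -> 0 <= t <= 1 -> is_derive (s : R) (1 : R) (f^~ t) (d s t).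
  move=> s1 t1; have Ust := Ug (s, t) s1 t1.
  have gE r : g (r, t) = p + t *: (x - p) + r *: (t *: delta_mx 0 k).
    rewrite /g /u /= -[RHS]addrA; congr (_ + _).
    by rewrite addrAC scalerDr scalerA [r *: _]scalerA mulrC.
  have d1 i : is_derive (s : R) (1 : R) (fun r => w (g (r, t)) 0 i)
                (t * pderiv k (fun y => w y 0 i) (g (s, t))).
    have dd : differentiable (fun y => w y 0 i) (g (s, t)).
      by apply: smooth_differentiable Ust.
    have -> : t * pderiv k (fun y => w y 0 i) (g (s, t)) = 'D_(t *: delta_mx 0 k) (fun y => w y 0 i) (g (s, t)).
      rewrite derive_pderiv // (bigD1 k) //= big1 => [|j jk].
        by rewrite !mxE !eqxx mulr1 addr0.
      by rewrite !mxE eqxx /= (negPf jk) mulr0 mul0r.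
    have -> : (fun r => w (g (r, t)) 0 i) =
              (fun r => w (p + t *: (x - p) + r *: (t *: delta_mx 0 k)) 0 i).
      by apply/funext => r; rewrite gE.
    rewrite gE.
    apply: (@is_derive_line _ (fun y => w y 0 i)).
    by rewrite -gE; apply: diff_derivable.
  have d2 i : is_derive (s : R) (1 : R) (fun r => u r 0 i) (i == k)%:R.
    have -> : (fun r => u r 0 i) = cst (x 0 i - p 0 i) + (i == k)%:R *: id.
      by apply/funext => r; rewrite /u !mxE eqxx /= addrAC [r * _]mulrC.
    have := is_deriveD (is_derive_cst (x 0 i - p 0 i) (s : R) (1 : R))
      (is_deriveZ (i == k)%:R (is_derive_id (s : R) (1 : R))).
    by rewrite add0r /GRing.scale /= mulr1.
  have -> : d s t = \sum_i (w (g (s, t)) 0 i * (i == k)%:R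
       + u s 0 i * (t * pderiv k (fun y => w y 0 i) (g (s, t)))).
    rewrite big_split /=; congr (_ + _).
      rewrite (bigD1 k) //= big1 ?addr0 ?eqxx ?mulr1 // => j jk.
      by rewrite (negPf jk) mulr0.
    by rewrite mulr_sumr; apply: eq_bigr => i _; rewrite mulrA mulrC.
  have -> : f^~ t = \sum_(i < 4) (fun r => w (g (r, t)) 0 i * u r 0 i).
    by apply/funext => r; rewrite fct_sumE.
  apply: is_derive_sum => i.
  exact: (@is_deriveM _ _ (fun r => w (g (r, t)) 0 i) (fun r => u r 0 i)).
have cs (s t : R) : {for t, continuous (fun t : R => (s, t))}.
  have h1 : s @[x --> t] --> s by exact: cvg_cst.
  have h2 : x @[x --> t] --> t by exact: cvg_id.
  exact: (cvg_pair h1 h2).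
have cf (s t : R) : `|s| <= e -> 0 <= t <= 1 -> {for t, continuous (f s)}.
  move=> s1 t1; apply: (@continuous_at_sum _ _ _ _ (fun i t => w (g (s, t)) 0 i * u s 0 i)) => i.
  have h1 := continuous_comp (cs s t) (cc (fun y => w y 0 i) (s, t) (sw i) s1 t1).
  have h2 : {for t, continuous (fun=> u s 0 i)} by exact: cst_continuous.
  exact: (continuousM h1 h2).
have cd (q : R * R) : `|q.1| <= e -> 0 <= q.2 <= 1 -> {for q, continuous (fun r => d r.1 r.2)}.
  move=> q1 q2.
  have E (h : 'rV[R]_4 -> R) : (fun q : R * R => h (g (q.1, q.2))) = h \o g.
    by apply/funext => -[].
  have h1 := cc (fun y => w y 0 k) q (sw k) q1 q2; rewrite -E in h1.
  have h2 i : {for q, continuous (fun q => pderiv k (fun y => w y 0 i) (g (q.1, q.2)) * u q.1 0 i)}.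
    have h := cc _ q (sdw i) q1 q2; rewrite -E in h.
    exact: (continuousM h (cui i q)).
  have h3 : {for q, continuous (fun q : R * R => \sum_i pderiv k (fun y => w y 0 i) (g (q.1, q.2)) * u q.1 0 i)}.
    exact: (@continuous_at_sum _ _ _ _ (fun i q => pderiv k (fun y => w y 0 i) (g (q.1, q.2)) * u q.1 0 i)).
  exact: (continuousD h1 (continuousM (c2 q) h3)).
have lE : (fun s => lam (x + s *: delta_mx 0 k)) =
   (fun s => \int[@lebesgue_measure R]_(t in `[0, 1]) f s t) by [].
rewrite lE.
suff <- : \int[@lebesgue_measure R]_(t in `[0, 1]) d 0 t = w x 0 k.
  exact: is_derive_integral01 e0 df cf cd.
have E0 : `|0 : R| <= e by rewrite normr0 ltW.
have u0 : u 0 = x - p by rewrite /u scale0r addr0.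
have H1 (t : R) : 0 <= t <= 1 ->
    is_derive t (1 : R) (fun t => t * w (p + t *: (x - p)) 0 k) (d 0 t).
  move=> t1; have Ut := Ug (0, t) E0 t1; rewrite /g /= u0 in Ut.
  have dd := smooth_differentiable oU (sw k) Ut.
  have D1 := @is_derive_line _ (fun y => w y 0 k) p (x - p) t (diff_derivable dd).
  have -> : d 0 t = t * 'D_(x - p) (fun y => w y 0 k) (p + t *: (x - p)) +
                    w (p + t *: (x - p)) 0 k * 1.
    rewrite derive_pderiv // mulr1 addrC /d /g /= u0; congr (_ + t * _).
    by apply: eq_bigr => i _; rewrite mulrC cw.
  exact: (@is_deriveM _ _ (@id R) (fun t => w (p + t *: (x - p)) 0 k)).
have H2 (t : R) : 0 <= t <= 1 -> {for t, continuous (d 0)}.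
  by move=> t1; exact: (continuous_comp (cs 0 t) (cd (0, t) E0 t1)).
by rewrite (Rintegral01_derivative H1 H2) mul1r mul0r subr0 scale1r addrC subrK.
Qed.

(** * Linear algebra of the system (A) *)

Notation o0 := (@Ordinal 4 0 isT).
Notation o1 := (@Ordinal 4 1 isT).
Notation o2 := (@Ordinal 4 2 isT).
Notation o3 := (@Ordinal 4 3 isT).

Lemma sum4 (V : nmodType) (f : 'I_4 -> V) : \sum_i f i = f o0 + f o1 + f o2 + f o3.
Proof.
rewrite !big_ord_recr big_ord0 /= add0r.
by congr (_ + _ + _ + _); congr f; apply: val_inj.
Qed.

Lemma ord4P (P : 'I_4 -> Prop) : P o0 -> P o1 -> P o2 -> P o3 -> forall i, P i.
Proof.
move=> p0 p1 p2 p3 [[|[|[|[|m]]]] Hm] //.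
- by rewrite (_ : Ordinal Hm = o0) //; apply: val_inj.
- by rewrite (_ : Ordinal Hm = o1) //; apply: val_inj.
- by rewrite (_ : Ordinal Hm = o2) //; apply: val_inj.
- by rewrite (_ : Ordinal Hm = o3) //; apply: val_inj.
Qed.

Section BilinearForm.
Context {F : fieldType} {n : nat}.
Implicit Types (a b : 'M[F]_n) (x y : 'rV[F]_n).

Definition form a x y : F := (x *m a *m y^T) 0 0.

Lemma formDl a x x' y : form a (x + x') y = form a x y + form a x' y.
Proof. by rewrite /form !mulmxDl mxE. Qed.
Lemma formDr a x y y' : form a x (y + y') = form a x y + form a x y'.
Proof. by rewrite /form linearD mulmxDr mxE. Qed.
Lemma formZl a c x y : form a (c *: x) y = c * form a x y.
Proof. by rewrite /form -!scalemxAl mxE. Qed.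
Lemma formZr a c x y : form a x (c *: y) = c * form a x y.
Proof. by rewrite /form linearZ /= -scalemxAr mxE. Qed.
Lemma form0l a y : form a 0 y = 0.
Proof. by rewrite /form !mul0mx mxE. Qed.
Lemma form0r a x : form a x 0 = 0.
Proof. by rewrite /form trmx0 mulmx0 mxE. Qed.

Lemma formC a x y : a^T = a -> form a x y = form a y x.
Proof.
move=> sa; rewrite /form -[in LHS]sa; set m := _ *m _ *m _.
have -> : m = (y *m a *m x^T)^T by rewrite !trmx_mul trmxK mulmxA.
by rewrite mxE.
Qed.

Lemma form_linear_comb a b (c d : F) x y :
  form (c *: a + d *: b) x y = c * form a x y + d * form b x y.
Proof. by rewrite /form mulmxDr mulmxDl -!scalemxAr -!scalemxAl !mxE. Qed.

Lemma form_delta a i j : form a (delta_mx 0 i) (delta_mx 0 j) = a i j.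
Proof. by rewrite /form -rowE trmx_delta -colE !mxE. Qed.

Lemma form_eq0 a x : (forall y, form a x y = 0) -> x *m a = 0.
Proof.
move=> H; apply/rowP => j; have := H (delta_mx 0 j).
by rewrite /form trmx_delta -colE !mxE.
Qed.

Lemma form_kerl a x y : x *m a = 0 -> form a x y = 0.
Proof. by move=> H; rewrite /form H mul0mx mxE. Qed.

Lemma form_kerr a x y : a^T = a -> y *m a = 0 -> form a x y = 0.
Proof. by move=> sa H; rewrite formC // form_kerl. Qed.

(** Linear dependence as vanishing of 2x2 minors: symmetric in [a] and [b], valid for zero matrices,
    and testable over a larger field. *)
Definition proportional a b := forall i j k l, a i j * b k l = a k l * b i j.

Lemma form_proportional a b :
  (forall x y x' y', form a x y * form b x' y' = form a x' y' * form b x y) ->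
  proportional a b.
Proof. by move=> H i j k l; rewrite -!form_delta H. Qed.
End BilinearForm.

(** The eigenvalues of [a *m invmx b] are the parameters at which the pencil [a - lam *: b] is
    singular. *)
Lemma closed_eigenvector (F : closedFieldType) n (a b : 'M[F]_n.+1) : b \in unitmx ->
  exists (lam : F) (v : 'rV[F]_n.+1), v != 0 /\ v *m (a - lam *: b) = 0.
Proof.
move=> ub; pose m := a *m invmx b.
have /closed_rootP [lam] : size (char_poly m) != 1 by rewrite size_char_poly.
rewrite -eigenvalue_root_char => /eigenvalueP [v vm v0].
exists lam, v; split=> //; rewrite mulmxBr -scalemxAr scalemxAl -vm /m.
by rewrite -!mulmxA mulVmx // mulmx1 subrr.
Qed.

Definition coord_in (F : fieldType) n (P : 'M[F]_n) (x : 'rV[F]_n) i : F := (x *m invmx P) 0 i.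

Lemma coord_in_sum (F : fieldType) n (P : 'M[F]_n) x : P \in unitmx ->
  x = \sum_i coord_in P x i *: row i P.
Proof. by move=> uP; rewrite /coord_in -mulmx_sum_row mulmxKV. Qed.

Lemma coord_in_row (F : fieldType) n (P : 'M[F]_n) i j : P \in unitmx ->
  coord_in P (row i P) j = (i == j)%:R.
Proof. by move=> uP; rewrite /coord_in -row_mul mulmxV // !mxE. Qed.

Lemma coord_inD (F : fieldType) n (P : 'M[F]_n) x y i :
  coord_in P (x + y) i = coord_in P x i + coord_in P y i.
Proof. by rewrite /coord_in mulmxDl mxE. Qed.

Lemma coord_inZ (F : fieldType) n (P : 'M[F]_n) c x i :
  coord_in P (c *: x) i = c * coord_in P x i.
Proof. by rewrite /coord_in -scalemxAl mxE. Qed.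

(** In the rank normal form of [b] the right factor is invertible, so the left kernel is visible
    after multiplication by [col_ebase b], which is the passage to coordinates in the basis [P]. *)
Lemma kernel_basis (F : fieldType) n (b : 'M[F]_n) :
  exists2 P, P \in unitmx & forall x, x *m b = 0 <->
    (forall i : 'I_n, (i < \rank b)%N -> coord_in P x i = 0).
Proof.
exists (invmx (col_ebase b)); first by rewrite unitmx_inv col_ebase_unit.
move=> x; rewrite /coord_in invmxK.
have E : x *m b = (x *m col_ebase b *m pid_mx (\rank b)) *m row_ebase b.
  by rewrite -[in LHS](mulmx_ebase b) !mulmxA.
have R0 : x *m b = 0 <-> x *m col_ebase b *m (pid_mx (\rank b) : 'M[F]_n) = 0.
  rewrite E; split=> [H|->]; last by rewrite mul0mx.
  by rewrite -[LHS](mulmxK (row_ebase_unit b)) H mul0mx.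
have ent j : (x *m col_ebase b *m (pid_mx (\rank b) : 'M[F]_n)) 0 j =
    (x *m col_ebase b) 0 j * (j < \rank b)%N%:R.
  rewrite mxE (bigD1 j) //= big1 => [|i ij]; first by rewrite addr0 [pid_mx _ _ _]mxE eqxx.
  have ijn : (nat_of_ord i == nat_of_ord j) = false by apply/negbTE.
  by rewrite [pid_mx _ _ _]mxE ijn mulr0.
rewrite R0; split=> [H i ir|H].
  by have := ent i; rewrite H ir mulr1 mxE => <-.
by apply/rowP => j; rewrite ent [RHS]mxE; case: ltnP => [/H ->|_]; rewrite ?mul0r ?mulr0.
Qed.

(** * Solutions of (A) over an algebraically closed field *)

Section SkewPairs.
Context {F : numClosedFieldType}.

(** The diagonal gives [p x0 * t x0 = 0], hence [t x0 = 0]; then [x = x0] in the identity forces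
    [t y = 0]. *)
Lemma skew_rank1 (T : Type) (p t : T -> F) x0 : (forall x y, p x * t y = - (p y * t x)) ->
  p x0 != 0 -> forall y, t y = 0.
Proof.
move=> H p0; have t0 : t x0 = 0.
  have /eqP := H x0 x0.
  by rewrite -addr_eq0 -mulr2n mulrn_eq0 mulf_eq0 (negPf p0) => /eqP.
by move=> y; apply: (mulfI p0); rewrite H t0 !mulr0 oppr0.
Qed.

Local Notation V := 'rV[F]_4.
(** [W y z w] stands for the vector W^s_{jkm} y^j z^k w^m. [Wspan] says that no nonzero covector
    annihilates all values of [W], and [Wtr] is W^i_{jki} = 0. *)
Variable W : V -> V -> V -> V.
Hypothesis W2 : forall c y z z' w, W y (c *: z + z') w = c *: W y z w + W y z' w.
Hypothesis W3 : forall c y z w w', W y z (c *: w + w') = c *: W y z w + W y z w'.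
Hypothesis Wspan : forall v : 'cV[F]_4, (forall y z w, W y z w *m v = 0) -> v = 0.
Hypothesis Wtr : forall y z, \sum_i W y z (delta_mx 0 i) 0 i = 0.

Implicit Types (k x y z w : V) (a b : 'M[F]_4).

Definition is_solution (a : 'M[F]_4) :=
  [/\ a^T = a,
      forall x y z w, form a x (W y z w) = - form a y (W x z w)
    & forall x y z w, form a x (W y z w) = form a z (W w x y)].

Lemma is_solution_comb a b c d : is_solution a -> is_solution b ->
  is_solution (c *: a + d *: b).
Proof.
move=> [sa a1 a2] [sb b1 b2]; split.
- by rewrite linearD !linearZ /= sa sb.
- by move=> x y z w; rewrite !form_linear_comb a1 b1; ring.
- by move=> x y z w; rewrite !form_linear_comb a2 b2.
Qed.

(** Pair symmetry moves [z, w] to the first pair, where skew-symmetry is known, and back. *)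
Lemma solution_skew34 a x y z w : is_solution a ->
  form a x (W y z w) = - form a x (W y w z).
Proof. by move=> [_ s1 s2]; rewrite s2 s1 -s2. Qed.

Lemma solution_span a k : (forall y z w, form a k (W y z w) = 0) -> k *m a = 0.
Proof.
move=> H; have /(congr1 trmx) : (k *m a)^T = 0.
  apply: Wspan => y z w; apply/rowP => i; rewrite ord1 [RHS]mxE -(H y z w) /form.
  have -> : W y z w *m (k *m a)^T = (k *m a *m (W y z w)^T)^T by rewrite [RHS]trmx_mul trmxK.
  by rewrite mxE.
by rewrite trmxK trmx0.
Qed.

Lemma solution_kernel b k : is_solution b -> k *m b = 0 ->
  (forall z w, W k z w *m b = 0) /\ (forall y z, W y z k *m b = 0).
Proof.
move=> [sb b1 b2] kb.
have H z w : W k z w *m b = 0.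
  by apply: form_eq0 => x; rewrite formC // b1 form_kerl // oppr0.
split=> // y z; apply: form_eq0 => x; rewrite formC // b2.
by rewrite (form_kerr _ _ (H _ _)).
Qed.

(** By [skew_rank1] the factor [r] kills all values of [W], and these span the space. *)
Lemma solution_rank1 b (p : V -> F) (r : V -> F) x0 : is_solution b ->
  (forall x u, form b x u = p x * r u) -> p x0 != 0 -> b = 0.
Proof.
move=> [sb b1 b2] bE p0.
have rW y z w : r (W y z w) = 0.
  by apply: (@skew_rank1 _ p (fun y => r (W y z w)) x0) => // x y'; rewrite -!bE b1.
apply/row_matrixP => i; rewrite row0 rowE; apply: solution_span => y z w.
by rewrite bE rW mulr0.
Qed.

(** The hypothesis says that ker b is at most the line of [k] modulo ker a. Since [W y z k] stays in
    ker b, the form [a] sees it as a multiple of [k]; skew-symmetry of the resulting product in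
    [x, y] forces it to vanish ([skew_rank1]), and the pair symmetry carries this to
    [form a k (W y z w)]. *)
Lemma solution_codim1 a b k : is_solution a -> is_solution b -> k *m b = 0 ->
  (forall z, z *m b = 0 -> exists t : F, (z - t *: k) *m a = 0) -> k *m a = 0.
Proof.
move=> sola solb kb H; have [sa a1 a2] := sola.
have [/eqP //|/eqP ka] := eqVneq (k *m a) 0.
have /existsP/= [i p0] : [exists i : 'I_4, form a (delta_mx 0 i) k != 0].
  rewrite -negb_forall; apply/negP => /forallP /= E; apply: ka.
  apply/rowP => i; have /eqP := E i; rewrite formC // /form trmx_delta -colE mxE => ->.
  by rewrite mxE.
have Z x y z : form a x (W y z k) = 0.
  (* The scalar supplied by [H] depends on [y']; dividing by the nonzero value chosen above turns it
     into an explicit function of [y']. *)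
  pose t y' := form a (delta_mx 0 i) (W y' z k) / form a (delta_mx 0 i) k.
  have tE x' y' : form a x' (W y' z k) = form a x' k * t y'.
    have [_ /(_ y' z) /H [c Hc]] := solution_kernel solb kb.
    have cE u : form a u (W y' z k) = form a u k * c.
      by rewrite -[W y' z k](subrK (c *: k)) formDr formZr (form_kerr _ sa Hc) add0r mulrC.
    by rewrite /t !cE; field.
  rewrite tE (@skew_rank1 _ (fun x => form a x k) t (delta_mx 0 i)) ?mulr0 // => x' y'.
  by rewrite -!tE a1.
by apply: solution_span => y z w; rewrite a2 (solution_skew34 _ _ _ _ sola) Z oppr0.
Qed.

(** * A solution of rank 2 and its kernel *)

Section RankTwo.
Variables (b P : 'M[F]_4).
Hypotheses (solb : is_solution b) (uP : P \in unitmx).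
Hypothesis kerb : forall x, x *m b = 0 <-> coord_in P x o0 = 0 /\ coord_in P x o1 = 0.
Local Notation p x := (coord_in P x o0).
Local Notation q x := (coord_in P x o1).
Local Notation e0 := (row o0 P).
Local Notation e1 := (row o1 P).
Local Notation k2 := (row o2 P).
Local Notation k3 := (row o3 P).
(** The area form on the plane V / ker b; every alternating form on this plane is a multiple of
    it. *)
Local Notation om x y := (p x * q y - q x * p y).
Let al := form b e0 e0.
Let ga := form b e0 e1.
Let be := form b e1 e1.

Let basis x : x = p x *: e0 + q x *: e1 + coord_in P x o2 *: k2 + coord_in P x o3 *: k3.
Proof. by rewrite {1}(coord_in_sum x uP) sum4. Qed.

Let rowPE i j : coord_in P (row i P) j = (i == j)%:R. Proof. exact: coord_in_row. Qed.

Let k2b : k2 *m b = 0. Proof. by apply/kerb; rewrite !rowPE. Qed.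
Let k3b : k3 *m b = 0. Proof. by apply/kerb; rewrite !rowPE. Qed.

Let kerbE x : x *m b = 0 -> x = coord_in P x o2 *: k2 + coord_in P x o3 *: k3.
Proof. by move=> /kerb [x0 x1]; rewrite {1}[x]basis x0 x1 !scale0r !add0r. Qed.

Let formE a x u : k2 *m a = 0 -> k3 *m a = 0 -> a^T = a ->
  form a x u = p x * (form a e0 e0 * p u + form a e0 e1 * q u)
             + q x * (form a e0 e1 * p u + form a e1 e1 * q u).
Proof.
move=> h2 h3 sa; rewrite {1}[x]basis {1}[u]basis !(formDl, formDr, formZl, formZr).
by rewrite !(form_kerl _ h2) !(form_kerl _ h3) !(form_kerr _ sa h2) !(form_kerr _ sa h3)
  (formC e1 e0 sa); ring.
Qed.

Lemma skew_bilinear2 (g : V -> V -> F) :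
  (forall (c : F) x x' y, g (c *: x + x') y = c * g x y + g x' y) ->
  (forall x y, g x y = - g y x) -> (forall x y, x *m b = 0 -> g x y = 0) ->
  forall x y, g x y = om x y * g e0 e1.
Proof.
move=> gl gs gk.
have gD x x' y : g (x + x') y = g x y + g x' y by rewrite -{1}[x]scale1r gl mul1r.
have g0 y : g 0 y = 0 by apply: gk; rewrite mul0mx.
have gZ c x y : g (c *: x) y = c * g x y by rewrite -[c *: x]addr0 gl g0 addr0.
have gE x y : g x y = p x * g e0 y + q x * g e1 y.
  by rewrite {1}[x]basis !gD !gZ (gk _ y k2b) (gk _ y k3b) !mulr0 !addr0.
have gd x : g x x = 0.
  by have /eqP := gs x x; rewrite -addr_eq0 -mulr2n mulrn_eq0 => /eqP.
move=> x y; rewrite gE (gs e0) (gs e1) !(gE y) !gd (gs e1 e0); ring.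
Qed.

(** If the Gram determinant vanished, a nonzero combination of [e0] and [e1] would lie in ker b,
    although their coordinates [p, q] are independent. *)
Let DE : al * be - ga ^+ 2 != 0.
Proof.
apply/negP => /eqP D0.
have ker v : p v * al + q v * ga = 0 -> p v * ga + q v * be = 0 -> p v = 0 /\ q v = 0.
  move=> h1 h2; apply/kerb; apply: form_eq0 => u.
  have [sb _ _] := solb.
  rewrite (formE v u k2b k3b sb) -/al -/ga -/be.
  transitivity ((p v * al + q v * ga) * p u + (p v * ga + q v * be) * q u); first by ring.
  by rewrite h1 h2 !mul0r addr0.
have pv s t : p (s *: e0 + t *: e1) = s by rewrite coord_inD !coord_inZ !rowPE /= mulr1 mulr0 addr0.
have qv s t : q (s *: e0 + t *: e1) = t by rewrite coord_inD !coord_inZ !rowPE /= mulr1 mulr0 add0r.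
have D0' : al * be = ga ^+ 2 by apply/eqP; rewrite -subr_eq0 D0.
have [be0 ga0] : be = 0 /\ - ga = 0.
  have := ker (be *: e0 + (- ga) *: e1); rewrite pv qv; apply; last by ring.
  by rewrite mulrC D0'; ring.
have ga0' : ga = 0 by rewrite -[ga]opprK ga0 oppr0.
have [] := ker (0 *: e0 + 1 *: e1); rewrite pv qv ?ga0' ?be0 ?mulr0 ?mul0r ?addr0 // => _.
by move/eqP; rewrite oner_eq0.
Qed.

(** [pJ], [qJ] are the coordinates of the traceless map J of the plane with b(x, J y) = (al be -
    ga^2) om(x, y), and [c] is the factor by which [W] differs from om(z, w) J y modulo ker b. *)
Let c := form b e0 (W e1 e0 e1) / (al * be - ga ^+ 2).
Local Notation pJ y := (ga * p y + be * q y).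
Local Notation qJ y := (- (al * p y + ga * q y)).

(** The form b(x, W(y, z, w)) is alternating in [x, y] and in [z, w] and descends to the plane, so
    it is a multiple of om(x, y) om(z, w). Cramer's rule for the Gram matrix of [b] then recovers
    [W] modulo ker b. *)
Let pqW y z w : p (W y z w) = c * om z w * pJ y /\ q (W y z w) = c * om z w * qJ y.
Proof.
have [sb b1 b2] := solb.
have bW x : form b x (W y z w) = om x y * om z w * form b e0 (W e1 e0 e1).
  rewrite -mulrA -(@skew_bilinear2 (fun z w => form b e0 (W e1 z w))).
  - apply: (@skew_bilinear2 (fun x y => form b x (W y z w))).
    + by move=> d x' x'' y'; rewrite formDl formZl.
    + by move=> x' y'; rewrite b1.
    + by move=> x' y'; apply: form_kerl.
  - by move=> d x' x'' y'; rewrite W2 formDr formZr.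
  - by move=> x' y'; apply: solution_skew34.
  - by move=> x' y' kx; rewrite b2 form_kerl.
have h0 := bW e0; have h1 := bW e1.
rewrite (formE _ _ k2b k3b sb) !rowPE /= -/al -/ga -/be in h0.
rewrite (formE _ _ k2b k3b sb) !rowPE /= -/al -/ga -/be in h1.
set u := p (W y z w) in h0 h1 *; set v := q (W y z w) in h0 h1 *.
have H0 : al * u + ga * v = q y * om z w * form b e0 (W e1 e0 e1).
  by transitivity (1 * (al * u + ga * v) + 0 * (ga * u + be * v)); [ring|rewrite h0; ring].
have H1 : ga * u + be * v = - p y * om z w * form b e0 (W e1 e0 e1).
  by transitivity (0 * (al * u + ga * v) + 1 * (ga * u + be * v)); [ring|rewrite h1; ring].
have E0 : (al * be - ga ^+ 2) * u = (al * be - ga ^+ 2) * (c * om z w * pJ y).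
  transitivity (be * (al * u + ga * v) - ga * (ga * u + be * v)); first by ring.
  by rewrite H0 H1 /c; field.
have E1 : (al * be - ga ^+ 2) * v = (al * be - ga ^+ 2) * (c * om z w * qJ y).
  transitivity (al * (ga * u + be * v) - ga * (al * u + ga * v)); first by ring.
  by rewrite H0 H1 /c; field.
by split; apply: (mulfI DE).
Qed.

(** With [c = 0] the coordinate [p] would annihilate all values of [W], against [Wspan]. *)
Let c0 : c != 0.
Proof.
apply/negP => /eqP cz.
have v0 : invmx P *m (delta_mx o0 0 : 'cV[F]_4) = 0.
  apply: Wspan => y z w; apply/rowP => i; rewrite ord1 [RHS]mxE mulmxA -colE mxE.
  by have [] := pqW y z w; rewrite /coord_in cz !mul0r => ->.
have : P *m (invmx P *m (delta_mx o0 0 : 'cV[F]_4)) = 0 by rewrite v0 mulmx0.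
rewrite mulmxA mulmxV // mul1mx => /matrixP /(_ o0 0); rewrite !mxE /= => /eqP.
by rewrite oner_eq0.
Qed.

(** Both forms live on the plane. As c is nonzero, a(x, J y) is skew-symmetric; written out on
    [e0, e1], this is the vanishing of the three minors of [(u, v, t)] against [(al, ga, be)], in
    which every minor of the two forms expands. *)
Lemma rank2_kernel_sub a : is_solution a -> k2 *m a = 0 -> k3 *m a = 0 -> proportional a b.
Proof.
move=> [sa a1 _] h2 h3; have [sb _ _] := solb.
have om1 : om e0 e1 = 1 by rewrite !rowPE /=; ring.
have aW x y : form a x (W y e0 e1) =
    c * (p x * (form a e0 e0 * pJ y + form a e0 e1 * qJ y)
       + q x * (form a e0 e1 * pJ y + form a e1 e1 * qJ y)).
  have [pW qW] := pqW y e0 e1.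
  by rewrite (formE _ _ h2 h3 sa) pW qW om1; ring.
set u := form a e0 e0 in aW *; set v := form a e0 e1 in aW *; set t := form a e1 e1 in aW *.
have sk x y := a1 x y e0 e1.
have E00 : u * ga - v * al = 0.
  have := sk e0 e0; rewrite aW !rowPE /= => /eqP; rewrite -addr_eq0 -mulr2n mulrn_eq0 /=.
  rewrite mulf_eq0 (negPf c0) /= => /eqP E; rewrite -[RHS]E; ring.
have E11 : v * be - t * ga = 0.
  have := sk e1 e1; rewrite aW !rowPE /= => /eqP; rewrite -addr_eq0 -mulr2n mulrn_eq0 /=.
  rewrite mulf_eq0 (negPf c0) /= => /eqP E; rewrite -[RHS]E; ring.
have E01 : u * be - t * al = 0.
  have := sk e0 e1; rewrite !aW !rowPE /= -mulrN => /(mulfI c0) /eqP; rewrite -subr_eq0 => /eqP E.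
  rewrite -[RHS]E; ring.
apply: form_proportional => x y x' y'.
rewrite (formE x y h2 h3 sa) (formE x' y' h2 h3 sa) (formE x y k2b k3b sb) (formE x' y' k2b k3b sb).
rewrite -/al -/ga -/be -/u -/v -/t; apply/eqP; rewrite -subr_eq0; apply/eqP.
transitivity ((p x * p y * (p x' * q y' + q x' * p y') - (p x * q y + q x * p y) * (p x' * p y')) * (u * ga - v * al)
  + (p x * p y * q x' * q y' - q x * q y * p x' * p y') * (u * be - t * al)
  + ((p x * q y + q x * p y) * q x' * q y' - q x * q y * (p x' * q y' + q x' * p y')) * (v * be - t * ga)).
  by ring.
by rewrite E00 E11 E01 !mulr0 !addr0.
Qed.

(** The right-hand side is [c * form b y z]. The full trace of [W y z] is zero in any basis, and its
    part on the plane is the trace of w -> c om(z, w) J y, which is [- c * form b y z]. *)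
Let trace y z : coord_in P (W y z k2) o2 + coord_in P (W y z k3) o3 =
  c * (q z * pJ y - p z * qJ y).
Proof.
have T : \sum_i coord_in P (W y z (row i P)) i = 0.
  pose M := \matrix_(i, j) W y z (delta_mx 0 i) 0 j.
  have WM w : W y z w = w *m M.
    rewrite {1}[w]row_sum_delta mulmx_sum_row.
    have gD w1 w2 : W y z (w1 + w2) = W y z w1 + W y z w2 by rewrite -{1}[w1]scale1r W3 scale1r.
    have g0 : W y z 0 = 0 by apply: (addrI (W y z 0)); rewrite -gD !addr0.
    have gZ d w1 : W y z (d *: w1) = d *: W y z w1 by rewrite -[d *: w1]addr0 W3 g0 addr0.
    rewrite (big_morph _ gD g0); apply: eq_bigr => i _; rewrite gZ; congr (_ *: _).
    by apply/rowP => j; rewrite !mxE.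
  transitivity (\tr (P *m M *m invmx P)).
    rewrite /mxtrace; apply: eq_bigr => i _.
    by rewrite /coord_in WM -row_mul -row_mul mxE.
  rewrite mxtrace_mulC mulmxA mulVmx // mul1mx -(Wtr y z).
  by apply: eq_bigr => i _; rewrite mxE.
rewrite sum4 in T.
have [p0 _] := pqW y z e0; have [_ q1] := pqW y z e1.
rewrite p0 q1 !rowPE /= in T.
apply/eqP; rewrite -subr_eq0 -[X in _ == X]T; apply/eqP; ring.
Qed.


(** Once [k] lies in ker a, the plane ker b is at most a line modulo ker a, spanned by a basis
    vector independent of [k]; [solution_codim1] puts that vector in ker a as well. *)
Lemma rank2_common_kernel a k : is_solution a -> k != 0 -> k *m b = 0 -> k *m a = 0 ->
  k2 *m a = 0 /\ k3 *m a = 0.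
Proof.
move=> sola k0 kb ka.
have kE := kerbE kb; set s := coord_in P k o2 in kE; set t := coord_in P k o3 in kE.
have [s0|s0] := eqVneq s 0; last first.
  have k3a : k3 *m a = 0.
    apply: (solution_codim1 sola solb k3b) => z zb.
    exists (coord_in P z o3 - coord_in P z o2 * t / s).
    have -> : z - (coord_in P z o3 - coord_in P z o2 * t / s) *: k3 = (coord_in P z o2 / s) *: k.
      rewrite {1}(kerbE zb) kE; apply/rowP => i; rewrite !mxE.
      by field.
    by rewrite -scalemxAl ka scaler0.
  split=> //; apply: (scalerI s0); rewrite scaler0 scalemxAl.
  by rewrite -[s *: k2](addrK (t *: k3)) -kE mulmxBl ka -scalemxAl k3a scaler0 subr0.
have t0 : t != 0 by apply: contra_neq k0 => t0; rewrite kE s0 t0 !scale0r addr0.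
have k3a : k3 *m a = 0.
  have kE' : k = t *: k3 by rewrite kE s0 scale0r add0r.
  by apply: (scalerI t0); rewrite scaler0 scalemxAl -kE'.
split=> //; apply: (solution_codim1 sola solb k2b) => z zb.
exists (coord_in P z o2); rewrite {1}(kerbE zb) [_ + _ *: k3]addrC addrK.
by rewrite -scalemxAl k3a scaler0.
Qed.

(** The restriction of [a] to ker b can have rank 2, 0 or 1, and each case is contradictory. [D]
    below is the Gram determinant of this restriction. *)
Lemma rank2_injective a : is_solution a ->
  (forall k, k *m b = 0 -> k *m a = 0 -> k = 0) -> False.
Proof.
move=> sola inj; have [sa a1 a2] := sola; have [sb _ _] := solb.
have WK y z k : k *m b = 0 -> W y z k *m b = 0.
  by move=> kb; have [_ ->] := solution_kernel solb kb.
have WK1 z w k : k *m b = 0 -> W k z w *m b = 0.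
  by move=> kb; have [-> _] := solution_kernel solb kb.
have om1 : om e0 e1 = 1 by rewrite !rowPE /=; ring.
(* With [A x y z w = form a x (W y z w)]: evaluate [A x y z k = - A z k y x]
   through the two components of [W] outside the kernel. *)
have key k m n : k *m b = 0 -> (forall x, form a k x = m * p x + n * q x) ->
    forall x y z, form a x (W y z k) = c * om y x * (m * pJ z + n * qJ z).
  move=> kb kE x y z; rewrite a2 a1 (solution_skew34 _ _ _ _ sola) opprK kE.
  by have [-> ->] := pqW z y x; ring.
pose D := form a k2 k2 * form a k3 k3 - form a k2 k3 ^+ 2.
have fK k x : k *m b = 0 -> form a k x =
   coord_in P k o2 * form a k2 x + coord_in P k o3 * form a k3 x.
  by move=> kb; rewrite {1}(kerbE kb) formDl !formZl.
(* Rank 2: [a] is nondegenerate on ker b. *)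
have [D0|D0] := eqVneq D 0; last first.
  have KK u : u *m b = 0 -> form a k2 u = 0 -> form a k3 u = 0 -> u = 0.
    move=> ub h2 h3; rewrite (formC k2 u sa) fK // (formC k3 k2 sa) in h2.
    rewrite (formC k3 u sa) fK // in h3.
    have E2 : D * coord_in P u o2 = 0.
      transitivity (form a k3 k3 * (coord_in P u o2 * form a k2 k2 + coord_in P u o3 * form a k2 k3)
         - form a k2 k3 * (coord_in P u o2 * form a k2 k3 + coord_in P u o3 * form a k3 k3)).
        by rewrite /D; ring.
      by rewrite h2 h3 !mulr0 subr0.
    have E3 : D * coord_in P u o3 = 0.
      transitivity (form a k2 k2 * (coord_in P u o2 * form a k2 k3 + coord_in P u o3 * form a k3 k3)
         - form a k2 k3 * (coord_in P u o2 * form a k2 k2 + coord_in P u o3 * form a k2 k3)).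
        by rewrite /D; ring.
      by rewrite h2 h3 !mulr0 subr0.
    move/eqP: E2; move/eqP: E3; rewrite !mulf_eq0 (negPf D0) /= => /eqP u3 /eqP u2.
    by rewrite (kerbE ub) u2 u3 !scale0r addr0.
  (* Cramer's rule: [y] is [e0] corrected to be [a]-orthogonal to ker b. Then [W y z] vanishes on
     ker b, and [trace] gives [form b y z = 0] for all [z], although [y] is nonzero modulo ker b. *)
  pose s := (form a k2 k3 * form a k3 e0 - form a k3 k3 * form a k2 e0) / D.
  pose t := (form a k2 k3 * form a k2 e0 - form a k2 k2 * form a k3 e0) / D.
  pose y := e0 + s *: k2 + t *: k3.
  have y2 : form a k2 y = 0.
    by rewrite /y !formDr !formZr /s /t /D; field.
  have y3 : form a k3 y = 0.
    by rewrite /y !formDr !formZr (formC k3 k2 sa) /s /t /D; field.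
  have Wy z k : k *m b = 0 -> W y z k = 0.
    move=> kb; apply: KK; first exact: WK.
      by rewrite a1 formC // fK ?WK1 // y2 y3 !mulr0 addr0 oppr0.
    by rewrite a1 formC // fK ?WK1 // y2 y3 !mulr0 addr0 oppr0.
  have T z := trace y z.
  have c00 i : coord_in P 0 i = 0 by rewrite /coord_in mul0mx mxE.
  have py : p y = 1 by rewrite /y !coord_inD !coord_inZ !rowPE /= !mulr0 !addr0.
  have qy : q y = 0 by rewrite /y !coord_inD !coord_inZ !rowPE /= !mulr0 !addr0.
  have := T e0; have := T e1; rewrite !Wy // !c00 py qy !rowPE /=.
  rewrite addr0 => /esym/eqP; rewrite mulf_eq0 (negPf c0) /= => /eqP E1.
  move=> /esym/eqP; rewrite mulf_eq0 (negPf c0) /= => /eqP E2.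
  have ga0 : ga = 0 by rewrite -[RHS]E1; ring.
  have al0 : al = 0 by rewrite -[RHS]E2; ring.
  by move: DE; rewrite ga0 al0 mul0r expr0n subr0 eqxx.
(* Rank 0: [a] pairs ker b with the plane V / ker b, and injectivity makes the determinant [E] of
   this pairing nonzero. *)
have [B0|B0] := boolP [&& form a k2 k2 == 0, form a k2 k3 == 0 & form a k3 k3 == 0].
  have /and3P [/eqP B22 /eqP B23 /eqP B33] := B0.
  have fE k x : k *m b = 0 -> form a k x = form a k e0 * p x + form a k e1 * q x.
    move=> kb; rewrite {1}[x]basis !formDr !formZr.
    rewrite (fK k k2) // (fK k k3) // B22 (formC k3 k2 sa) B23 B33; ring.
  set m2 := form a k2 e0 in fE *; set n2 := form a k2 e1 in fE *.
  set m3 := form a k3 e0; set n3 := form a k3 e1.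
  pose E := m2 * n3 - m3 * n2.
  have E0 : E != 0.
    apply/negP => /eqP E0.
    have N k : k *m b = 0 -> form a k e0 = 0 -> form a k e1 = 0 -> k = 0.
      move=> kb h0 h1; apply: inj => //; apply: form_eq0 => x.
      by rewrite fE // h0 h1 !mul0r addr0.
    have kst s t : (s *: k2 + t *: k3) *m b = 0.
      by rewrite mulmxDl -!scalemxAl k2b k3b !scaler0 addr0.
    have cst s t : coord_in P (s *: k2 + t *: k3) o2 = s /\ coord_in P (s *: k2 + t *: k3) o3 = t.
      by rewrite !coord_inD !coord_inZ !rowPE /= !mulr0 !mulr1 addr0 add0r.
    have Z s t : s * m2 + t * m3 = 0 -> s * n2 + t * n3 = 0 -> s = 0 /\ t = 0.
      move=> h0 h1; have := N _ (kst s t); rewrite !formDl !formZl => /(_ h0 h1) z.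
      have [hs ht] := cst s t; rewrite z /coord_in mul0mx !mxE in hs ht.
      by rewrite -hs -ht.
    have [||m30 /eqP] := Z m3 (- m2); [by ring|by rewrite -[RHS]oppr0 -[in RHS]E0 /E; ring|].
    rewrite oppr_eq0 => /eqP m20.
    have [||n30 /eqP] := Z n3 (- n2); [by rewrite m20 m30; ring|by ring|].
    rewrite oppr_eq0 => /eqP n20.
    have [||/eqP] := Z 1 0; [by rewrite m20; ring|by rewrite n20; ring|].
    by rewrite oner_eq0.
  have S k m n y z : k *m b = 0 -> (forall x, form a k x = m * p x + n * q x) ->
      let u := W y z k in
      coord_in P u o2 * m2 + coord_in P u o3 * m3 = - (c * q y * (m * pJ z + n * qJ z)) /\
      coord_in P u o2 * n2 + coord_in P u o3 * n3 = c * p y * (m * pJ z + n * qJ z).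
    move=> kb kE u; have ub : u *m b = 0 by exact: WK.
    by rewrite -!fK // !(formC u _ sa) !(key k m n) // !rowPE /=; split; ring.
  (* Solving [S] for the coordinates gives [- c * form b y z] for the trace of [W y z] on ker b,
     while [trace] gives the same with the opposite sign; hence [b] vanishes. *)
  have Bz y z : al * p y * p z + ga * (p y * q z + q y * p z) + be * q y * q z = 0.
    have [u0 u1] := S k2 m2 n2 y z k2b (fun x => fE k2 x k2b).
    have [v0 v1] := S k3 m3 n3 y z k3b (fun x => fE k3 x k3b).
    have T := trace y z.
    set r := coord_in P (W y z k2) o2 in u0 u1 T *; set r' := coord_in P (W y z k2) o3 in u0 u1 *.
    set w := coord_in P (W y z k3) o3 in v0 v1 T *; set w' := coord_in P (W y z k3) o2 in v0 v1 *.
    have E1 : E * (r + w) = n3 * (r * m2 + r' * m3) - m3 * (r * n2 + r' * n3)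
       + m2 * (w' * n2 + w * n3) - n2 * (w' * m2 + w * m3) by rewrite /E; ring.
    rewrite T u0 u1 v0 v1 in E1.
    have : 2%:R * (E * (c * (al * p y * p z + ga * (p y * q z + q y * p z) + be * q y * q z))) = 0.
      by move/eqP: E1; rewrite -subr_eq0 => /eqP E1; rewrite -[RHS]E1 /E; ring.
    by move/eqP; rewrite mulf_eq0 pnatr_eq0 /= mulf_eq0 (negPf E0) /= mulf_eq0 (negPf c0) => /eqP.
  have := Bz e0 e0; have := Bz e0 e1; rewrite !rowPE /= => h1 h2.
  have ga0 : ga = 0 by rewrite -[RHS]h1; ring.
  have al0 : al = 0 by rewrite -[RHS]h2; ring.
  by move: DE; rewrite ga0 al0 mul0r expr0n subr0 eqxx.
(* Rank 1: [k] spans the radical of [a] restricted to ker b. *)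
have [k [kb kn kK kU]] : exists k, [/\ k *m b = 0, k != 0,
    forall l, l *m b = 0 -> form a k l = 0 &
    forall u, u *m b = 0 -> form a u k2 = 0 -> form a u k3 = 0 -> exists mu : F, u = mu *: k].
  have k2n : k2 != 0.
    apply/negP => /eqP k20; have := rowPE o2 o2; rewrite k20 /coord_in mul0mx mxE eqxx => /eqP.
    by rewrite eq_sym oner_eq0.
  have [B22|B22] := eqVneq (form a k2 k2) 0.
    have B23 : form a k2 k3 = 0.
      by move/eqP: D0; rewrite /D B22 mul0r sub0r oppr_eq0 expf_eq0 /= => /eqP.
    have B33 : form a k3 k3 != 0 by move: B0; rewrite B22 B23 eqxx.
    exists k2; split=> // [l lb|u ub _].
      by rewrite formC // fK // (formC k3 k2 sa) B22 B23 !mulr0 addr0.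
    rewrite fK // B23 mulr0 add0r => /eqP; rewrite mulf_eq0 (negPf B33) orbF => /eqP u3.
    by exists (coord_in P u o2); rewrite {1}(kerbE ub) u3 scale0r addr0.
  pose k := form a k2 k3 *: k2 - form a k2 k2 *: k3.
  have kb : k *m b = 0 by rewrite mulmxBl -!scalemxAl k2b k3b !scaler0 subr0.
  exists k; split=> // [|l lb|u ub h2 h3].
  - apply: contra_neq B22 => k0.
    have : coord_in P k o3 = - form a k2 k2.
      by rewrite /k -scaleNr coord_inD !coord_inZ !rowPE /=; ring.
    by rewrite k0 /coord_in mul0mx mxE => /eqP; rewrite eq_sym oppr_eq0 => /eqP.
  - rewrite (kerbE lb) !formDr !formZr /k -scaleNr !formDl !formZl (formC k3 k2 sa).
    transitivity (- coord_in P l o3 * D); first by rewrite /D; ring.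
    by rewrite D0 mulr0.
  - rewrite fK // (formC k3 k2 sa) in h2.
    exists (- coord_in P u o3 / form a k2 k2); rewrite {1}(kerbE ub) /k.
    have -> : coord_in P u o2 = - coord_in P u o3 / form a k2 k2 * form a k2 k3.
      apply: (mulIf B22); rewrite -[LHS](addrK (coord_in P u o3 * form a k2 k3)) h2.
      by field.
    by apply/rowP => i; rewrite !mxE; field.
pose m := form a k e0; pose n := form a k e1.
have kE x : form a k x = m * p x + n * q x.
  rewrite {1}[x]basis !formDr !formZr (kK _ k2b) (kK _ k3b) -/m -/n; ring.
have omK y x : x *m b = 0 -> om y x = 0 by move=> /kerb [-> ->]; ring.
(* [W y z k] is in ker b and [a]-orthogonal to ker b, hence a multiple of [k]. Pairing it with
   [n *: e0 - m *: e1], which is [a]-orthogonal to [k], makes the formula of [key] vanish. *)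
have Sz z : (m * (m * pJ z + n * qJ z) = 0) /\ (n * (m * pJ z + n * qJ z) = 0).
  have Ey y : (p y * m + q y * n) * (m * pJ z + n * qJ z) = 0.
    have [||mu Emu] := kU (W y z k) (WK y z k kb).
    - by rewrite formC // (key k m n) // omK // mulr0 mul0r.
    - by rewrite formC // (key k m n) // omK // mulr0 mul0r.
    have := key k m n kb kE (n *: e0 - m *: e1) y z.
    rewrite Emu formZr formC // kE -scaleNr !coord_inD !coord_inZ !rowPE /= => E.
    apply: (mulfI c0); rewrite mulr0; apply: oppr_inj; rewrite oppr0.
    transitivity (mu * (m * (n * 1 + - m * 0) + n * (n * 0 + - m * 1))); last by ring.
    by rewrite E; ring.
  have := Ey e0; have := Ey e1; rewrite !rowPE /= => E1 E0.
  by split; [rewrite -[RHS]E0|rewrite -[RHS]E1]; ring.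
have mn0 : m = 0 /\ n = 0.
  have S0 z : (m * pJ z + n * qJ z) = 0 \/ (m = 0 /\ n = 0).
    have [/eqP h1 /eqP h2] := Sz z; move: h1 h2; rewrite !mulf_eq0.
    by have [->|_] := eqVneq (m * pJ z + n * qJ z) 0; [left|rewrite !orbF => /eqP ? /eqP ?; right].
  have [h0|//] := S0 e0; have [h1|//] := S0 e1.
  rewrite !rowPE /= in h0 h1.
  split; apply: (mulfI DE); rewrite mulr0.
    transitivity (al * (m * (ga * 0 + be * 1) + n * - (al * 0 + ga * 1))
      - ga * (m * (ga * 1 + be * 0) + n * - (al * 1 + ga * 0))); first by ring.
    by rewrite h0 h1 !mulr0 subr0.
  transitivity (ga * (m * (ga * 0 + be * 1) + n * - (al * 0 + ga * 1))
      - be * (m * (ga * 1 + be * 0) + n * - (al * 1 + ga * 0))); first by ring.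
  by rewrite h0 h1 !mulr0 subr0.
move: kn; rewrite (inj k kb) ?eqxx //; apply: form_eq0 => x.
by rewrite kE; have [-> ->] := mn0; rewrite !mul0r addr0.
Qed.

Lemma rank2_proportional a : is_solution a -> proportional a b.
Proof.
move=> sola.
have [[k [k0 kb ka]]|H] := pselect (exists k, [/\ k != 0, k *m b = 0 & k *m a = 0]).
  by have [h2 h3] := rank2_common_kernel sola k0 kb ka; exact: rank2_kernel_sub.
exfalso; apply: (rank2_injective sola) => k kb ka; apply/eqP; apply/negPn/negP => k0.
by apply: H; exists k.
Qed.

End RankTwo.

Lemma solution_rank_le2 a b : is_solution a -> is_solution b -> b != 0 ->
  (\rank b <= 2)%N -> proportional a b.
Proof.
move=> sola solb b0 rb; have [P uP kerP] := kernel_basis b.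
have [sb _ _] := solb.
have [r2|r2] := eqVneq (\rank b) 2%N.
  apply: (rank2_proportional solb uP) => // x; rewrite kerP r2; split=> [H|[h0 h1]].
    by split; apply: H.
  by apply: ord4P => // _.
have r1 : \rank b = 1%N.
  have : \rank b != 0%N by rewrite mxrank_eq0.
  by move: rb r2; case: (\rank b) => [|[|[|]]].
exfalso; move/eqP: b0; apply.
pose e0 := row o0 P.
have kerE (i : 'I_4) : (0 < i)%N -> row i P *m b = 0.
  move=> i0; apply/kerP => j; rewrite r1 ltnS leqn0 => /eqP j0.
  by rewrite coord_in_row // -val_eqE /= j0 gtn_eqF.
have bE x u : form b x u = coord_in P x o0 * form b e0 u.
  rewrite {1}(coord_in_sum x uP) sum4 !formDl !formZl.
  by rewrite (form_kerl _ (kerE o1 _)) // (form_kerl _ (kerE o2 _)) // (form_kerl _ (kerE o3 _)) // !mulr0 !addr0.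
apply: (solution_rank1 solb bE (x0 := e0)).
by rewrite coord_in_row // eqxx oner_eq0.
Qed.

Lemma solution_degenerate a b : is_solution a -> is_solution b -> b != 0 ->
  b \notin unitmx -> proportional a b.
Proof.
move=> sola solb b0 ub.
have [r2|r3] := leqP (\rank b) 2; first exact: solution_rank_le2.
have rb : \rank b = 3%N.
  apply/eqP; rewrite eqn_leq r3 andbT -ltnS ltn_neqAle rank_leq_row andbT.
  by move: ub; rewrite -row_free_unit.
have [P uP kerP] := kernel_basis b; have [sa _ _] := sola; have [sb _ _] := solb.
pose k := row o3 P.
have kb : k *m b = 0.
  by apply/kerP => i; rewrite rb => i3; rewrite coord_in_row // -val_eqE /= gtn_eqF.
have kerb x : x *m b = 0 -> x = coord_in P x o3 *: k.
  by move=> /kerP H; rewrite {1}(coord_in_sum x uP) sum4 (H o0) ?rb // (H o1) ?rb // (H o2) ?rb // !scale0r !add0r.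
have ka : k *m a = 0.
  apply: (solution_codim1 sola solb kb) => z zb; exists (coord_in P z o3).
  by rewrite {1}(kerb z zb) subrr mul0mx.
pose w (i : 'I_3) : 'I_4 := widen_ord (leqnSn 3) i.
(* [sub c] is the Gram matrix of [c] on the first three basis vectors, that is, the form on the
   quotient by [k]; [ext] lifts vectors of the quotient. *)
pose sub (c : 'M[F]_4) : 'M[F]_3 := \matrix_(i, j) form c (row (w i) P) (row (w j) P).
pose ext (v : 'rV[F]_3) : 'rV[F]_4 := \sum_i v 0 i *: row (w i) P.
have coord_ext v i : coord_in P (ext v) (w i) = v 0 i.
  rewrite /coord_in /ext mulmx_suml summxE (bigD1 i) //= big1 => [|j ji].
    by rewrite -scalemxAl mxE -/(coord_in _ _ _) coord_in_row // eqxx mulr1 addr0.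
  by rewrite -scalemxAl mxE -/(coord_in _ _ _) coord_in_row // -val_eqE /= val_eqE (negPf ji) mulr0.
have coord_ext3 v : coord_in P (ext v) o3 = 0.
  rewrite /coord_in /ext mulmx_suml summxE big1 // => j _.
  rewrite -scalemxAl mxE -/(coord_in _ _ _) coord_in_row // -val_eqE /=.
  by rewrite ltn_eqF ?mulr0.
have sub_ker c v : c^T = c -> k *m c = 0 -> v *m sub c = 0 -> ext v *m c = 0.
  move=> sc kc vc; apply: form_eq0 => y.
  have extw j : form c (ext v) (row (w j) P) = 0.
    have := congr1 (fun m : 'rV[F]_3 => m 0 j) vc; rewrite !mxE => <-.
    rewrite /ext (big_morph (fun x => form c x _) (fun x y => formDl c x y _) (form0l c _)).
    by apply: eq_bigr => i _; rewrite formZl mxE.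
  rewrite {1}(coord_in_sum y uP) big_ord_recr /= formDr formZr.
  rewrite [X in _ + _ * X](_ : _ = 0) ?mulr0 ?addr0; last first.
    by rewrite (_ : row ord_max P = k) ?(form_kerr _ sc kc) //; congr row; apply: val_inj.
  rewrite (big_morph (fun x => form c (ext v) x) (formDr c (ext v)) (form0r c _)).
  by apply: big1 => i _; rewrite formZr extw mulr0.
have usub : sub b \in unitmx.
  rewrite -row_free_unit -kermx_eq0; apply/eqP/row_matrixP => i; rewrite row0.
  apply/rowP => j; rewrite -(coord_ext (row i (kermx (sub b)))) mxE.
  have /kerb -> : ext (row i (kermx (sub b))) *m b = 0.
    by apply: sub_ker => //; rewrite -row_mul mulmx_ker row0.
  by rewrite coord_ext3 scale0r /coord_in mul0mx mxE.
have [lam [v [v0 vE]]] := closed_eigenvector (sub a) usub.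
pose c := 1 *: a + (- lam) *: b.
have solc : is_solution c by exact: is_solution_comb.
have [sc _ _] := solc.
have kc : k *m c = 0 by rewrite /c mulmxDr -!scalemxAr ka kb !scaler0 addr0.
have ec : ext v *m c = 0.
  apply: sub_ker => //; rewrite -[RHS]vE; congr (_ *m _).
  by apply/matrixP => i j; rewrite !mxE /c form_linear_comb mul1r mulNr.
have [cz|cn] := eqVneq c 0.
  have aE : a = lam *: b.
    by apply/eqP; rewrite -subr_eq0 -scaleNr -{1}[a]scale1r -/c cz.
  by move=> i j i' j'; rewrite aE !mxE; ring.
(* The lifted eigenvector and [k] are independent vectors in the kernel of [c]. *)
have rc : (\rank c <= 2)%N.
  have : (\rank (kermx c) >= 2)%N.
    have sK : (col_mx (ext v) k <= kermx c)%MS.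
      by rewrite col_mx_sub !sub_kermx ec kc !eqxx.
    apply: leq_trans (mxrankS sK).
    have : row_free (col_mx (ext v) k).
      rewrite -kermx_eq0; apply/eqP/row_matrixP => i; rewrite row0.
      have := mulmx_ker (col_mx (ext v) k) => /(congr1 (row i)); rewrite row0 row_mul.
      set u := row i _; rewrite -[u]hsubmxK mul_row_col => E.
      have [s sE] : exists s, lsubmx u = s%:M by exists (lsubmx u 0 0); rewrite [LHS]mx11_scalar.
      have [t tE] : exists t, rsubmx u = t%:M by exists (rsubmx u 0 0); rewrite [LHS]mx11_scalar.
      rewrite sE tE !mul_scalar_mx in E *.
      have t0 : t = 0.
        have := congr1 (fun x => coord_in P x o3) E.
        by rewrite coord_inD !coord_inZ coord_ext3 coord_in_row // eqxx mulr0 mulr1 add0r /coord_in mul0mx mxE.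
      rewrite t0 scale0r addr0 in E *.
      have s0 : s = 0.
        apply/eqP; apply: contraNT v0 => sn; apply/eqP/rowP => j.
        apply: (mulfI sn); rewrite -coord_ext -coord_inZ E /coord_in mul0mx !mxE mulr0.
        by [].
      by rewrite s0 -[RHS]hsubmxK !raddf0.
    by rewrite /row_free => /eqP ->.
  rewrite mxrank_ker; have := rank_leq_row c; case: (\rank c) => [|[|[|[|[]]]]] //.
have bc := solution_rank_le2 solb solc cn rc.
move=> i j i' j'; have := bc i j i' j'; rewrite !mxE => E.
apply/eqP; rewrite -subr_eq0; apply/eqP.
transitivity (b i' j' * (1 * a i j + - lam * b i j) - b i j * (1 * a i' j' + - lam * b i' j')); first by ring.
by rewrite -E; ring.
Qed.

Theorem solutions_proportional a b : is_solution a -> is_solution b -> proportional a b.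
Proof.
move=> sola solb.
have [->|b0] := eqVneq b 0; first by move=> i j k l; rewrite !mxE !mulr0.
have [ub|nub] := boolP (b \in unitmx); last exact: solution_degenerate.
have [lam [v [v0 vE]]] := closed_eigenvector a ub.
pose c := 1 *: a + (- lam) *: b.
have cE : c = a - lam *: b by rewrite /c scale1r scaleNr.
have solc : is_solution c by exact: is_solution_comb.
have [cz|cn] := eqVneq c 0.
  have aE : a = lam *: b by apply/eqP; rewrite -subr_eq0 -cE cz.
  by move=> i j i' j'; rewrite aE !mxE; ring.
have nuc : c \notin unitmx.
  apply: contraNN v0 => uc; apply/eqP; rewrite -(mulmxK uc v) cE vE mul0mx.
  by [].
have bc := solution_degenerate solb solc cn nuc.
move=> i j i' j'; have := bc i j i' j'; rewrite !mxE => E.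
apply/eqP; rewrite -subr_eq0; apply/eqP.
transitivity (b i' j' * (1 * a i j + - lam * b i j) - b i j * (1 * a i' j' + - lam * b i' j')); first by ring.
by rewrite -E; ring.
Qed.
End SkewPairs.

(** * From complex to real coefficients *)

Section RealSolutions.
Import complex.
Context {R : rcfType}.
Variable w : 'I_4 -> 'I_4 -> 'I_4 -> 'I_4 -> R.
Hypothesis w_trace : forall j k, \sum_i w i j k i = 0.
Hypothesis w_nondeg : forall xi : 'rV[R]_4, xi != 0 ->
  exists j k l, \sum_i w i j k l * xi 0 i != 0.

Definition component_solution (a : 'M[R]_4) :=
  [/\ a^T = a,
      forall i j k m, \sum_s a i s * w s j k m + \sum_s a j s * w s i k m = 0
    & forall i j k m, \sum_s a i s * w s j k m - \sum_s a k s * w s m i j = 0].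

Section Extension.
Variables (C : numClosedFieldType) (toC : {rmorphism R -> C}).
Local Notation V := 'rV[C]_4.

Definition tensor_map (y z u : V) : V :=
  \row_s \sum_j \sum_k \sum_m y 0 j * z 0 k * u 0 m * toC (w s j k m).

Lemma tensor_map2 (c : C) (y z z' u : V) :
  tensor_map y (c *: z + z') u = c *: tensor_map y z u + tensor_map y z' u.
Proof.
apply/rowP => s; rewrite !mxE mulr_sumr -big_split /=; apply: eq_bigr => j _.
rewrite mulr_sumr -big_split /=; apply: eq_bigr => k _.
rewrite mulr_sumr -big_split /=; apply: eq_bigr => m _.
by rewrite !mxE; ring.
Qed.

Lemma tensor_map3 (c : C) (y z u u' : V) :
  tensor_map y z (c *: u + u') = c *: tensor_map y z u + tensor_map y z u'.
Proof.
apply/rowP => s; rewrite !mxE mulr_sumr -big_split /=; apply: eq_bigr => j _.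
rewrite mulr_sumr -big_split /=; apply: eq_bigr => k _.
rewrite mulr_sumr -big_split /=; apply: eq_bigr => m _.
by rewrite !mxE; ring.
Qed.

Lemma tensor_map_delta j k m s :
  tensor_map (delta_mx 0 j) (delta_mx 0 k) (delta_mx 0 m) 0 s = toC (w s j k m).
Proof.
rewrite mxE (bigD1 j) //= [X in _ + X]big1 ?addr0 => [|j' nj]; last first.
  apply: big1 => k' _; apply: big1 => m' _.
  by rewrite !mxE eqxx /= (negPf nj) !mul0r.
rewrite (bigD1 k) //= [X in _ + X]big1 ?addr0 => [|k' nk]; last first.
  apply: big1 => m' _.
  by rewrite !mxE eqxx /= (negPf nk) mulr0 !mul0r.
rewrite (bigD1 m) //= [X in _ + X]big1 ?addr0 => [|m' nm]; last first.
  by rewrite !mxE eqxx /= (negPf nm) mulr0 !mul0r.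
by rewrite !mxE !eqxx !mul1r.
Qed.

Lemma tensor_map_trace y z : \sum_i tensor_map y z (delta_mx 0 i) 0 i = 0.
Proof.
transitivity (\sum_j \sum_k y 0 j * z 0 k * toC (\sum_i w i j k i)).
  transitivity (\sum_i \sum_j \sum_k y 0 j * z 0 k * toC (w i j k i)); last first.
    rewrite exchange_big; apply: eq_bigr => j _.
    rewrite exchange_big; apply: eq_bigr => k _.
    by rewrite rmorph_sum mulr_sumr.
  apply: eq_bigr => i _; rewrite mxE; apply: eq_bigr => j _; apply: eq_bigr => k _.
  rewrite (bigD1 i) //= [X in _ + X]big1 ?addr0 => [|m nm].
    by rewrite !mxE !eqxx mulr1.
  by rewrite !mxE eqxx /= (negPf nm) mulr0 mul0r.
apply: big1 => j _; apply: big1 => k _; by rewrite w_trace rmorph0 mulr0.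
Qed.

Variables (re im : {additive C -> R}).
Hypothesis reM : forall x z, re (toC x * z) = x * re z.
Hypothesis imM : forall x z, im (toC x * z) = x * im z.
Hypothesis re_im0 : forall z, re z = 0 -> im z = 0 -> z = 0.

(** The components of the tensor are real, so the real and the imaginary part of an annihilating
    vector annihilate it separately, and [w_nondeg] applies to each. *)
Lemma tensor_map_span (v : 'cV[C]_4) :
  (forall y z u, tensor_map y z u *m v = 0) -> v = 0.
Proof.
move=> H.
have E j k m : \sum_s toC (w s j k m) * v s 0 = 0.
  have : (tensor_map (delta_mx 0 j) (delta_mx 0 k) (delta_mx 0 m) *m v) 0 0 = 0.
    by rewrite H mxE.
  by rewrite mxE; under eq_bigr do rewrite tensor_map_delta.
have part (f : {additive C -> R}) : (forall x z, f (toC x * z) = x * f z) ->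
    forall s, f (v s 0) = 0.
  move=> fM s; apply/eqP/negPn/negP => fs.
  have [] := w_nondeg (xi := \row_s f (v s 0)).
    by apply: contra_neq fs => /rowP /(_ s); rewrite !mxE.
  move=> j [k [l]]; rewrite (eq_bigr (fun s => f (toC (w s j k l) * v s 0))) => [|t _].
    by rewrite -raddf_sum E raddf0 eqxx.
  by rewrite mxE fM.
by apply/colP => s; rewrite [RHS]mxE; apply: re_im0; apply: part.
Qed.

Lemma form_tensor_map a x y z u : form (map_mx toC a) x (tensor_map y z u) =
  \sum_i \sum_j \sum_k \sum_m x 0 i * y 0 j * z 0 k * u 0 m * toC (\sum_s a i s * w s j k m).
Proof.
have -> : form (map_mx toC a) x (tensor_map y z u) =
    \sum_i \sum_s x 0 i * toC (a i s) * tensor_map y z u 0 s.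
  rewrite /form mxE exchange_big; apply: eq_bigr => s _.
  rewrite !mxE mulr_suml; apply: eq_bigr => i _; rewrite !mxE.
  by [].
apply: eq_bigr => i _.
transitivity (\sum_s \sum_j \sum_k \sum_m
    x 0 i * y 0 j * z 0 k * u 0 m * toC (a i s * w s j k m)).
  apply: eq_bigr => s _; rewrite mxE mulr_sumr; apply: eq_bigr => j _.
  rewrite mulr_sumr; apply: eq_bigr => k _; rewrite mulr_sumr; apply: eq_bigr => m _.
  by rewrite rmorphM; ring.
rewrite exchange_big; apply: eq_bigr => j _.
rewrite exchange_big; apply: eq_bigr => k _.
rewrite exchange_big; apply: eq_bigr => m _.
by rewrite rmorph_sum mulr_sumr.
Qed.

Lemma component_is_solution a : component_solution a -> is_solution tensor_map (map_mx toC a).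
Proof.
move=> [sa a1 a2]; split.
- by rewrite map_trmx sa.
- move=> x y z u; apply/eqP; rewrite -addr_eq0; apply/eqP.
  rewrite !form_tensor_map [X in _ + X]exchange_big -big_split /=; apply: big1 => i _.
  rewrite -big_split /=; apply: big1 => j _; rewrite -big_split /=; apply: big1 => k _.
  rewrite -big_split /=; apply: big1 => m _.
  rewrite [y 0 j * x 0 i]mulrC -mulrDr -rmorphD a1 rmorph0 mulr0.
  by [].
- move=> x y z u; rewrite !form_tensor_map.
  transitivity (\sum_k \sum_m \sum_i \sum_j
    x 0 i * y 0 j * z 0 k * u 0 m * toC (\sum_s a i s * w s j k m)).
    rewrite (eq_bigr _ (fun i _ => exchange_big _ _ _ _ _ _)) /=.
    rewrite exchange_big; apply: eq_bigr => k _.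
    rewrite (eq_bigr _ (fun i _ => exchange_big _ _ _ _ _ _)) /=.
    by rewrite exchange_big.
  apply: eq_bigr => k _; apply: eq_bigr => m _; apply: eq_bigr => i _; apply: eq_bigr => j _.
  have /eqP := a2 i j k m; rewrite subr_eq0 => /eqP ->.
  by ring.
Qed.

Lemma extended_solutions_proportional a b : component_solution a -> component_solution b ->
  proportional a b.
Proof.
move=> /component_is_solution sa /component_is_solution sb i j k l.
have := solutions_proportional tensor_map2 tensor_map3 tensor_map_span
  tensor_map_trace sa sb i j k l.
by rewrite !mxE -!rmorphM => /fmorph_inj.
Qed.
End Extension.

Theorem component_solutions_proportional a b : component_solution a -> component_solution b ->
  proportional a b.
Proof.
move=> sa sb; refine (@extended_solutions_proportional (complex R : numClosedFieldType)
  (@real_complex R : {rmorphism _ -> _})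
  (@complex.Re R : {additive _ -> _}) (@complex.Im R : {additive _ -> _}) _ _ _ a b sa sb).
- by move=> x [c d] /=; rewrite mul0r subr0.
- by move=> x [c d] /=; rewrite mul0r addr0.
- by move=> [c d] /= -> ->.
Qed.
End RealSolutions.

(** * Weyl tensor and the system (B) *)

Lemma sum_eqMl (R : pzRingType) (i : 'I_4) (f : 'I_4 -> R) :
  \sum_j (i == j)%:R * f j = f i.
Proof.
rewrite (bigD1 i) //= eqxx mul1r big1 ?addr0 // => j ji.
by rewrite eq_sym (negPf ji) mul0r.
Qed.

Lemma sum_eqMl' (R : pzRingType) (i : 'I_4) (f : 'I_4 -> R) :
  \sum_j (j == i)%:R * f j = f i.
Proof. by under eq_bigr do rewrite eq_sym; exact: sum_eqMl. Qed.

Lemma sum_eqMr (R : pzRingType) (i : 'I_4) (f : 'I_4 -> R) :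
  \sum_j f j * (i == j)%:R = f i.
Proof.
rewrite (bigD1 i) //= eqxx mulr1 big1 ?addr0 // => j ji.
by rewrite eq_sym (negPf ji) mulr0.
Qed.

Lemma sum_eqMr' (R : pzRingType) (i : 'I_4) (f : 'I_4 -> R) :
  \sum_j f j * (j == i)%:R = f i.
Proof. by under eq_bigr do rewrite eq_sym; exact: sum_eqMr. Qed.

Section Weyl.
Context {R : realType} (G : conn R) (x : 'rV[R]_4).

Lemma weyl_trace j k : \sum_a weyl G x a j k a = 0.
Proof.
have s4 (c : R) : \sum_(a < 4) (a == a)%:R * c = 4%:R * c.
  by under eq_bigr do rewrite eqxx mul1r; rewrite sumr_const card_ord mulr_natl.
transitivity (\sum_a curvature G x a j k a
   - 3%:R^-1 * (\sum_(a < 4) (a == a)%:R * ricci G x j k - \sum_(a < 4) (a == k)%:R * ricci G x j a)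
   + 5%:R^-1 * \sum_(a < 4) (a == j)%:R * ricci_skew G x k a
   + 15%:R^-1 * (\sum_(a < 4) (a == a)%:R * ricci_skew G x j k
                 - \sum_(a < 4) (a == k)%:R * ricci_skew G x j a)).
  by rewrite -!sumrB !mulr_sumr -sumrB -!big_split.
by rewrite !s4 !sum_eqMl' /ricci_skew -/(ricci G x j k); field.
Qed.

Lemma solA_proportional a b :
  (forall xi : 'rV[R]_4, xi != 0 -> exists j k l, \sum_a weyl G x a j k l * xi 0 a != 0) ->
  solA G x a -> solA G x b -> proportional a b.
Proof. by move=> nd; exact: (component_solutions_proportional weyl_trace nd). Qed.

Lemma proportionalE (a b : 'M[R]_4) : a != 0 -> proportional a b -> exists c : R, b = c *: a.
Proof.
move=> a0 ab.
have [[i j] /= aij] : exists ij : 'I_4 * 'I_4, a ij.1 ij.2 != 0.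
  apply/existsP; rewrite -negb_forall; apply: contra a0 => /forallP H.
  by apply/eqP/matrixP => i j; rewrite mxE; apply/eqP; exact: (H (i, j)).
exists (b i j / a i j); apply/matrixP => k l; rewrite mxE.
by apply: (mulfI aij); rewrite ab; field.
Qed.

Lemma solA_space :
  (forall xi : 'rV[R]_4, xi != 0 -> exists j k l, \sum_a weyl G x a j k l * xi 0 a != 0) ->
  exists2 S : {vspace 'M[R]_4}, (forall b, b \in S <-> solA G x b) & (\dim S <= 1)%N.
Proof.
move=> nd.
have sol0 : solA G x 0.
  split=> [|i j k m|i j k m]; first by rewrite trmx0.
    by rewrite !big1 ?addr0 // => s _; rewrite mxE mul0r.
  by rewrite !big1 ?subr0 // => s _; rewrite mxE mul0r.
have solZ (c : R) a : solA G x a -> solA G x (c *: a).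
  have E (a' : 'M[R]_4) i j k m : \sum_s (c *: a') i s * weyl G x s j k m =
      c * \sum_s a' i s * weyl G x s j k m.
    by rewrite mulr_sumr; apply: eq_bigr => s _; rewrite mxE mulrA.
  move=> [sa a1 a2]; split=> [|i j k m|i j k m]; first by rewrite linearZ /= sa.
    by rewrite !E -mulrDr a1 mulr0.
  by rewrite !E -mulrBr a2 mulr0.
have [[a [sola a0]]|H] := pselect (exists a, solA G x a /\ a != 0).
  exists <[a]>%VS; last by rewrite dim_vline a0.
  move=> b; split=> [/vlineP [c ->]|solb]; first exact: solZ.
  apply/vlineP; apply: proportionalE a0 _; exact: solA_proportional.
exists 0%VS; last by rewrite dimv0.
move=> b; rewrite memv0; split=> [/eqP -> //|solb].
by apply/eqP/eqP/negPn/negP => b0; apply: H; exists b.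
Qed.
End Weyl.

Section SystemB.
Context {R : realType} (G : conn R) (x : 'rV[R]_4).
Variable (a : 'M[R]_4).
Hypotheses (sa : a^T = a) (ua : a \in unitmx).
Local Notation s := (invmx a).

Lemma inv_symmetric : s^T = s.
Proof. by rewrite trmx_inv sa. Qed.

Lemma sum_invM i k : \sum_j s i j * a j k = (i == k)%:R.
Proof. by have := congr1 (fun m : 'M[R]_4 => m i k) (mulVmx ua); rewrite !mxE => <-. Qed.

Lemma sum_Minv i k : \sum_j a i j * s j k = (i == k)%:R.
Proof. by have := congr1 (fun m : 'M[R]_4 => m i k) (mulmxV ua); rewrite !mxE => <-. Qed.

Definition contraction (ds : 'I_4 -> 'M[R]_4) (k : 'I_4) : R :=
  \sum_b \sum_c a c b * E_lhs G x s ds k b c.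

(** The constant is 4 - (1 + 1)/5: contracting [s] with its inverse gives the dimension, and each of
    the two divergence terms of (E) contributes [w 0 k]. As it is nonzero, (B) determines [w]. *)
Lemma contraction_shift (w : 'rV[R]_4) ds k :
  contraction (fun d => w 0 d *: s + ds d) k = 18%:R / 5%:R * w 0 k + contraction ds k.
Proof.
have nE d b c : nabla G x s (fun d => w 0 d *: s + ds d) d b c =
    w 0 d * s b c + nabla G x s ds d b c.
  by rewrite /nabla !mxE !addrA.
pose u b := \sum_i w 0 i * s i b.
have E b c : E_lhs G x s (fun d => w 0 d *: s + ds d) k b c =
    (w 0 k * s b c - 5%:R^-1 * (u b * (c == k)%:R + u c * (b == k)%:R)) + E_lhs G x s ds k b c.
  rewrite /E_lhs nE; under eq_bigr do rewrite nE; rewrite big_split /=.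
  under [X in _ + X * (b == k)%:R]eq_bigr do rewrite nE; rewrite [X in _ + X * (b == k)%:R]big_split /=.
  by rewrite -/(u b) -/(u c); ring.
have au i : \sum_b a i b * u b = w 0 i.
  rewrite /u; under eq_bigr do rewrite mulr_sumr; rewrite exchange_big /=.
  rewrite -[RHS](sum_eqMr i (fun j => w 0 j)); apply: eq_bigr => j _.
  rewrite -(sum_Minv i j) mulr_sumr; apply: eq_bigr => b _.
  by rewrite -{1}inv_symmetric [s^T _ _]mxE; ring.
rewrite /contraction; under eq_bigr => b _ do under eq_bigr => c _ do rewrite E mulrDr.
under eq_bigr do rewrite big_split /=; rewrite big_split /=; congr (_ + _).
have T1 : \sum_b \sum_c a c b * (w 0 k * s b c) = 4%:R * w 0 k.
  transitivity (\sum_(b < 4) w 0 k); last by rewrite sumr_const card_ord mulr_natl.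
  apply: eq_bigr => b _; transitivity (w 0 k * \sum_c s b c * a c b).
    by rewrite mulr_sumr; apply: eq_bigr => c _; ring.
  by rewrite sum_invM eqxx mulr1.
have T2 : \sum_b \sum_c a c b * (u b * (c == k)%:R) = w 0 k.
  rewrite -[RHS]au; apply: eq_bigr => b _.
  by rewrite -[RHS](sum_eqMr' k (fun c => a c b * u b)); apply: eq_bigr => c _; ring.
have T3 : \sum_b \sum_c a c b * (u c * (b == k)%:R) = w 0 k.
  rewrite exchange_big -[RHS]au; apply: eq_bigr => c _.
  rewrite -[RHS](sum_eqMr' k (fun b => a b c * u c)); apply: eq_bigr => b _.
  by rewrite -{1}sa [a^T _ _]mxE; ring.
transitivity (\sum_b \sum_c a c b * (w 0 k * s b c) - 5%:R^-1 *
  (\sum_b \sum_c a c b * (u b * (c == k)%:R) + \sum_b \sum_c a c b * (u c * (b == k)%:R))).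
  rewrite -big_split /= mulr_sumr -sumrB; apply: eq_bigr => b _.
  rewrite -big_split /= mulr_sumr -sumrB; apply: eq_bigr => c _.
  ring.
by rewrite T1 T2 T3; field.
Qed.
End SystemB.

Lemma systemB_gradient (R : realType) (G : conn R) (a : 'rV[R]_4 -> 'M[R]_4) x w :
  (a x)^T = a x -> a x \in unitmx -> systemB G a x w ->
  forall k, w 0 k = - (5%:R / 18%:R) * contraction G x (a x) (pderiv_mx (fun y => invmx (a y)) x) k.
Proof.
move=> sa ua Bw k.
have := contraction_shift G x sa ua w (pderiv_mx (fun y => invmx (a y)) x) k.
rewrite {1}/contraction big1 => [E|b _]; last by apply: big1 => c _; rewrite Bw mulr0.
rewrite -[contraction _ _ _ _ _](addKr (18%:R / 5%:R * w 0 k)) -E addr0.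
by field.
Qed.

Lemma systemB_unique (R : realType) (G : conn R) (a : 'rV[R]_4 -> 'M[R]_4) x v w :
  (a x)^T = a x -> a x \in unitmx -> systemB G a x v -> systemB G a x w -> v = w.
Proof.
move=> sa ua Bv Bw; apply/rowP => k.
by rewrite (systemB_gradient sa ua Bv) (systemB_gradient sa ua Bw).
Qed.

(** * Projective equivalence and (B), as algebra at one point *)

Section ConformalChristoffel.
Context {R : realType} (G : conn R) (x : 'rV[R]_4).
Variables (a : 'M[R]_4) (da : 'I_4 -> 'M[R]_4) (eta : 'I_4 -> R).
Hypotheses (sa : a^T = a) (ua : a \in unitmx) (sda : forall d, (da d)^T = da d).
Hypothesis sG : forall i j k, G x i j k = G x i k j.
Local Notation s := (invmx a).

Let aC i j : a i j = a j i. Proof. by rewrite -{1}sa mxE. Qed.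
Let daC d i j : da d i j = da d j i. Proof. by rewrite -{1}sda mxE. Qed.
Let sT : s^T = s. Proof. exact: inv_symmetric. Qed.
Let sC i j : s i j = s j i. Proof. by rewrite -{1}sT mxE. Qed.

(* [christoffel1] is the symbol of the first kind of the metric [h a] divided by [h]; [da] and [eta] stand for [d a] and [d h / h]. *)
Definition christoffel1 (t j k : 'I_4) : R :=
  2%:R^-1 * (da k t j + eta k * a t j + (da j t k + eta j * a t k) - (da t j k + eta t * a j k)).
Definition christoffel2 (i j k : 'I_4) : R := \sum_t s i t * christoffel1 t j k.

(** Since (h a)^{-1} det(h a)^{1/5} = (det a / h)^{1/5} a^{-1}, this is the derivative of (1/5) ln
    |det a / h|, by Jacobi's formula. [dsigma] is the derivative of that sigma divided by its scalar
    factor. *)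
Definition log_gradient (d : 'I_4) : R := 5%:R^-1 * (\tr (s *m da d) - eta d).
Definition dsigma (d : 'I_4) : 'M[R]_4 := log_gradient d *: s - s *m da d *m s.

Lemma christoffel1C t j k : christoffel1 t j k = christoffel1 t k j.
Proof. by rewrite /christoffel1 (daC t j k) (aC j k); ring. Qed.

Lemma christoffel2C i j k : christoffel2 i j k = christoffel2 i k j.
Proof. by apply: eq_bigr => t _; rewrite christoffel1C. Qed.

Let M k := \matrix_(t, d) christoffel1 t k d.

(** Metric compatibility: the lowered symbols symmetrize to the derivative of [h a], divided by
    [h]. *)
Let M_sym k : M k + (M k)^T = da k + eta k *: a.
Proof.
apply/matrixP => t d; rewrite !mxE /christoffel1.
by rewrite (daC k d t) (aC d t) (aC k t) (aC k d) (daC t k d) (daC d k t) (aC d k) (aC t k); field.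
Qed.

Let christoffel2M i k d : christoffel2 i k d = (s *m M k) i d.
Proof. by rewrite mxE; apply: eq_bigr => t _; rewrite mxE. Qed.

Lemma christoffel2_trace k : \sum_d christoffel2 d d k = 2%:R^-1 * (\tr (s *m da k) + 4%:R * eta k).
Proof.
have E : \sum_d christoffel2 d d k = \tr (s *m M k).
  by apply: eq_bigr => d _; rewrite christoffel2C christoffel2M.
have E' : \tr (s *m (M k)^T) = \tr (s *m M k).
  by rewrite -[LHS]mxtrace_tr trmx_mul trmxK sT mxtrace_mulC.
have : \tr (s *m (M k + (M k)^T)) = \tr (s *m da k) + 4%:R * eta k.
  rewrite M_sym mulmxDr linearD /= -scalemxAr linearZ /= mulVmx // mxtrace1.
  by rewrite mulrC.
by rewrite mulmxDr linearD /= E' E => <-; field.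
Qed.

(** The weighted tensor sigma of a metric is parallel for its own Levi-Civita connection: [M_sym]
    handles the two index terms and its trace the weight. *)
Lemma christoffel2_compatible k b c :
  dsigma k b c + \sum_d christoffel2 b k d * s d c + \sum_d christoffel2 c d k * s b d
  - 2%:R / 5%:R * (\sum_d christoffel2 d d k) * s b c = 0.
Proof.
have E1 : \sum_d christoffel2 b k d * s d c = (s *m M k *m s) b c.
  by rewrite mxE; apply: eq_bigr => d _; rewrite christoffel2M.
have E2 : \sum_d christoffel2 c d k * s b d = (s *m (M k)^T *m s) b c.
  have -> : s *m (M k)^T *m s = (s *m M k *m s)^T by rewrite !trmx_mul sT mulmxA.
  rewrite [RHS]mxE mxE; apply: eq_bigr => d _.
  by rewrite christoffel2C christoffel2M (sC b d).
have E3 : (s *m M k *m s) b c + (s *m (M k)^T *m s) b c =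
    (s *m da k *m s) b c + eta k * s b c.
  transitivity ((s *m (M k + (M k)^T) *m s) b c); first by rewrite mulmxDr mulmxDl [RHS]mxE.
  by rewrite M_sym mulmxDr mulmxDl -scalemxAr mulVmx // -scalemxAl mul1mx mxE [X in _ + X]mxE.
rewrite E1 E2 christoffel2_trace /dsigma /log_gradient.
set w := 5%:R^-1 * _.
have -> : (w *: s - s *m da k *m s) b c = w * s b c - (s *m da k *m s) b c by rewrite !mxE.
by rewrite -[X in X - _ = _]addrA E3 /w; field.
Qed.

(** The difference of the two connections. Because sigma is parallel for one of them, its derivative
    along [G] is [- X], which is linear in [D]. *)
Let D i j k := christoffel2 i j k - G x i j k.
Let DC i j k : D i j k = D i k j. Proof. by rewrite /D christoffel2C sG. Qed.

Let X k b c := \sum_d D b k d * s d c + \sum_d D c d k * s b d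
  - 2%:R / 5%:R * (\sum_d D d d k) * s b c.

Let nablaX k b c : nabla G x s dsigma k b c = - X k b c.
Proof.
have := christoffel2_compatible k b c; rewrite /nabla /X.
have E1 : \sum_d D b k d * s d c = \sum_d christoffel2 b k d * s d c - \sum_d G x b k d * s d c.
  by rewrite -sumrB; apply: eq_bigr => d _; rewrite /D mulrBl.
have E2 : \sum_d D c d k * s b d = \sum_d christoffel2 c d k * s b d - \sum_d G x c d k * s b d.
  by rewrite -sumrB; apply: eq_bigr => d _; rewrite /D mulrBl.
have E3 : \sum_d D d d k = \sum_d christoffel2 d d k - \sum_d G x d d k by rewrite -sumrB.
rewrite E1 E2 E3 => H; apply/eqP; rewrite -subr_eq0; apply/eqP.
by rewrite -[RHS]H; ring.
Qed.

Let E_lhsX k b c : E_lhs G x s dsigma k b c =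
  - X k b c + 5%:R^-1 * ((\sum_i X i i b) * (c == k)%:R + (\sum_i X i i c) * (b == k)%:R).
Proof.
have nX b' : \sum_i nabla G x s dsigma i i b' = - \sum_i X i i b'.
  by rewrite -sumrN; apply: eq_bigr => i _; rewrite nablaX.
by rewrite /E_lhs nablaX !nX; ring.
Qed.

(** For a pure-trace [D] the weight removes the terms in [phi k], and what remains of [X] is exactly
    the Kronecker part that (E) subtracts; its divergence is [5 up], matching the factor 1/5. *)
Lemma projective_E (phi : 'I_4 -> R) :
  (forall i j k, christoffel2 i j k = G x i j k + (i == j)%:R * phi k + (i == k)%:R * phi j) ->
  forall k b c, E_lhs G x s dsigma k b c = 0.
Proof.
move=> H.
have DE i j k : D i j k = (i == j)%:R * phi k + (i == k)%:R * phi j by rewrite /D H; ring.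
pose up c := \sum_d phi d * s d c.
have XE k b c : X k b c = (b == k)%:R * up c + (c == k)%:R * up b.
  have E1 : \sum_d D b k d * s d c = (b == k)%:R * up c + phi k * s b c.
    rewrite -[X in _ + X](sum_eqMl b (fun d => phi k * s d c)) /up mulr_sumr -big_split /=.
    by apply: eq_bigr => d _; rewrite DE; ring.
  have E2 : \sum_d D c d k * s b d = (c == k)%:R * up b + phi k * s b c.
    rewrite -[X in _ + X](sum_eqMl c (fun d => phi k * s b d)) /up mulr_sumr -big_split /=.
    by apply: eq_bigr => d _; rewrite DE (sC d b); ring.
  have E3 : \sum_d D d d k = 5%:R * phi k.
    transitivity (\sum_(d < 4) phi k + \sum_d (d == k)%:R * phi d).
      by rewrite -big_split; apply: eq_bigr => d _; rewrite DE eqxx mul1r.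
    by rewrite sum_eqMl' sumr_const card_ord -[_ *+ 4]mulr_natl; ring.
  by rewrite /X E1 E2 E3; field.
have XX b : \sum_i X i i b = 5%:R * up b.
  transitivity (\sum_(i < 4) up b + \sum_i (b == i)%:R * up i).
    by rewrite -big_split; apply: eq_bigr => i _; rewrite XE eqxx mul1r.
  by rewrite sum_eqMl sumr_const card_ord -[_ *+ 4]mulr_natl; ring.
by move=> k b c; rewrite E_lhsX XE !XX; field.
Qed.

(** After lowering an index with [a], (E) prescribes the symmetrization of [N k b c] in [b, c], and
    torsion-freeness makes [N] symmetric in [k, c]. This determines [N] as in the Koszul formula; a
    trace then leaves only the Kronecker terms. *)
Lemma E_projective : (forall k b c, E_lhs G x s dsigma k b c = 0) ->
  exists phi : 'I_4 -> R, forall i j k,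
    christoffel2 i j k = G x i j k + (i == j)%:R * phi k + (i == k)%:R * phi j.
Proof.
move=> H.
pose psi b := 5%:R^-1 * \sum_i X i i b.
have XE k b c : X k b c = psi b * (c == k)%:R + psi c * (b == k)%:R.
  have /eqP := H k b c; rewrite E_lhsX addrC subr_eq0 => /eqP <-.
  by rewrite /psi; field.
pose tr k := \sum_d D d d k.
pose Dm k := \matrix_(i, c) D i k c.
pose N k b c := (a *m Dm k) b c.
pose lo b := \sum_i a b i * psi i.
have NC k b c : N k b c = N c b k.
  by rewrite /N !mxE; apply: eq_bigr => i _; rewrite !mxE DC.
have NE k b c : N k b c + N k c b = lo b * a k c + lo c * a k b + 2%:R / 5%:R * tr k * a b c.
  pose Xm := \matrix_(b', c') X k b' c'.
  have XmE : Xm = Dm k *m s + (Dm k *m s)^T - (2%:R / 5%:R * tr k) *: s.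
    apply/matrixP => b' c'; rewrite !mxE /X /tr; congr (_ + _ - _).
      by apply: eq_bigr => d _; rewrite mxE.
    by apply: eq_bigr => d _; rewrite mxE DC (sC d b').
  have L : a *m Xm *m a = a *m Dm k + (a *m Dm k)^T - (2%:R / 5%:R * tr k) *: a.
    rewrite XmE mulmxBr mulmxBl mulmxDr mulmxDl -scalemxAr -scalemxAl mulmxV // mul1mx.
    rewrite trmx_mul sT !mulmxA mulmxV // mul1mx -!mulmxA mulVmx // mulmx1.
    by rewrite trmx_mul sa.
  have Rr : (a *m Xm *m a) b c = lo b * a k c + lo c * a k b.
    rewrite mxE.
    transitivity (\sum_j (lo b * (j == k)%:R + psi j * a b k) * a j c).
      apply: eq_bigr => j _; congr (_ * _); rewrite mxE /lo mulr_suml.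
      rewrite -[psi j * _](sum_eqMr' k (fun i => psi j * a b i)) -big_split /=.
      by apply: eq_bigr => i _; rewrite mxE XE; ring.
    rewrite -[lo b * _](sum_eqMr' k (fun j => lo b * a j c)) /lo [(\sum_i a c i * _) * _]mulr_suml.
    rewrite -big_split /=; apply: eq_bigr => j _; rewrite (aC j c) (aC b k); ring.
  have -> : N k b c + N k c b = (a *m Xm *m a) b c + 2%:R / 5%:R * tr k * a b c.
    by rewrite L /N; move: (a *m Dm k) => P; rewrite !mxE; ring.
  by rewrite Rr.
have N1 k b c : N k b c = a k c * (lo b - 5%:R^-1 * tr b) + 5%:R^-1 * (tr k * a b c + tr c * a b k).
  have n2 : (2%:R : R) != 0 by rewrite pnatr_eq0.
  apply: (mulfI n2).
  (* Koszul's alternating sum of three permuted symmetrizations. *)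
  transitivity ((N k b c + N k c b) + (N c b k + N c k b) - (N b k c + N b c k)).
    by rewrite (NC c b k) (NC c k b) (NC b c k); ring.
  by rewrite !NE (aC k c) (aC c b) (aC k b); field.
have DN i k c : D i k c = \sum_b s i b * N k b c.
  transitivity ((s *m (a *m Dm k)) i c); last by rewrite mxE.
  by rewrite mulmxA mulVmx // mul1mx mxE.
pose z i := \sum_b s i b * (lo b - 5%:R^-1 * tr b).
have DE i k c : D i k c = a k c * z i + 5%:R^-1 * (tr k * (i == c)%:R + tr c * (i == k)%:R).
  rewrite DN /z -!(sum_invM ua) !mulr_sumr -big_split /= mulr_sumr -big_split /=.
  by apply: eq_bigr => b _; rewrite N1; ring.
(* The Kronecker terms of [DE] already have trace [tr c], so the remaining term must have trace
   zero. *)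
have az c : \sum_k a c k * z k = 0.
  have : tr c = \sum_k a c k * z k + 5%:R^-1 * (tr c + 4%:R * tr c).
    rewrite {1}/tr -[tr c in X in _ + _ * (X + _)](sum_eqMr' c tr).
    have -> : 4%:R * tr c = \sum_(k < 4) tr c * (k == k)%:R.
      by under eq_bigr do rewrite eqxx mulr1; rewrite sumr_const card_ord mulr_natl.
    rewrite -big_split /= mulr_sumr -big_split /=.
    by apply: eq_bigr => k _; rewrite DE (aC k c).
  by move/eqP; rewrite -subr_eq0 => /eqP E; apply: oppr_inj; rewrite oppr0 -[RHS]E; field.
have z0 i : z i = 0.
  rewrite -(sum_eqMl i z).
  transitivity (\sum_c s i c * \sum_k a c k * z k).
    under [RHS]eq_bigr do rewrite mulr_sumr; rewrite exchange_big /=.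
    apply: eq_bigr => k _; rewrite -(sum_invM ua) mulr_suml.
    by apply: eq_bigr => c _; rewrite mulrA.
  by rewrite big1 // => c _; rewrite az mulr0.
exists (fun k => 5%:R^-1 * tr k) => i j k.
have := DE i j k; rewrite z0 mulr0 add0r => E.
by rewrite -[LHS](subrK (G x i j k)) -/(D i j k) E; ring.
Qed.
End ConformalChristoffel.

(** * Derivatives of determinants and inverses of matrix fields *)

Section MatrixFields.
Context {R : realType} (U : set 'rV[R]_4) (oU : open U).
Variable a : 'rV[R]_4 -> 'M[R]_4.
Hypothesis sma : forall i j, smooth U (fun x => a x i j).

Lemma smooth_det : smooth U (fun x => \det (a x)).
Proof.
apply: smooth_sum => // s _; apply: smoothM => //; first exact: smooth_cst.
exact: smooth_prod.
Qed.

Lemma pderiv_prod4 (F : 'I_4 -> 'rV[R]_4 -> R) d x :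
  (forall k, derivable (F k) x (delta_mx 0 d)) ->
  derivable (fun y => \prod_k F k y) x (delta_mx 0 d) /\
  pderiv d (fun y => \prod_k F k y) x =
  \sum_k \prod_i (if i == k then pderiv d (F i) x else F i x).
Proof.
move=> dF.
have -> : (fun y => \prod_k F k y) = (fun y => F o0 y * F o1 y * F o2 y * F o3 y).
  apply/funext => y; rewrite !big_ord_recr big_ord0 /= mul1r.
  by congr (_ * _ * _ * _); congr (F _ y); apply: val_inj.
have p4 (f : 'I_4 -> R) : \prod_i f i = f o0 * f o1 * f o2 * f o3.
  rewrite !big_ord_recr big_ord0 /= mul1r.
  by congr (_ * _ * _ * _); congr f; apply: val_inj.
have d01 : derivable (fun y => F o0 y * F o1 y) x (delta_mx 0 d) by exact: (derivableM (dF o0) (dF o1)).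
have d012 : derivable (fun y => F o0 y * F o1 y * F o2 y) x (delta_mx 0 d).
  exact: (derivableM d01 (dF o2)).
split; first exact: (derivableM d012 (dF o3)).
apply: etrans (pderivM d012 (dF o3)) _.
have E012 := pderivM d01 (dF o2); have E01 := pderivM (dF o0) (dF o1).
by rewrite E012 E01 sum4 !p4 /=; ring.
Qed.

(** Jacobi's formula: differentiate one row at a time and expand each determinant along that row,
    where the cofactors are those of [a]. *)
Lemma pderiv_det x d : U x ->
  pderiv d (fun y => \det (a y)) x = \tr (pderiv_mx a x d *m \adj (a x)).
Proof.
move=> Ux.
have da i j : derivable (fun y => a y i j) x (delta_mx 0 d) by exact: smooth_derivable (sma i j) Ux.
pose rep k := \matrix_(i, j) (if i == k then pderiv_mx a x d i j else a x i j).
have dP (s : 'S_4) := pderiv_prod4 (F := fun i y => a y i (s i)) (fun i => da i (s i)).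
have dt (s : 'S_4) : derivable (fun y => (-1) ^+ s * \prod_i a y i (s i)) x (delta_mx 0 d).
  by apply: (@derivableM _ _ (fun=> (-1) ^+ s)) => //; have [] := dP s.
have [_ E] := @pderiv_sum _ _ (index_enum _) (fun (s : 'S_4) y => (-1) ^+ s * \prod_i a y i (s i)) d x dt.
have -> : pderiv d (fun y => \det (a y)) x = \sum_k \det (rep k).
  rewrite [LHS]E /determinant exchange_big; apply: eq_bigr => s _.
  have [ds Es] := dP s.
  apply: etrans (pderivM (derivable_cst _ _ _) ds) _.
  rewrite Es pderiv_cst mul0r addr0 mulr_sumr; apply: eq_bigr => k _.
  by congr (_ * _); apply: eq_bigr => i _; rewrite !mxE; case: ifP => // _.
rewrite /mxtrace; apply: eq_bigr => k _; rewrite (expand_det_row _ k) [RHS]mxE.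
apply: eq_bigr => j _; rewrite [(\adj _) _ _]mxE [rep k k j]mxE eqxx; congr (_ * _).
rewrite /cofactor; congr (_ * \det _); apply/matrixP => i j'; rewrite !mxE.
by rewrite eq_sym (negPf (neq_lift _ _)).
Qed.

Hypothesis ua : forall x, U x -> a x \in unitmx.

Lemma pderiv_det_unit x d : U x -> pderiv d (fun y => \det (a y)) x =
  \det (a x) * \tr (invmx (a x) *m pderiv_mx a x d).
Proof.
move=> Ux; rewrite pderiv_det // mxtrace_mulC /invmx (ua Ux) -scalemxAl linearZ /=.
by rewrite mulrA mulfV ?mul1r // -unitfE -unitmxE; exact: ua.
Qed.

Lemma det_neq0 x : U x -> \det (a x) != 0.
Proof. by move=> /ua; rewrite unitmxE unitfE. Qed.

Lemma smooth_invmx i j : smooth U (fun x => invmx (a x) i j).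
Proof.
have sc k l : smooth U (fun x => cofactor (a x) k l).
  apply: smoothM => //; first exact: smooth_cst.
  have -> : (fun x => \det (row' k (col' l (a x)))) =
     (fun x => \sum_(s : 'S_3) (-1) ^+ s * \prod_i a x (lift k i) (lift l (s i))).
    apply/funext => x; apply: eq_bigr => s _; congr (_ * _); apply: eq_bigr => m _.
    by rewrite !mxE.
  apply: smooth_sum => // s _; apply: smoothM => //; first exact: smooth_cst.
  exact: smooth_prod.
apply: (eq_on_smooth oU (f := fun x => (\det (a x))^-1 * cofactor (a x) j i)).
  by move=> x /ua u; rewrite /invmx u !mxE.
by apply: smoothM => //; apply: smoothV => //; [exact: det_neq0|exact: smooth_det].
Qed.

Lemma pderiv_invmx x d : U x -> pderiv_mx (fun y => invmx (a y)) x d =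
  - (invmx (a x) *m pderiv_mx a x d *m invmx (a x)).
Proof.
move=> Ux.
have da i j : derivable (fun y => a y i j) x (delta_mx 0 d) by exact: smooth_derivable (sma i j) Ux.
have ds i j : derivable (fun y => invmx (a y) i j) x (delta_mx 0 d).
  exact: smooth_derivable (smooth_invmx i j) Ux.
have E : pderiv_mx (fun y => invmx (a y)) x d *m a x + invmx (a x) *m pderiv_mx a x d = 0.
  apply/matrixP => i k; rewrite !mxE -big_split /=.
  have dt j : derivable (fun y => invmx (a y) i j * a y j k) x (delta_mx 0 d) by exact: derivableM.
  have [_ E] := @pderiv_sum _ _ (index_enum _) (fun j y => invmx (a y) i j * a y j k) d x dt.
  transitivity (pderiv d (fun y => \sum_j invmx (a y) i j * a y j k) x).
    by rewrite E; apply: eq_bigr => j _; rewrite pderivM // !mxE addrC.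
  apply: etrans (pderiv_cst (i == k)%:R d x); apply: (eq_on_pderiv oU) => // y Uy.
  exact: sum_invM (ua Uy) i k.
have := congr1 (fun m => m *m invmx (a x)) E.
rewrite mulmxDl mulmxK ?mul0mx; last exact: ua.
by move/eqP; rewrite addr_eq0 => /eqP.
Qed.
End MatrixFields.

(** * The Levi-Civita connection of a conformal multiple *)

Section LeviCivita.
Context {R : realType} (U : set 'rV[R]_4) (oU : open U).
Variables (a : 'rV[R]_4 -> 'M[R]_4) (h : 'rV[R]_4 -> R) (G : conn R).
Hypotheses (na : nondegenerate_field U a) (sh : smooth U h) (h0 : forall x, U x -> h x != 0).
Hypothesis sG : symmetric_connection U G.

Let eta x k := pderiv k h x / h x.

Lemma pderiv_mx_sym x d : U x -> (pderiv_mx a x d)^T = pderiv_mx a x d.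
Proof.
have [_ syma] := na; move=> Ux; apply/matrixP => i j; rewrite !mxE.
by apply: (eq_on_pderiv oU) => // y Uy; rewrite -{1}(syma y Uy).1 mxE.
Qed.

Lemma levi_civita_conformal x i j k : U x ->
  levi_civita (fun y => h y *: a y) x i j k = christoffel2 (a x) (pderiv_mx a x) (eta x) i j k.
Proof.
move=> Ux; have [sma syma] := na; have [_ uax] := syma x Ux.
have dh d : derivable h x (delta_mx 0 d) by exact: smooth_derivable sh Ux.
have da d l m : derivable (fun y => a y l m) x (delta_mx 0 d) by exact: smooth_derivable (sma l m) Ux.
have hx := h0 Ux.
have dE d l m : pderiv d (fun y => (h y *: a y) l m) x =
    h x * (pderiv_mx a x d l m + eta x d * a x l m).
  have -> : (fun y => (h y *: a y) l m) = (fun y => h y * a y l m).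
    by apply/funext => y; rewrite mxE.
  by rewrite pderivM // mxE /eta; field.
have iE s : invmx (h x *: a x) i s = (h x)^-1 * invmx (a x) i s.
  by rewrite invmxZ ?mxE // unitmxZ // unitfE.
rewrite /levi_civita /christoffel2 mulr_sumr; apply: eq_bigr => t _.
rewrite (dE k t j) (dE j t k) (dE t j k) iE /christoffel1; field.
by rewrite hx.
Qed.

Definition log_gradient_row x : 'rV[R]_4 := \row_d log_gradient (a x) (pderiv_mx a x) (eta x) d.

Lemma dsigmaE x : U x ->
  (fun d => log_gradient_row x 0 d *: invmx (a x) + pderiv_mx (fun y => invmx (a y)) x d) =
  dsigma (a x) (pderiv_mx a x) (eta x).
Proof.
move=> Ux; have [sma syma] := na; apply/funext => d; rewrite mxE (pderiv_invmx oU) //.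
by move=> y Uy; have [] := syma y Uy.
Qed.

Lemma projective_systemB : in_projective_class U G (fun y => h y *: a y) <->
  solB U G a log_gradient_row.
Proof.
have [sma syma] := na; have [_ symG] := sG; split=> [[phi Hphi] x Ux|HB].
  have [sx ux] := syma x Ux => k b c; rewrite dsigmaE //.
  refine (@projective_E _ G x (a x) (pderiv_mx a x) (eta x) sx ux (fun d => pderiv_mx_sym d Ux) (fun c => phi x 0 c) _ k b c).
  by move=> i j l; rewrite -levi_civita_conformal // Hphi.
(* The 1-form is found point by point and assembled by choice; off [U] its value is set to 0. *)
have H x : exists ph : 'rV[R]_4, U x -> forall i j k,
    levi_civita (fun y => h y *: a y) x i j k = G x i j k + (i == j)%:R * ph 0 k + (i == k)%:R * ph 0 j.
  have [Ux|nUx] := pselect (U x); last by exists 0.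
  have [sx ux] := syma x Ux.
  have [|phi Hphi] := @E_projective _ G x (a x) (pderiv_mx a x) (eta x) sx ux (fun d => pderiv_mx_sym d Ux) (symG x Ux).
    by move=> k b c; have := HB x Ux k b c; rewrite dsigmaE.
  by exists (\row_c phi c) => _ i j k; rewrite levi_civita_conformal // Hphi !mxE.
have [phi Hphi] := choice H.
by exists phi => x Ux i j k; apply: Hphi.
Qed.
End LeviCivita.

(** * Symmetries of the Riemann tensor *)

(** The derivative of g_{is} is C_{isd} + C_{sid}. In the derivative of [C = g Gam] the first
    summand reproduces the quadratic terms of the curvature, and the second gives the sums on the
    right. *)
Lemma lower_curvature_algebra (R : comPzRingType) (g : 'M[R]_4) (Gam C : 'I_4 -> 'I_4 -> 'I_4 -> R)
    (dGam dC : 'I_4 -> 'I_4 -> 'I_4 -> 'I_4 -> R) :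
  (forall i j k, C i j k = C i k j) ->
  (forall i j k, \sum_s g i s * Gam s j k = C i j k) ->
  (forall d i j k, dC d i j k = \sum_s (g i s * dGam d s j k + (C i s d + C s i d) * Gam s j k)) ->
  forall i j k l,
  \sum_s g i s * (dGam l s j k - dGam k s j l + \sum_a (Gam s l a * Gam a j k - Gam s k a * Gam a j l)) =
  dC l i j k - dC k i j l - \sum_s C s i l * Gam s j k + \sum_s C s i k * Gam s j l.
Proof.
move=> CC gG dCE i j k l.
have quad l' k' : \sum_s g i s * \sum_a Gam s l' a * Gam a j k' = \sum_s C i s l' * Gam s j k'.
  under eq_bigr do rewrite mulr_sumr; rewrite exchange_big; apply: eq_bigr => a _ /=.
  by rewrite CC -gG mulr_suml; apply: eq_bigr => s _; rewrite mulrA.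
transitivity (\sum_s g i s * dGam l s j k - \sum_s g i s * dGam k s j l
   + (\sum_s C i s l * Gam s j k - \sum_s C i s k * Gam s j l)).
  rewrite -!quad -!sumrB -big_split; apply: eq_bigr => s _ /=.
  by rewrite sumrB mulrDr !mulrBr.
have dCE' d j' k' : dC d i j' k' = \sum_s g i s * dGam d s j' k' +
   (\sum_s C i s d * Gam s j' k' + \sum_s C s i d * Gam s j' k').
  by rewrite dCE -!big_split; apply: eq_bigr => s _; rewrite mulrDl.
by rewrite !dCE'; ring.
Qed.

Section RiemannForm.
Variables (R : fieldType) (H Q : 'I_4 -> 'I_4 -> 'I_4 -> 'I_4 -> R).

(* The lowered curvature in terms of the second derivatives [H l k i j = d_l d_k g_ij]
   and the products [Q i j k l = g(Gamma_ij, Gamma_kl)]. *)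
Definition riemann_form (i j k l : 'I_4) : R :=
  2%:R^-1 * (H l k i j + H l j i k - H l i j k) - 2%:R^-1 * (H k l i j + H k j i l - H k i j l)
  - Q i l j k + Q i k j l.

Hypothesis HC : forall l k i j, H l k i j = H k l i j.
Hypothesis HS : forall l k i j, H l k i j = H l k j i.
Hypothesis QC : forall i j k l, Q i j k l = Q k l i j.

Lemma riemann_form_skew i j k l : riemann_form i j k l + riemann_form j i k l = 0.
Proof.
rewrite /riemann_form (QC j l i k) (QC j k i l) (HC l k i j) (HC l k j i) (HS k l j i).
by ring.
Qed.

Lemma riemann_form_pair i j k l : (forall i j k l, Q i j k l = Q j i l k) ->
  riemann_form i j k l = riemann_form k l i j.
Proof.
move=> QS; rewrite /riemann_form (QC k j l i) (QS l i k j) (QS k i l j).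
rewrite (HC l k i j) (HC j i k l) (HC j l k i) (HS l j k i) (HC j k l i) (HS k j l i).
by rewrite (HC i l k j) (HS l i k j) (HC i k l j) (HS k i l j); ring.
Qed.
End RiemannForm.

Section RiemannSymmetries.
Context {R : realType} (U : set 'rV[R]_4) (oU : open U).
Variable g : 'rV[R]_4 -> 'M[R]_4.
Hypothesis mg : metric U g.

Let smg i j : smooth U (fun x => g x i j).
Proof. by have [H _] := mg; exact: H. Qed.
Let ug x : U x -> g x \in unitmx.
Proof. by have [_ H] := mg; move=> /H []. Qed.
Let gC x i j : U x -> g x i j = g x j i.
Proof. by have [_ H] := mg; move=> /H [E _]; rewrite -{1}E mxE. Qed.
Let invC x i j : U x -> invmx (g x) i j = invmx (g x) j i.
Proof. by have [_ H] := mg; move=> /H [E _]; rewrite -{1}(inv_symmetric E) mxE. Qed.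

Definition lower_christoffel (y : 'rV[R]_4) (i j k : 'I_4) : R :=
  2%:R^-1 * (pderiv k (fun y => g y i j) y + pderiv j (fun y => g y i k) y
             - pderiv i (fun y => g y j k) y).

Local Notation C := lower_christoffel.
Local Notation Gam := (levi_civita g).

Let pdgC d i j x : U x -> pderiv d (fun y => g y i j) x = pderiv d (fun y => g y j i) x.
Proof. by move=> Ux; apply: (eq_on_pderiv oU) => // y Uy; rewrite gC. Qed.

Lemma smooth_levi_civita i j k : smooth U (fun y => Gam y i j k).
Proof.
apply: smoothM => //; first exact: smooth_cst.
apply: smooth_sum => // s _; apply: smoothM => //; first exact: smooth_invmx.
by apply: smoothB => //; [apply: smoothD => //|]; apply: smooth_pderiv.
Qed.

Lemma levi_civitaE y i j k : Gam y i j k = \sum_s invmx (g y) i s * C y s j k.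
Proof. by rewrite /levi_civita mulr_sumr; apply: eq_bigr => s _; rewrite /C; ring. Qed.

Lemma lower_christoffelC y i j k : U y -> C y i j k = C y i k j.
Proof. by move=> Uy; rewrite /C (pdgC i j k Uy); ring. Qed.

Lemma levi_civita_symmetric : symmetric_connection U Gam.
Proof.
split=> [i j k|y Uy i j k]; first exact: smooth_levi_civita.
by rewrite !levi_civitaE; apply: eq_bigr => s _; rewrite lower_christoffelC.
Qed.

Lemma lower_levi_civita y i j k : U y -> \sum_s g y i s * Gam y s j k = C y i j k.
Proof.
move=> Uy; rewrite -[RHS](sum_eqMl i (fun t => C y t j k)).
transitivity (\sum_s \sum_t g y i s * invmx (g y) s t * C y t j k).
  by apply: eq_bigr => s _; rewrite levi_civitaE mulr_sumr; apply: eq_bigr => t _; rewrite mulrA.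
by rewrite exchange_big; apply: eq_bigr => t _; rewrite -mulr_suml sum_Minv //; exact: ug.
Qed.

Lemma pderiv_metric y d i j : U y -> pderiv d (fun z => g z i j) y = C y i j d + C y j i d.
Proof.
by move=> Uy; rewrite /C (pdgC d j i Uy) (pdgC i j d Uy) (pdgC j i d Uy); field.
Qed.

Let H l k i j x := pderiv l (pderiv k (fun y => g y i j)) x.

Let pderiv_lower x d i j k : U x -> pderiv d (fun y => C y i j k) x =
  2%:R^-1 * (H d k i j x + H d j i k x - H d i j k x).
Proof.
move=> Ux.
have dp k' i' j' : derivable (pderiv k' (fun y => g y i' j')) x (delta_mx 0 d).
  by apply: smooth_derivable Ux => //; apply: smooth_pderiv.
have dN k' i' j' : derivable (fun z => - pderiv k' (fun y => g y i' j') z) x (delta_mx 0 d).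
  exact: derivableN.
have E : pderiv d (fun y => - pderiv i (fun y => g y j k) y) x = - H d i j k x.
  have -> : (fun y => - pderiv i (fun y => g y j k) y) = (fun y => (fun=> -1) y * pderiv i (fun y => g y j k) y).
    by apply/funext => y; rewrite mulN1r.
  by rewrite pderivM // ?pderiv_cst ?mul0r ?addr0 ?mulN1r //; exact: derivable_cst.
have d2 : derivable (fun y => pderiv k (fun y => g y i j) y + pderiv j (fun y => g y i k) y) x (delta_mx 0 d).
  exact: derivableD.
have d3 : derivable (fun y => pderiv k (fun y => g y i j) y + pderiv j (fun y => g y i k) y
     - pderiv i (fun y => g y j k) y) x (delta_mx 0 d).
  exact: (derivableD d2 (dN _ _ _)).
have dc : derivable (fun=> 2%:R^-1 : R) x (delta_mx 0 d : 'rV[R]_4) by exact: derivable_cst.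
apply: etrans (pderivM dc d3) _.
rewrite pderiv_cst mul0r addr0; congr (_ * _).
by apply: etrans (pderivD d2 (dN _ _ _)) _; rewrite E; congr (_ + _); exact: (pderivD (dp _ _ _) (dp _ _ _)).
Qed.

Let HC x l k i j : U x -> H l k i j x = H k l i j x.
Proof. by move=> Ux; apply: (pderivC _ _ oU (smg i j 2) Ux). Qed.

Let HS x l k i j : U x -> H l k i j x = H l k j i x.
Proof. by move=> Ux; apply: (eq_on_pderiv oU) => // y Uy; exact: pdgC. Qed.

Local Opaque levi_civita lower_christoffel.

Lemma lower_curvature x i j k l : U x ->
  \sum_s g x i s * curvature Gam x s j k l =
  pderiv l (fun y => C y i j k) x - pderiv k (fun y => C y i j l) x
  - \sum_s C x s i l * Gam x s j k + \sum_s C x s i k * Gam x s j l.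
Proof.
move=> Ux.
have dgd d i' j' : derivable (fun y => g y i' j') x (delta_mx 0 d) by exact: smooth_derivable (smg i' j') Ux.
have dG d i' j' k' : derivable (fun y => Gam y i' j' k') x (delta_mx 0 d).
  exact: smooth_derivable (smooth_levi_civita i' j' k') Ux.
have dC d i' j' k' : pderiv d (fun y => C y i' j' k') x =
    \sum_s (g x i' s * pderiv d (fun y => Gam y s j' k') x + (C x i' s d + C x s i' d) * Gam x s j' k').
  transitivity (pderiv d (fun y => \sum_s g y i' s * Gam y s j' k') x).
    by apply: (eq_on_pderiv oU) => // y Uy; rewrite lower_levi_civita.
  have dt s : derivable (fun y => g y i' s * Gam y s j' k') x (delta_mx 0 d) by exact: derivableM.
  have [_ ->] := @pderiv_sum _ _ (index_enum _) (fun s y => g y i' s * Gam y s j' k') d x dt.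
  by apply: eq_bigr => s _; rewrite pderivM // pderiv_metric.
exact: (lower_curvature_algebra (fun i j k => lower_christoffelC i j k Ux)
  (fun i j k => lower_levi_civita i j k Ux) dC).
Qed.

Lemma christoffel_productC x i j k l : U x ->
  \sum_s C x s i j * Gam x s k l = \sum_s C x s k l * Gam x s i j.
Proof.
move=> Ux.
have E i' j' k' l' : \sum_s C x s i' j' * Gam x s k' l' =
    \sum_s \sum_t invmx (g x) s t * C x s i' j' * C x t k' l'.
  by apply: eq_bigr => s _; rewrite levi_civitaE mulr_sumr; apply: eq_bigr => t _; ring.
rewrite !E exchange_big; apply: eq_bigr => s _; apply: eq_bigr => t _.
by rewrite (invC t s Ux); ring.
Qed.

Let lower_curvatureE x i j k l : U x ->
  \sum_s g x i s * curvature Gam x s j k l =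
  riemann_form (fun l k i j => H l k i j x) (fun i j k l => \sum_s C x s i j * Gam x s k l) i j k l.
Proof.
move=> Ux; rewrite lower_curvature // (pderiv_lower l i j k Ux) (pderiv_lower k i j l Ux).
by [].
Qed.

Lemma riemann_skew x i j k l : U x ->
  \sum_s g x i s * curvature Gam x s j k l + \sum_s g x j s * curvature Gam x s i k l = 0.
Proof.
move=> Ux; rewrite !lower_curvatureE //; apply: riemann_form_skew => *.
- exact: HC.
- exact: HS.
- exact: christoffel_productC.
Qed.

Lemma riemann_pair x i j k l : U x ->
  \sum_s g x i s * curvature Gam x s j k l = \sum_s g x k s * curvature Gam x s l i j.
Proof.
move=> Ux; rewrite !lower_curvatureE //; apply: riemann_form_pair => [*|*|*|i' j' k' l'].
- exact: HC.
- exact: HS.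
- exact: christoffel_productC.
- apply: eq_bigr => s _; rewrite lower_christoffelC //; congr (_ * _).
  by have [_ sy] := levi_civita_symmetric; exact: sy.
Qed.
End RiemannSymmetries.

(** * Projective invariance of the Weyl tensor *)

Section ProjectiveAlgebra.
Context {R : realType}.
Local Notation tensor4 := ('I_4 -> 'I_4 -> 'I_4 -> 'I_4 -> R).

(** Derivatives are independent arguments here, so that a projective change becomes polynomial
    algebra. *)
Definition curvature_of (Gam : 'I_4 -> 'I_4 -> 'I_4 -> R) (dGam : tensor4) : tensor4 :=
  fun i j k l => dGam l i j k - dGam k i j l
    + \sum_a (Gam i l a * Gam a j k - Gam i k a * Gam a j l).

Definition weyl_of (K : tensor4) : tensor4 := fun i j k l =>
  let ric j k := \sum_a K a j k a in
  let sk j k := ric j k - ric k j in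
  K i j k l - 3%:R^-1 * ((i == l)%:R * ric j k - (i == k)%:R * ric j l)
  + 5%:R^-1 * ((i == j)%:R * sk k l)
  + 15%:R^-1 * ((i == l)%:R * sk j k - (i == k)%:R * sk j l).

Lemma weyl_ofE (G : conn R) x : weyl G x = weyl_of (curvature G x).
Proof. by []. Qed.

(** [P j l] is the covariant derivative of phi_j in direction [l], minus phi_j phi_l. Its skew part
    is nonzero when [phi] is not closed, which is the source of the term with [i == j]. *)
Lemma curvature_of_projective (Gam : 'I_4 -> 'I_4 -> 'I_4 -> R) (dGam : tensor4)
    (phi : 'I_4 -> R) (dphi : 'I_4 -> 'I_4 -> R) i j k l :
  (forall i j k, Gam i j k = Gam i k j) ->
  let P j l := dphi l j - \sum_a phi a * Gam a j l - phi j * phi l in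
  curvature_of (fun i j k => Gam i j k + (i == j)%:R * phi k + (i == k)%:R * phi j)
    (fun l i j k => dGam l i j k + (i == j)%:R * dphi l k + (i == k)%:R * dphi l j) i j k l =
  curvature_of Gam dGam i j k l + (i == j)%:R * (P k l - P l k)
    + (i == k)%:R * P j l - (i == l)%:R * P j k.
Proof.
move=> GC P.
pose T l k := \sum_a Gam i l a * Gam a j k.
have prodE l' k' : \sum_a (Gam i l' a + (i == l')%:R * phi a + (i == a)%:R * phi l')
      * (Gam a j k' + (a == j)%:R * phi k' + (a == k')%:R * phi j) =
    T l' k' + Gam i l' j * phi k' + Gam i l' k' * phi j
    + (i == l')%:R * (\sum_a phi a * Gam a j k' + phi j * phi k' + phi k' * phi j)
    + phi l' * (Gam i j k' + (i == j)%:R * phi k' + (i == k')%:R * phi j).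
  rewrite -(sum_eqMl' j (fun a => Gam i l' a * phi k')) -(sum_eqMl' k' (fun a => Gam i l' a * phi j)).
  rewrite -(sum_eqMl' j (fun a => phi a * phi k')) -(sum_eqMl' k' (fun a => phi a * phi j)).
  rewrite -[X in phi l' * X](sum_eqMl i (fun a => Gam a j k' + (a == j)%:R * phi k' + (a == k')%:R * phi j)).
  rewrite /T -!big_split /= !mulr_sumr -!big_split /=; apply: eq_bigr => a _; ring.
have PkE : \sum_a phi a * Gam a k l = \sum_a phi a * Gam a l k.
  by apply: eq_bigr => a _; rewrite GC.
rewrite /curvature_of !sumrB !prodE /P -/(T l k) -/(T k l) PkE.
by rewrite (GC i j k) (GC i j l) (GC i k l); ring.
Qed.

(** The Ricci tensor changes by P_{kj} - 4 P_{jk}, so its skew part changes by 5 (P_{kj} - P_{jk});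
    this is what the coefficients 1/5 and 1/15 in the Weyl tensor compensate. *)
Lemma weyl_of_projective (K K' : tensor4) (P : 'I_4 -> 'I_4 -> R) :
  (forall i j k l, K' i j k l = K i j k l + (i == j)%:R * (P k l - P l k)
    + (i == k)%:R * P j l - (i == l)%:R * P j k) ->
  forall i j k l, weyl_of K' i j k l = weyl_of K i j k l.
Proof.
move=> KE i j k l.
have ricE j' k' : \sum_a K' a j' k' a = \sum_a K a j' k' a + P k' j' - 4%:R * P j' k'.
  transitivity (\sum_a K a j' k' a + \sum_a (a == j')%:R * (P k' a - P a k')
      + \sum_a (a == k')%:R * P j' a - \sum_(a < 4) P j' k').
    by rewrite -!big_split -sumrB; apply: eq_bigr => a _; rewrite KE eqxx mul1r.
  by rewrite !sum_eqMl' sumr_const card_ord mulr_natl; ring.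
by rewrite /weyl_of KE !ricE; field.
Qed.

Lemma weyl_of_ricci_flat (K : tensor4) : (forall j k, \sum_a K a j k a = 0) ->
  forall i j k l, weyl_of K i j k l = K i j k l.
Proof.
by move=> H i j k l; rewrite /weyl_of !H !subrr !mulr0 subrr !mulr0 subr0 !addr0.
Qed.
End ProjectiveAlgebra.

Section ProjectiveClass.
Context {R : realType} (U : set 'rV[R]_4) (oU : open U).
Variables (G : conn R) (g : 'rV[R]_4 -> 'M[R]_4).
Hypotheses (sG : symmetric_connection U G) (mg : metric U g) (pg : in_projective_class U G g).

Local Notation Gam := (levi_civita g).

Let smGam i j k : smooth U (fun y => Gam y i j k).
Proof. by have [H _] := levi_civita_symmetric oU mg; exact: H. Qed.

Local Opaque levi_civita.

Lemma weyl_levi_civita x i j k l : U x -> weyl Gam x i j k l = weyl G x i j k l.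
Proof.
move=> Ux; have [phi0 Hphi0] := pg; have [smG symG] := sG.
(* [phi0] comes without regularity. Tracing the projective relation gives 5 phi0, so on [U] it
   equals this smooth expression, which can be differentiated. *)
pose phi c y := 5%:R^-1 * (\sum_a Gam y a a c - \sum_a G y a a c).
have phiE c y : U y -> phi0 y 0 c = phi c y.
  move=> Uy; rewrite /phi -sumrB.
  have -> : \sum_a (Gam y a a c - G y a a c) = \sum_(a < 4) phi0 y 0 c + \sum_a (a == c)%:R * phi0 y 0 a.
    by rewrite -big_split; apply: eq_bigr => a _; rewrite Hphi0 // eqxx mul1r /=; ring.
  by rewrite sum_eqMl' sumr_const card_ord -[_ *+ 4]mulr_natl; field.
have smphi c : smooth U (phi c).
  apply: smoothM => //; first exact: smooth_cst.
  by apply: smoothB => //; apply: smooth_sum => // a _.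
have HG i' j' k' y : U y -> Gam y i' j' k' = G y i' j' k' + (i' == j')%:R * phi k' y + (i' == k')%:R * phi j' y.
  by move=> Uy; rewrite Hphi0 // !phiE.
have dE d i' j' k' : pderiv d (fun y => Gam y i' j' k') x = pderiv d (fun y => G y i' j' k') x
     + (i' == j')%:R * pderiv d (phi k') x + (i' == k')%:R * pderiv d (phi j') x.
  have dp c : derivable (phi c) x (delta_mx 0 d) by exact: smooth_derivable (smphi c) Ux.
  have dG : derivable (fun y => G y i' j' k') x (delta_mx 0 d) by exact: smooth_derivable (smG i' j' k') Ux.
  have dc (c : R) : derivable (fun=> c) x (delta_mx 0 d : 'rV[R]_4) by exact: derivable_cst.
  apply: etrans (eq_on_pderiv oU _ (fun y Uy => HG i' j' k' y Uy) Ux) _.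
  have d1 := derivableM (dc (i' == j')%:R) (dp k').
  have d2 := derivableM (dc (i' == k')%:R) (dp j').
  apply: etrans (pderivD (derivableD dG d1) d2) _.
  rewrite (pderivM (dc _) (dp _)) pderiv_cst mul0r addr0; congr (_ + _).
  apply: etrans (pderivD dG d1) _.
  by rewrite (pderivM (dc _) (dp _)) pderiv_cst mul0r addr0.
rewrite !weyl_ofE.
have KE := curvature_of_projective (Gam := G x) (fun d i j k => pderiv d (fun y => G y i j k) x)
  (fun c => phi c x) (fun d c => pderiv d (phi c) x) _ _ _ _ (symG x Ux).
have CE i' j' k' l' : curvature Gam x i' j' k' l' = curvature_of
    (fun i j k => G x i j k + (i == j)%:R * phi k x + (i == k)%:R * phi j x)
    (fun l i j k => pderiv l (fun y => G y i j k) x + (i == j)%:R * pderiv l (phi k) x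
       + (i == k)%:R * pderiv l (phi j) x) i' j' k' l'.
  rewrite /curvature /curvature_of !dE; congr (_ + _).
  by apply: eq_bigr => a _; rewrite !HG.
by apply: weyl_of_projective => i' j' k' l'; rewrite CE; exact: KE.
Qed.

Lemma ricci_flat_weyl x i j k l : ricci_flat U g -> U x ->
  weyl G x i j k l = curvature Gam x i j k l.
Proof.
move=> rf Ux; rewrite -weyl_levi_civita // weyl_ofE; apply: weyl_of_ricci_flat => j' k'.
exact: rf.
Qed.

Lemma ricci_flat_solA x : ricci_flat U g -> U x -> solA G x (g x).
Proof.
move=> rf Ux; have [_ /(_ x Ux) [sg _]] := mg.
have wE i j k m : \sum_s g x i s * weyl G x s j k m = \sum_s g x i s * curvature Gam x s j k m.
  by apply: eq_bigr => s _; rewrite ricci_flat_weyl.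
split=> // i j k m; rewrite !wE; first exact: (riemann_skew oU mg).
by rewrite (riemann_pair oU mg i j k m Ux) subrr.
Qed.
End ProjectiveClass.

(** * Reconstruction of the metric *)

Lemma root5_exp5 (R : realType) (y : R) : root5 (y ^+ 5) = y.
Proof.
rewrite /root5 sgrX normrX -(powR_mulrn 5 (normr_ge0 y)) -powRrM mulfV ?pnatr_eq0 // powRr1 //.
have -> : Num.sg y ^+ 5 = Num.sg y.
  by case: (ltgtP y 0) => [y0|y0|->]; rewrite ?sgr0 ?(ltr0_sg y0) ?(gtr0_sg y0) ?expr1n //; ring.
by rewrite -numEsg.
Qed.

(** A fifth root of the determinant is supplied as [r], so that later computations stay free of real
    powers. *)
Lemma sigma_of_conformal (R : realType) (a : 'M[R]_4) (h r : R) :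
  h != 0 -> a \in unitmx -> r ^+ 5 = h ^+ 4 * \det a ->
  sigma_of (h *: a) = (r / h) *: invmx a.
Proof.
move=> h0 ua r5; rewrite /sigma_of detZ -r5 root5_exp5 invmxZ ?scalerA //.
by rewrite unitmxZ // unitfE.
Qed.

Section Congruence.
Context {R : realType} (U : set 'rV[R]_4) (oU : open U).

Lemma eq_on_levi_civita (g g' : 'rV[R]_4 -> 'M[R]_4) x i j k :
  (forall y, U y -> g y = g' y) -> U x -> levi_civita g x i j k = levi_civita g' x i j k.
Proof.
move=> gg Ux; rewrite /levi_civita (gg x Ux); congr (_ * _); apply: eq_bigr => s _.
have E d l m : pderiv d (fun y => g y l m) x = pderiv d (fun y => g' y l m) x.
  by apply: (eq_on_pderiv oU) => // y Uy; rewrite gg.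
by rewrite !E.
Qed.

Lemma eq_on_in_projective_class G (g g' : 'rV[R]_4 -> 'M[R]_4) :
  (forall y, U y -> g y = g' y) -> in_projective_class U G g -> in_projective_class U G g'.
Proof.
move=> gg [phi H]; exists phi => x Ux i j k.
by rewrite -(eq_on_levi_civita i j k gg Ux) H.
Qed.

Lemma gradient_closed (lam : 'rV[R]_4 -> R) (w : 'rV[R]_4 -> 'rV[R]_4) :
  potential U lam w -> closed_form U w.
Proof.
move=> [sl dl] x Ux i k.
have E l : forall y, U y -> w y 0 l = pderiv l lam y by move=> y Uy; rewrite dl.
rewrite (eq_on_pderiv oU k (E i) Ux) (eq_on_pderiv oU i (E k) Ux).
exact: (pderivC k i oU (sl 2%N) Ux).
Qed.

Lemma eq_on_potential lam (w w' : 'rV[R]_4 -> 'rV[R]_4) :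
  (forall y, U y -> w y = w' y) -> potential U lam w -> potential U lam w'.
Proof. by move=> ww [sl dl]; split=> // x Ux i; rewrite -ww // dl. Qed.

Lemma potential_constant p lam lam' w : star_shaped p U ->
  potential U lam w -> potential U lam' w ->
  forall x, U x -> lam x = lam' x + (lam p - lam' p).
Proof.
move=> sU [sl dl] [sl' dl'] x Ux.
have := @star_shaped_constant R p U (fun y => lam y - lam' y) sU _ x Ux.
move=> <-; first by rewrite addrC subrK.
move=> y Uy; split.
  by apply: smooth_differentiable Uy => //; apply: smoothB.
move=> i.
have d1 : derivable lam y (delta_mx 0 i) by exact: smooth_derivable sl Uy.
have d2 : derivable lam' y (delta_mx 0 i) by exact: smooth_derivable sl' Uy.
have E : pderiv i (fun y => lam y - lam' y) y = pderiv i lam y - pderiv i lam' y.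
  have -> : (fun y => lam y - lam' y) = (fun y => lam y + (fun=> -1) y * lam' y).
    by apply/funext => z; rewrite mulN1r.
  have dc : derivable (fun=> -1 : R) y (delta_mx 0 i : 'rV[R]_4) by exact: derivable_cst.
  apply: etrans (pderivD d1 (derivableM dc d2)) _.
  by rewrite (pderivM dc d2) pderiv_cst mul0r addr0 mulN1r.
by rewrite E dl // dl' // subrr.
Qed.
End Congruence.

Section Main.
Context {R : realType} (p : 'rV[R]_4) (U : set 'rV[R]_4) (G : conn R).
Hypotheses (smallU : small_nbhd p U) (sG : symmetric_connection U G) (ndW : nondegenerate_weyl U G).

Let oU : open U. Proof. by have [] := smallU. Qed.
Let starU : star_shaped p U. Proof. by have [] := smallU. Qed.
Let Up : U p. Proof. by have [_ []] := smallU. Qed.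

Lemma nondegenerate_field_neq0 a x : nondegenerate_field U a -> U x -> a x != 0.
Proof.
move=> [_ H] Ux; have [_ ua] := H x Ux; apply: contraTneq ua => ->.
by rewrite unitmxE det0 unitr0.
Qed.

Lemma nondegenerate_field_det a x : nondegenerate_field U a -> U x -> \det (a x) != 0.
Proof. by move=> [_ H] Ux; have [_] := H x Ux; rewrite unitmxE unitfE. Qed.

Lemma solA_multiple x (a b : 'M[R]_4) : U x -> a != 0 -> solA G x a -> solA G x b ->
  exists c : R, b = c *: a.
Proof.
by move=> Ux a0 sa sb; apply: proportionalE => //; apply: solA_proportional sa sb; exact: ndW.
Qed.

Lemma solB_unique a w w' : nondegenerate_field U a -> solB U G a w -> solB U G a w' ->
  forall x, U x -> w x = w' x.
Proof.
move=> [_ H] Bw Bw' x Ux; have [sa ua] := H x Ux.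
exact: (systemB_unique sa ua (Bw x Ux) (Bw' x Ux)).
Qed.

Section ConformalFactor.
Variables (a : 'rV[R]_4 -> 'M[R]_4) (h : 'rV[R]_4 -> R).
Hypotheses (na : nondegenerate_field U a) (sh : smooth U h) (h0 : forall x, U x -> h x != 0).

Let sma i j : smooth U (fun x => a x i j). Proof. by have [H _] := na; exact: H. Qed.
Let ua x : U x -> a x \in unitmx. Proof. by have [_ H] := na; move=> /H []. Qed.
Let sdet : smooth U (fun x => \det (a x)). Proof. exact: smooth_det. Qed.
Let det0 x : U x -> \det (a x) != 0. Proof. exact: nondegenerate_field_det. Qed.

Definition det_ratio x := \det (a x) * (h x)^-1.
(** This is (1/5) ln |det a / h|; squaring replaces the absolute value, and the function is smooth
    for either sign of the ratio. *)
Definition conformal_potential x := 10%:R^-1 * ln (det_ratio x * det_ratio x).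

Let sD : smooth U det_ratio.
Proof. by apply: smoothM => //; apply: smoothV. Qed.

Let D0 x : U x -> det_ratio x != 0.
Proof. by move=> Ux; rewrite mulf_neq0 ?det0 // invr_neq0 // h0. Qed.

Let DD0 x : U x -> 0 < det_ratio x * det_ratio x.
Proof. by move=> Ux; rewrite -expr2 exprn_even_gt0 // D0. Qed.

Lemma potential_conformal : potential U conformal_potential (log_gradient_row a h).
Proof.
split; first by apply: smoothM => //; [exact: smooth_cst|apply: smooth_ln => //; exact: smoothM].
move=> x Ux i; rewrite mxE /log_gradient.
have sDD : smooth U (fun x => det_ratio x * det_ratio x) by exact: smoothM.
have dD : derivable det_ratio x (delta_mx 0 i) by exact: smooth_derivable sD Ux.
have ddet : derivable (fun x => \det (a x)) x (delta_mx 0 i) by exact: smooth_derivable sdet Ux.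
have dh : derivable h x (delta_mx 0 i) by exact: smooth_derivable sh Ux.
have [dl El] := pderiv_ln i (DD0 Ux) (smooth_differentiable oU sDD Ux).
have dc : derivable (fun=> 10%:R^-1 : R) x (delta_mx 0 i : 'rV[R]_4) by exact: derivable_cst.
apply: etrans (pderivM dc dl) _.
rewrite El pderiv_cst mul0r addr0 (pderivM dD dD).
have dV : derivable (fun y => (h y)^-1) x (delta_mx 0 i) by exact: (derivableV (h0 Ux) dh).
have -> : pderiv i det_ratio x = det_ratio x * (\tr (invmx (a x) *m pderiv_mx a x i) - pderiv i h x / h x).
  apply: etrans (pderivM ddet dV) _.
  rewrite (pderivV (h0 Ux) dh) (pderiv_det_unit oU sma ua i Ux) /det_ratio.
  by field; exact: h0.
by have Dx := D0 Ux; have hx := h0 Ux; field; rewrite hx Dx.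
Qed.

(** The quotient [u] of the two sides without the sign satisfies u^2 = 1, so 2 u du = 0 and [u] is
    constant on the star-shaped set. *)
Lemma det_ratio_sign : exists e : bool, forall x, U x ->
  det_ratio x = (-1) ^+ e * expR (5%:R * conformal_potential x).
Proof.
have [sl _] := potential_conformal.
pose u x := det_ratio x * expR (- 5%:R * conformal_potential x).
have su : smooth U u.
  apply: smoothM => //; apply: smooth_expR => //; apply: smoothM => //; exact: smooth_cst.
have EE x : expR (- 5%:R * conformal_potential x) * expR (5%:R * conformal_potential x) = 1.
  by rewrite -expRD mulNr addNr expR0.
have uu x : U x -> u x * u x = 1.
  move=> Ux; rewrite /u mulrACA -expRD.
  have -> : - 5%:R * conformal_potential x + - 5%:R * conformal_potential x = - ln (det_ratio x * det_ratio x).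
    by rewrite /conformal_potential; field.
  by rewrite expRN lnK ?posrE ?DD0 // mulfV // lt0r_neq0 // DD0.
have uc x : U x -> u x = u p.
  apply: star_shaped_constant starU _ x => x Ux; split; first exact: smooth_differentiable su Ux.
  move=> i; have du : derivable u x (delta_mx 0 i) by exact: smooth_derivable su Ux.
  have u0 : u x != 0 by apply/eqP => u0; have /eqP := uu x Ux; rewrite u0 mul0r eq_sym oner_eq0.
  have : pderiv i (fun y => u y * u y) x = 0.
    by apply: etrans (eq_on_pderiv oU i uu Ux) _; exact: pderiv_cst.
  rewrite (pderivM du du) [pderiv i u x * _]mulrC -mulr2n => /eqP.
  by rewrite mulrn_eq0 /= mulf_eq0 (negPf u0) => /eqP.
have [e ue] : exists e : bool, u p = (-1) ^+ e.
  have /eqP := uu p Up; rewrite -expr2 sqrf_eq1 => /orP[/eqP ->|/eqP ->].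
    by exists false; rewrite expr0.
  by exists true; rewrite expr1.
exists e => x Ux; rewrite -ue -(uc x Ux) /u -mulrA EE mulr1.
by [].
Qed.

(** Multiplying a metric by t multiplies its sigma by t^{-1} (t^4)^{1/5} = t^{-1/5}, also for
    negative t. Hence the factor e^{-5C} adds [C] to the potential, and the sign makes the scalar
    factor positive. *)
Lemma sigma_of_scaled (e : bool) (C : R) x :
  (forall x, U x -> det_ratio x = (-1) ^+ e * expR (5%:R * conformal_potential x)) -> U x ->
  sigma_of (((-1) ^+ e * expR (- 5%:R * C)) *: (h x *: a x)) =
    expR (conformal_potential x + C) *: invmx (a x).
Proof.
move=> He Ux; rewrite scalerA.
set s : R := (-1) ^+ e.
have s2 : s * s = 1 by rewrite /s -expr2 sqrr_sign.
have s0 : s != 0 by rewrite /s signr_eq0.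
have hx := h0 Ux.
have dE : \det (a x) = h x * (s * expR (5%:R * conformal_potential x)).
  by rewrite -He // /det_ratio; field.
have expn (n : nat) (y : R) : expR y ^+ n = expR (n%:R * y) by rewrite -expRM_natl.
pose r := s * expR (- 4%:R * C) * h x * expR (conformal_potential x).
have r5 : r ^+ 5 = (s * expR (- 5%:R * C) * h x) ^+ 4 * \det (a x).
  rewrite dE /r !exprMn !expn.
  have -> : s ^+ 5 = s by rewrite !exprS expr0 mulr1 !mulrA s2 mul1r s2 mul1r.
  have -> : s ^+ 4 = 1 by rewrite !exprS expr0 mulr1 !mulrA s2 mul1r s2.
  have -> : 5%:R * (- 4%:R * C) = 4%:R * (- 5%:R * C) by ring.
  by ring.
have e0 y : expR y != 0 :> R by exact: lt0r_neq0 (expR_gt0 _).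
rewrite (sigma_of_conformal _ (ua Ux) r5) ?mulf_neq0 //; congr (_ *: _).
rewrite /r expRD.
have -> : expR (- 4%:R * C) = expR (- 5%:R * C) * expR C by rewrite -expRD; congr expR; ring.
by field; rewrite s0 hx e0.
Qed.
End ConformalFactor.

Lemma solB_conformal a h : nondegenerate_field U a -> smooth U h -> (forall x, U x -> h x != 0) ->
  in_projective_class U G (fun y => h y *: a y) -> solB U G a (log_gradient_row a h).
Proof. by move=> na sh h0; apply: (projective_systemB oU na sh h0 sG).1. Qed.

Lemma ricci_flat_factor a g : nondegenerate_solA U G a ->
  metric U g -> in_projective_class U G g -> ricci_flat U g ->
  exists h, [/\ smooth U h, forall x, U x -> h x != 0, forall x, U x -> g x = h x *: a x
    & solB U G a (log_gradient_row a h)].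
Proof.
move=> [na solAa] mg pg rg.
(* The factor is recovered by a trace rather than chosen point by point, which makes it smooth. *)
pose h x := 4%:R^-1 * \tr (invmx (a x) *m g x).
have ghE x : U x -> g x = h x *: a x.
  move=> Ux; have [_ /(_ x Ux) [_ ua]] := na.
  have [|c gE] := solA_multiple Ux (nondegenerate_field_neq0 na Ux) (solAa x Ux) (b := g x).
    exact: (ricci_flat_solA oU sG mg pg rg Ux).
  rewrite /h gE -scalemxAr linearZ /= mulVmx // mxtrace1.
  by rewrite mulrCA mulVf ?mulr1 // pnatr_eq0.
have sh : smooth U h.
  have [sma _] := na; have [smg _] := mg.
  apply: smoothM => //; first exact: smooth_cst.
  apply: (eq_on_smooth oU (f := fun x => \sum_i \sum_j invmx (a x) i j * g x j i)).
    by move=> x _; apply: eq_bigr => i _; rewrite mxE.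
  apply: smooth_sum => // i _; apply: smooth_sum => // j _; apply: smoothM => //.
  by apply: smooth_invmx => // x Ux; have [_ /(_ x Ux) []] := na.
have h0 x : U x -> h x != 0.
  move=> Ux; have := nondegenerate_field_neq0 mg Ux; apply: contraNneq => h0.
  by rewrite ghE // h0 scale0r.
exists h; split=> //; apply: solB_conformal => //.
exact: (eq_on_in_projective_class oU ghE).
Qed.

(** A solution of (B) is given pointwise; the explicit formula for the gradient makes it smooth, as
    the Poincare lemma requires. *)
Lemma smooth_solB a w : nondegenerate_field U a -> solB U G a w ->
  forall i, smooth U (fun x => w x 0 i).
Proof.
move=> na Bw k; have [sma syma] := na; have [smG _] := sG.
have ua x : U x -> a x \in unitmx by move=> /syma [].
apply: (eq_on_smooth oU (f := fun x => - (5%:R / 18%:R) *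
   contraction G x (a x) (pderiv_mx (fun y => invmx (a y)) x) k)).
  by move=> x Ux; have [sx ux] := syma x Ux; rewrite (systemB_gradient sx ux (Bw x Ux)).
have ss i j : smooth U (fun x => invmx (a x) i j) by exact: smooth_invmx.
have sn i j l : smooth U (fun x => nabla G x (invmx (a x)) (pderiv_mx (fun y => invmx (a y)) x) i j l).
  rewrite /nabla; apply: smoothB => //.
    apply: smoothD => //; first apply: smoothD => //.
    - apply: (eq_on_smooth oU (f := pderiv i (fun y => invmx (a y) j l))).
        by move=> x _; rewrite mxE.
      exact: smooth_pderiv.
    - by apply: smooth_sum => // d _; apply: smoothM.
    - by apply: smooth_sum => // d _; apply: smoothM.
  apply: smoothM => //; apply: smoothM => //; first exact: smooth_cst.
  by apply: smooth_sum.
apply: smoothM => //; first exact: smooth_cst.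
apply: smooth_sum => // b _; apply: smooth_sum => // c _; apply: smoothM => //.
rewrite /E_lhs; apply: smoothB => //; apply: smoothM => //; first exact: smooth_cst.
by apply: smoothD => //; apply: smoothM => //; try exact: smooth_cst; exact: smooth_sum.
Qed.

(** Take [a = gbar] in (B). The factor 1 of [gbar] and the factor [h] of [g] both yield solutions;
    as (B) has at most one, dh / h = 0. *)
Lemma ricci_flat_unique gbar g : 
  metric U gbar -> in_projective_class U G gbar -> ricci_flat U gbar ->
  metric U g -> in_projective_class U G g -> ricci_flat U g ->
  exists c : R, c != 0 /\ forall x, U x -> g x = c *: gbar x.
Proof.
move=> mb pb rb mg pg rg.
have solb : nondegenerate_solA U G gbar.
  by split=> // x Ux; exact: (ricci_flat_solA oU sG mb pb rb Ux).
have [h [sh h0 ghE Bh]] := ricci_flat_factor solb mg pg rg.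
have B1 : solB U G gbar (log_gradient_row gbar (fun=> 1)).
  apply: solB_conformal => //.
  - exact: smooth_cst.
  - have E y : U y -> gbar y = 1 *: gbar y by rewrite scale1r.
    exact: (eq_on_in_projective_class oU E pb).
have dh x : U x -> forall i, pderiv i h x = 0.
  move=> Ux i; have /rowP /(_ i) := solB_unique mb Bh B1 Ux.
  rewrite !mxE /log_gradient pderiv_cst mul0r.
  have n5 : (5%:R^-1 : R) != 0 by rewrite invr_eq0 pnatr_eq0.
  move=> /(mulfI n5) /addrI /oppr_inj /eqP.
  by rewrite mulf_eq0 invr_eq0 (negPf (h0 x Ux)) orbF => /eqP.
exists (h p); split; first exact: h0.
move=> x Ux; rewrite ghE //; congr (_ *: _).
apply: star_shaped_constant starU _ x Ux => y Uy; split; last exact: dh.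
exact: smooth_differentiable sh Uy.
Qed.

Lemma ricci_flat_reconstruction gbar a :
  metric U gbar -> in_projective_class U G gbar -> ricci_flat U gbar ->
  nondegenerate_solA U G a ->
  (exists w, solB U G a w) /\
  forall w, solB U G a w ->
    [/\ closed_form U w,
        (exists lam, potential U lam w),
        (forall lam, potential U lam w ->
           exists c : R, c != 0 /\ forall x, U x ->
             sigma_of (c *: gbar x) = expR (lam x) *: invmx (a x))
      & exists (e : bool) lam, potential U lam w /\
          forall x, U x ->
            sigma_of (gbar x) = expR (lam x) *: invmx ((-1) ^+ e *: a x)].
Proof.
move=> mb pb rb sola; have [na _] := sola.
have [h [sh h0 ghE Bh]] := ricci_flat_factor sola mb pb rb.
split; first by exists (log_gradient_row a h).
move=> w Bw.
have pot : potential U (conformal_potential a h) w.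
  apply: eq_on_potential (potential_conformal na sh h0) => x Ux.
  exact: solB_unique na Bh Bw x Ux.
have [e He] := det_ratio_sign na sh h0.
have expn0 y : expR y != 0 :> R by exact: lt0r_neq0 (expR_gt0 _).
split.
- exact: gradient_closed pot.
- by exists (conformal_potential a h).
- move=> lam plam.
  (* Two potentials of [w] differ by a constant, which is absorbed by scaling the metric by
     e^{-5C}. *)
  pose C := lam p - conformal_potential a h p.
  exists ((-1) ^+ e * expR (- 5%:R * C)); split; first by rewrite mulf_neq0 // signr_eq0.
  move=> x Ux; rewrite ghE // (sigma_of_scaled na h0 C He Ux).
  by rewrite (potential_constant oU starU plam pot Ux).
(* The metric is kept and the sign is moved to [a]; both [sigma_of] and inversion are odd. *)
- exists e, (conformal_potential a h); split=> // x Ux.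
  have := sigma_of_scaled na h0 0 He Ux; rewrite mulr0 expR0 mulr1 addr0 => E.
  have [_ /(_ x Ux) [_ ua]] := na.
  have sE : ((-1) ^+ e : R)^-1 = (-1) ^+ e by rewrite invr_sign.
  rewrite invmxZ ?unitmxZ ?unitfE ?signr_eq0 // sE scalerA mulrC -scalerA -E ghE //.
  have : h x *: a x \in unitmx by rewrite unitmxZ // unitfE h0.
  move: (h x *: a x) => M uM; rewrite /sigma_of detZ.
  have -> : ((-1) ^+ e : R) ^+ 4 = 1 by rewrite -[4%N]/(2 * 2)%N exprM sqrr_sign expr1n.
  rewrite mul1r invmxZ ?unitmxZ ?unitfE ?signr_eq0 // sE !scalerA.
  by congr (_ *: _); rewrite mulrAC -[X in X * _]expr2 sqrr_sign mul1r.
Qed.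

Lemma no_ricci_flat :
  ((exists x, U x /\ forall b, solA G x b -> \det b = 0) \/
   (exists a, nondegenerate_solA U G a /\ ~ exists w, solB U G a w) \/
   (exists a w, [/\ nondegenerate_solA U G a, solB U G a w & ~ closed_form U w])) ->
   ~ exists g, [/\ metric U g, in_projective_class U G g & ricci_flat U g].
Proof.
move=> H [g [mg pg rg]]; case: H => [[x [Ux H]]|[[a [sola H]]|[a [w [sola Bw H]]]]].
- have := nondegenerate_field_det mg Ux.
  by rewrite (H _ (ricci_flat_solA oU sG mg pg rg Ux)) eqxx.
- by apply: H; have [] := ricci_flat_reconstruction mg pg rg sola.
- by apply: H; have [_ /(_ w Bw) []] := ricci_flat_reconstruction mg pg rg sola.
Qed.

Lemma metric_of_solution a w : nondegenerate_solA U G a -> solB U G a w -> closed_form U w ->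
  (exists lam, potential U lam w) /\
  forall lam, potential U lam w ->
    exists g, [/\ metric U g, in_projective_class U G g &
      forall x, U x -> sigma_of (g x) = expR (lam x) *: invmx (a x)].
Proof.
move=> [na _] Bw cw; split.
  exact: poincare smallU (smooth_solB na Bw) cw.
move=> lam [sl dl]; have [sma syma] := na.
have ua x : U x -> a x \in unitmx by move=> /syma [].
have expn0 y : expR y != 0 :> R by exact: lt0r_neq0 (expR_gt0 _).
pose f x := expR (- 5%:R * lam x).
pose h x := f x * \det (a x).
have s5 : smooth U (fun x => - 5%:R * lam x) by apply: smoothM => //; exact: smooth_cst.
have sf : smooth U f by exact: smooth_expR.
have sd : smooth U (fun x => \det (a x)) by exact: smooth_det.
have sh : smooth U h by exact: smoothM.
have d0 x : U x -> \det (a x) != 0 by exact: nondegenerate_field_det.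
have h0 x : U x -> h x != 0 by move=> Ux; rewrite mulf_neq0 ?expn0 ?d0.
have wE x : U x -> log_gradient_row a h x = w x.
  move=> Ux; apply/rowP => i; rewrite mxE -dl // /log_gradient.
  have d1 : derivable f x (delta_mx 0 i) by exact: smooth_derivable sf Ux.
  have d2 : derivable (fun x => \det (a x)) x (delta_mx 0 i) by exact: smooth_derivable sd Ux.
  have d3 : derivable lam x (delta_mx 0 i) by exact: smooth_derivable sl Ux.
  have dc : derivable (fun=> - 5%:R : R) x (delta_mx 0 i : 'rV[R]_4) by exact: derivable_cst.
  have [_ Ef] := pderiv_expR i (smooth_differentiable oU s5 Ux).
  rewrite (pderivM dc d3) pderiv_cst mul0r addr0 in Ef.
  have -> : pderiv i h x = h x * (- 5%:R * pderiv i lam x + \tr (invmx (a x) *m pderiv_mx a x i)).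
    apply: etrans (pderivM d1 d2) _; rewrite (pderiv_det_unit oU sma ua i Ux) Ef /h /f; ring.
  by field; exact: h0.
have Bh : solB U G a (log_gradient_row a h).
  by move=> x Ux; rewrite wE //; exact: Bw.
exists (fun y => h y *: a y); split.
- split=> [i j|x Ux].
    apply: (eq_on_smooth oU (f := fun x => h x * a x i j)); first by move=> x _; rewrite mxE.
    exact: smoothM.
  have [sx ux] := syma x Ux; split; first by rewrite linearZ /= sx.
  by rewrite unitmxZ // unitfE h0.
- exact: (projective_systemB oU na sh h0 sG).2.
- move=> x Ux.
  (* The fifth root is explicit: e^{-4 lam} det a has fifth power h^4 det a for h = e^{-5 lam} det
     a. *)
  have r5 : (expR (- 4%:R * lam x) * \det (a x)) ^+ 5 = h x ^+ 4 * \det (a x).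
    have expn (n : nat) (y : R) : expR y ^+ n = expR (n%:R * y) by rewrite -expRM_natl.
    rewrite /h /f !exprMn !expn.
    have -> : 5%:R * (- 4%:R * lam x) = 4%:R * (- 5%:R * lam x) by ring.
    by ring.
  rewrite (sigma_of_conformal (h0 x Ux) (ua x Ux) r5); congr (_ *: _).
  have -> : expR (- 4%:R * lam x) = expR (- 5%:R * lam x) * expR (lam x).
    by rewrite -expRD; congr expR; ring.
  by rewrite /h /f; have dx := d0 x Ux; field; rewrite dx expn0.
Qed.
End Main.

(** * An Einstein metric that is not Ricci-flat *)

Section EinsteinExample.
Context {R : realType}.
Implicit Types (x y : 'rV[R]_4) (i j k l : 'I_4).

(** All metric coefficients and Christoffel symbols of the example have this shape, so one rule
    differentiates them all. *)
Definition cubic (c1 c2 c3 : 'I_4 -> R) (c : R) (y : 'rV[R]_4) : R :=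
  c + (c1 o1 * y 0 o1 + c2 o1 * (y 0 o1 * y 0 o1) + c3 o1 * (y 0 o1 * y 0 o1 * y 0 o1))
    + (c1 o3 * y 0 o3 + c2 o3 * (y 0 o3 * y 0 o3) + c3 o3 * (y 0 o3 * y 0 o3 * y 0 o3)).

Lemma smooth_cubic c1 c2 c3 c : smooth setT (cubic c1 c2 c3 c).
Proof.
have oT : open [set: 'rV[R]_4] by exact: openT.
have sc d : smooth [set: 'rV[R]_4] (fun=> d : R) by exact: smooth_cst.
have sx i : smooth [set: 'rV[R]_4] (fun y => y 0 i) by exact: smooth_coord.
have sp i (e1 e2 e3 : R) : smooth [set: 'rV[R]_4]
    (fun y => e1 * y 0 i + e2 * (y 0 i * y 0 i) + e3 * (y 0 i * y 0 i * y 0 i)).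
  apply: smoothD => //; first by apply: smoothD => //; do ! apply: smoothM => //.
  by do ! apply: smoothM => //.
exact: (smoothD oT (smoothD oT (sc c) (sp o1 _ _ _)) (sp o3 _ _ _)).
Qed.

Lemma pderiv_cubic c1 c2 c3 c d x : pderiv d (cubic c1 c2 c3 c) x =
   (d == o1)%:R * (c1 o1 + 2%:R * c2 o1 * x 0 o1 + 3%:R * c3 o1 * (x 0 o1 * x 0 o1))
 + (d == o3)%:R * (c1 o3 + 2%:R * c2 o3 * x 0 o3 + 3%:R * c3 o3 * (x 0 o3 * x 0 o3)).
Proof.
have dc (e : R) : derivable (fun=> e) x (delta_mx 0 d : 'rV[R]_4) by exact: derivable_cst.
have part i (e1 e2 e3 : R) :
   derivable (fun y : 'rV[R]_4 => e1 * y 0 i + e2 * (y 0 i * y 0 i) + e3 * (y 0 i * y 0 i * y 0 i)) x (delta_mx 0 d)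
   /\ pderiv d (fun y => e1 * y 0 i + e2 * (y 0 i * y 0 i) + e3 * (y 0 i * y 0 i * y 0 i)) x =
   (d == i)%:R * (e1 + 2%:R * e2 * x 0 i + 3%:R * e3 * (x 0 i * x 0 i)).
  have [dx Ex] := pderiv_coord i d x.
  have dx2 := derivableM dx dx; have dx3 := derivableM dx2 dx.
  have E2 := pderivM dx dx; have E3 := pderivM dx2 dx.
  have d1 := derivableM (dc e1) dx; have d2 := derivableM (dc e2) dx2; have d3 := derivableM (dc e3) dx3.
  split; first exact: (derivableD (derivableD d1 d2) d3).
  apply: etrans (pderivD (derivableD d1 d2) d3) _.
  rewrite (pderivM (dc e3) dx3).
  apply: etrans (f_equal2 _ (pderivD d1 d2) (erefl _)) _.
  by rewrite (pderivM (dc e1) dx) (pderivM (dc e2) dx2) E3 E2 Ex !pderiv_cst !fctE; ring.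
have [p1 E1] := part o1 (c1 o1) (c2 o1) (c3 o1).
have [p3 E3] := part o3 (c1 o3) (c2 o3) (c3 o3).
apply: etrans (pderivD (derivableD (dc c) p1) p3) _.
apply: etrans (f_equal2 _ (pderivD (dc c) p1) (erefl _)) _.
by rewrite E1 E3 pderiv_cst add0r.
Qed.

Definition off_diag i j : bool :=
  [|| (i == o0) && (j == o1), (i == o1) && (j == o0), (i == o2) && (j == o3) | (i == o3) && (j == o2)].

(* [2 dy0 dy1 + y1^2 dy0^2 + 2 dy2 dy3 + y3^2 dy2^2]: a product of two surfaces of curvature 1. *)
Definition product_metric x : 'M[R]_4 := \matrix_(i, j)
  cubic (fun=> 0) (fun m => ((m == o1) && (i == o0) && (j == o0) || (m == o3) && (i == o2) && (j == o2))%:R)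
    (fun=> 0) (off_diag i j)%:R x.

Definition product_metric_inv x : 'M[R]_4 := \matrix_(i, j)
  ((off_diag i j)%:R - ((i == o1) && (j == o1))%:R * (x 0 o1 * x 0 o1)
    - ((i == o3) && (j == o3))%:R * (x 0 o3 * x 0 o3)).

Definition product_christoffel (i j k : 'I_4) x : R := cubic
  (fun m => ((m == o1) && (i == o1) && ((j == o0) && (k == o1) || (j == o1) && (k == o0))
          || (m == o3) && (i == o3) && ((j == o2) && (k == o3) || (j == o3) && (k == o2)))%:R
         - ((m == o1) && (i == o0) && (j == o0) && (k == o0)
          || (m == o3) && (i == o2) && (j == o2) && (k == o2))%:R)
  (fun=> 0)
  (fun m => ((m == o1) && (i == o1) && (j == o0) && (k == o0)
          || (m == o3) && (i == o3) && (j == o2) && (k == o2))%:R) 0 x.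

Lemma product_metric_mulV x : product_metric x *m product_metric_inv x = 1%:M.
Proof.
apply/matrixP; apply: ord4P; apply: ord4P;
  by rewrite !mxE sum4 !mxE /cubic /off_diag /=; ring.
Qed.

Lemma product_metric_unit x : product_metric x \in unitmx.
Proof. by have [] := mulmx1_unit (product_metric_mulV x). Qed.

Lemma invmx_product_metric x : invmx (product_metric x) = product_metric_inv x.
Proof.
by rewrite -[RHS](mulKmx (product_metric_unit x)) product_metric_mulV mulmx1.
Qed.

Lemma metric_product : metric setT product_metric.
Proof.
split=> [i j|x _].
  have -> : (fun x => product_metric x i j) = cubic (fun=> 0)
    (fun m => ((m == o1) && (i == o0) && (j == o0) || (m == o3) && (i == o2) && (j == o2))%:R)
    (fun=> 0) (off_diag i j)%:R by apply/funext => x; rewrite mxE.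
  exact: smooth_cubic.
split; last exact: product_metric_unit.
apply/matrixP; apply: ord4P; apply: ord4P; by rewrite !mxE.
Qed.

Lemma pderiv_product_metric d i j x : pderiv d (fun y => product_metric y i j) x =
  ((d == o1) && (i == o0) && (j == o0))%:R * (2%:R * x 0 o1)
  + ((d == o3) && (i == o2) && (j == o2))%:R * (2%:R * x 0 o3).
Proof.
have -> : (fun x => product_metric x i j) = cubic (fun=> 0)
    (fun m => ((m == o1) && (i == o0) && (j == o0) || (m == o3) && (i == o2) && (j == o2))%:R)
    (fun=> 0) (off_diag i j)%:R by apply/funext => y; rewrite mxE.
rewrite pderiv_cubic /= !orbF -!andbA.
by case: (d == o1); case: (d == o3); case: (_ && _); case: (_ && _); rewrite /=; ring.
Qed.

Lemma levi_civita_product x i j k : levi_civita product_metric x i j k = product_christoffel i j k x.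
Proof.
rewrite /levi_civita sum4 invmx_product_metric !pderiv_product_metric !mxE /product_christoffel /cubic /off_diag.
move: i j k; apply: ord4P; apply: ord4P; apply: ord4P => /=; by field.
Qed.

Local Notation Gam := (levi_civita product_metric).

Lemma curvature_product x i j k l : curvature Gam x i j k l =
  pderiv l (product_christoffel i j k) x - pderiv k (product_christoffel i j l) x
  + \sum_a (product_christoffel i l a x * product_christoffel a j k x
          - product_christoffel i k a x * product_christoffel a j l x).
Proof.
have E i' j' k' : (fun y => Gam y i' j' k') = product_christoffel i' j' k'.
  by apply/funext => y; rewrite levi_civita_product.
rewrite /curvature !E; congr (_ + _); apply: eq_bigr => a _.
by rewrite !levi_civita_product.
Qed.

Lemma ricci_product x j k : ricci Gam x j k = product_metric x j k.
Proof.
rewrite /ricci sum4 !curvature_product !sum4 /product_christoffel !pderiv_cubic !mxE /cubic /off_diag.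
move: j k; apply: ord4P; apply: ord4P => /=; by ring.
Qed.

Lemma curvature_product_mixed x i j k l : (k < 2)%N -> (2 <= l)%N -> curvature Gam x i j k l = 0.
Proof.
rewrite curvature_product sum4 /product_christoffel !pderiv_cubic /cubic.
move: i j k l; apply: ord4P; apply: ord4P; apply: ord4P => /=; apply: ord4P => //= _ _; by ring.
Qed.

(** Exchanging rows 0, 1 and rows 2, 3, an even permutation, makes the matrix lower triangular with
    unit diagonal. *)
Lemma det_product_metric x : \det (product_metric x) = 1.
Proof.
pose T := tperm_mx o0 o1 *m (tperm_mx o2 o3 *m product_metric x).
have sE : forall i, perm.tperm o2 o3 (perm.tperm o0 o1 i) =
    if i == o0 then o1 else if i == o1 then o0 else if i == o2 then o3 else o2.
  by apply: ord4P; rewrite ?perm.tpermL ?perm.tpermR ?[perm.tperm o0 o1 _]perm.tpermD //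
    ?perm.tpermL ?perm.tpermR // perm.tpermD.
have TE i j : T i j = product_metric x
    (if i == o0 then o1 else if i == o1 then o0 else if i == o2 then o3 else o2) j.
  by rewrite /T -!xrowE !mxE sE.
have <- : \det T = \det (product_metric x).
  by rewrite !det_mulmx !det_perm !perm.odd_tperm /= !expr1 mulrA mulrN1 opprK mul1r.
rewrite det_trig; last first.
  by apply/is_trig_mxP; apply: ord4P; apply: ord4P => //= _;
    rewrite TE /= mxE /cubic /off_diag /=; ring.
have p4 (f : 'I_4 -> R) : \prod_i f i = f o0 * f o1 * f o2 * f o3.
  rewrite !big_ord_recr big_ord0 /= mul1r.
  by congr (_ * _ * _ * _); congr f; apply: val_inj.
by rewrite p4 !TE /= !mxE /cubic /off_diag /=; ring.
Qed.

Lemma weyl_product x i j k l : weyl Gam x i j k l = curvature Gam x i j k l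
  - 3%:R^-1 * ((i == l)%:R * product_metric x j k - (i == k)%:R * product_metric x j l).
Proof.
have [_ sy] := metric_product.
rewrite weylE; first by rewrite /weyl_sym !ricci_product.
by move=> j' k'; rewrite !ricci_product -{1}(sy x I).1 mxE.
Qed.

(** On mixed planes the curvature vanishes and [W] reduces to its Ricci part. A suitable [j] makes
    one of the two Kronecker terms vanish and gives the other coefficient 1, so the contraction with
    [xi] is the component [xi 0 i] times 1/3 or -1/3. *)
Lemma nondegenerate_weyl_product : nondegenerate_weyl setT Gam.
Proof.
move=> x _ xi xi0.
have [i xii] : exists i, xi 0 i != 0.
  apply/existsP; rewrite -negb_forall; apply: contra xi0 => /forallP H.
  by apply/eqP/rowP => i; rewrite mxE; apply/eqP; exact: H.
have n3 : (3%:R^-1 : R) != 0 by rewrite invr_eq0 pnatr_eq0.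
have [i2|i2] := ltnP i 2.
  exists o3, i, o2.
  have -> : \sum_a weyl Gam x a o3 i o2 * xi 0 a = 3%:R^-1 * \sum_a (a == i)%:R * xi 0 a.
    rewrite mulr_sumr; apply: eq_bigr => a _; rewrite weyl_product curvature_product_mixed //.
    have -> : product_metric x o3 i = 0.
      by move: i i2 {xii}; apply: ord4P => //= _; rewrite mxE /cubic /off_diag /=; ring.
    have -> : product_metric x o3 o2 = 1 by rewrite mxE /cubic /off_diag /=; ring.
    by ring.
  by rewrite sum_eqMl' mulf_neq0.
exists o1, o0, i.
have -> : \sum_a weyl Gam x a o1 o0 i * xi 0 a = - 3%:R^-1 * \sum_a (a == i)%:R * xi 0 a.
  rewrite mulr_sumr; apply: eq_bigr => a _; rewrite weyl_product curvature_product_mixed //.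
  have -> : product_metric x o1 i = 0.
    by move: i i2 {xii}; apply: ord4P => //= _; rewrite mxE /cubic /off_diag /=; ring.
  have -> : product_metric x o1 o0 = 1 by rewrite mxE /cubic /off_diag /=; ring.
  by ring.
by rewrite sum_eqMl' mulf_neq0 // oppr_eq0.
Qed.

(** Lowered by the metric, [W] is the Riemann tensor minus a tensor of constant-curvature type, and
    both have the symmetries required by (A). *)
Lemma solA_product x : solA Gam x (product_metric x).
Proof.
have oT : open [set: 'rV[R]_4] by exact: openT.
have [_ sy] := metric_product.
have gC i j : product_metric x i j = product_metric x j i by rewrite -{1}(sy x I).1 mxE.
have wE i j k m : \sum_s product_metric x i s * weyl Gam x s j k m =
    \sum_s product_metric x i s * curvature Gam x s j k m
    - 3%:R^-1 * (product_metric x i m * product_metric x j k - product_metric x i k * product_metric x j m).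
  rewrite -(sum_eqMr' m (fun s => product_metric x i s)) -(sum_eqMr' k (fun s => product_metric x i s)).
  rewrite !mulr_suml -sumrB mulr_sumr -sumrB; apply: eq_bigr => s _; rewrite weyl_product; ring.
split=> [|i j k m|i j k m]; first exact: (sy x I).1.
  rewrite !wE -[RHS](riemann_skew oT metric_product i j k m (I : setT x)); ring.
rewrite !wE (riemann_pair oT metric_product i j k m (I : setT x)).
by rewrite (gC m i) (gC k i) (gC m j) (gC k j); ring.
Qed.

(** Constant curvature would give W = 0; a product of two surfaces of equal curvature is still
    Einstein but has nondegenerate [W]. The determinant 1 makes [lam = 0] the potential, so the
    reconstruction returns the metric itself, whose Ricci tensor is the metric. *)
Lemma einstein_example : exists (p : 'rV[R]_4) (U : set 'rV[R]_4) (G : conn R),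
    [/\ small_nbhd p U, symmetric_connection U G, nondegenerate_weyl U G &
      exists a w lam g,
        [/\ nondegenerate_solA U G a, solB U G a w, closed_form U w &
          [/\ potential U lam w, metric U g, in_projective_class U G g,
              (forall x, U x -> sigma_of (g x) = expR (lam x) *: invmx (a x))
            & ~ ricci_flat U g]]].
Proof.
have oT : open [set: 'rV[R]_4] by exact: openT.
have sym := levi_civita_symmetric oT metric_product.
have pot : potential setT (fun=> 0) (fun=> 0 : 'rV[R]_4).
  split=> [|x _ i]; first exact: smooth_cst.
  by rewrite pderiv_cst mxE.
have proj : in_projective_class setT Gam product_metric.
  by exists (fun=> 0) => x _ i j k; rewrite !mxE !mulr0 !addr0.
exists 0, setT, Gam; split=> //; first exact: nondegenerate_weyl_product.
exists product_metric, (fun=> 0), (fun=> 0), product_metric; split.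
- by split=> [|x _]; [exact: metric_product|exact: solA_product].
- have s1 : smooth [set: 'rV[R]_4] (fun=> 1 : R) by exact: smooth_cst.
  have n1 (x : 'rV[R]_4) : setT x -> (1 : R) != 0 by rewrite oner_eq0.
  have [+ _] := projective_systemB oT metric_product s1 n1 sym.
  have -> : (fun y => 1 *: product_metric y) = product_metric by apply/funext => y; rewrite scale1r.
  move=> /(_ proj) B x _; have := B x I; congr (systemB _ _ _ _).
  apply/rowP => i; rewrite !mxE /log_gradient pderiv_cst mul0r subr0.
  have [smg sy] := metric_product.
  have ug y : setT y -> product_metric y \in unitmx by move=> _; exact: product_metric_unit.
  have := pderiv_det_unit oT smg ug i (I : setT x).
  rewrite det_product_metric mul1r => <-.
  have -> : (fun y => \det (product_metric y)) = (fun=> 1) by apply/funext => y; rewrite det_product_metric.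
  by rewrite pderiv_cst mulr0.
- exact: (gradient_closed oT pot).
- split=> //; first exact: metric_product.
    move=> x _; rewrite expR0 scale1r /sigma_of det_product_metric.
    by rewrite -[X in root5 X](expr1n _ 5) root5_exp5 scale1r.
  move=> /(_ 0 I o0 o1); rewrite ricci_product mxE /cubic /off_diag /= !mul0r !addr0 => /eqP.
  by rewrite oner_eq0.
Qed.
End EinsteinExample.

Theorem mainTheorem4 (R : realType) :
  (forall (p : 'rV[R]_4) (U : set 'rV[R]_4) (G : conn R),
    small_nbhd p U -> symmetric_connection U G -> nondegenerate_weyl U G ->
    (* (1) *)
    ((forall x, U x ->
        exists2 S : {vspace 'M[R]_4},
          (forall b, b \in S <-> solA G x b) & (\dim S <= 1)%N) /\
     (forall a, nondegenerate_solA U G a ->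
        forall x, U x -> forall v w : 'rV[R]_4,
          systemB G a x v -> systemB G a x w -> v = w)) /\
    (* (2) *)
    (forall gbar, metric U gbar -> in_projective_class U G gbar ->
        ricci_flat U gbar -> nonflat U gbar ->
        [/\ (forall g, metric U g -> in_projective_class U G g -> ricci_flat U g ->
               exists c : R, c != 0 /\ forall x, U x -> g x = c *: gbar x),
            (forall x, U x -> solA G x (gbar x)),
            (forall x, U x -> forall b, solA G x b -> exists c : R, b = c *: gbar x)
          & forall a, nondegenerate_solA U G a ->
              (exists w, solB U G a w) /\
              forall w, solB U G a w ->
                [/\ closed_form U w,
                    (exists lam, potential U lam w),
                    (forall lam, potential U lam w ->
                       exists c : R, c != 0 /\ forall x, U x ->
                         sigma_of (c *: gbar x) = expR (lam x) *: invmx (a x))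
                  & exists (e : bool) lam, potential U lam w /\
                      forall x, U x ->
                        sigma_of (gbar x) = expR (lam x) *: invmx ((-1) ^+ e *: a x)]]) /\
    (* (3) *)
    ((exists x, U x /\ forall b, solA G x b -> \det b = 0) \/
     (exists a, nondegenerate_solA U G a /\ ~ exists w, solB U G a w) \/
     (exists a w, [/\ nondegenerate_solA U G a, solB U G a w & ~ closed_form U w]) ->
     ~ exists g, [/\ metric U g, in_projective_class U G g & ricci_flat U g]) /\
    (* (4) *)
    (forall a w, nondegenerate_solA U G a -> solB U G a w -> closed_form U w ->
       (exists lam, potential U lam w) /\
       forall lam, potential U lam w ->
         exists g, [/\ metric U g, in_projective_class U G g &
           forall x, U x -> sigma_of (g x) = expR (lam x) *: invmx (a x)])) /\
  (* (4), "need not be Ricci-flat" *)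
  (exists (p : 'rV[R]_4) (U : set 'rV[R]_4) (G : conn R),
    [/\ small_nbhd p U, symmetric_connection U G, nondegenerate_weyl U G &
      exists a w lam g,
        [/\ nondegenerate_solA U G a, solB U G a w, closed_form U w &
          [/\ potential U lam w, metric U g, in_projective_class U G g,
              (forall x, U x -> sigma_of (g x) = expR (lam x) *: invmx (a x))
            & ~ ricci_flat U g]]]).
Proof.
split; last exact: einstein_example.
move=> p U G sU sG nd.
have oU : open U by have [] := sU.
split; [split|split; [|split]].
- by move=> x Ux; apply: solA_space; exact: nd.
- move=> a [[_ H] _] x Ux v w; have [sa ua] := H x Ux.
  exact: systemB_unique.
- move=> gbar mb pb rb nf; split.
  + by move=> g mg pg rg; exact: (ricci_flat_unique sU sG nd mb pb rb mg pg rg).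
  + by move=> x Ux; exact: (ricci_flat_solA oU sG mb pb rb Ux).
  + move=> x Ux b sb.
    apply: (solA_multiple nd Ux (nondegenerate_field_neq0 mb Ux) _ sb).
    exact: (ricci_flat_solA oU sG mb pb rb Ux).
  + by move=> a; exact: (ricci_flat_reconstruction sU sG nd mb pb rb).
- exact: (no_ricci_flat sU sG nd).
- by move=> a w sa Bw cw; exact: (metric_of_solution sU sG sa Bw cw).
Qed.
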